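(* Let $n,a\in\mathbb{N}$ with $a$ odd, let $\lambda\in\mathbb{C}$ with $\lambda^4\ne 0,1$, and suppose there is a natural number $c$ with $c\cdot 2^{n-1}=2a+2$. Let $S_{a,\lambda}$ be the compact Riemann surface defined by $y^{2^{n}}=x^{a}(x^{2}-1)^{a}(x^{2}-\lambda^{2})(x^{2}-\lambda^{-2})$, and let $\tau_1,\tau_2$ be the self-maps of $S_{a,\lambda}$ defined by $$\tau_1(x,y)=(-x,\ \omega_{2^{n+1}}y),\qquad \tau_2(x,y)=\left(\frac1x,\ \frac{\omega_{2^{n+1}}y}{x^{c}}\right).$$ Then $\tau_1,\tau_2\in\mathrm{Aut}(S_{a,\lambda})$ and each has order $2^{n+1}$. Furthermore: (1) If $c$ is even, then $G_1=\langle\tau_1,\tau_2\rangle$ is an abelian group isomorphic to $\mathbb{Z}/2^{n+1}\mathbb{Z}\times\mathbb{Z}/2\mathbb{Z}$. (2) If $c$ is odd, then $G_2=\langle\tau_1,\tau_2\rangle$ is isomorphic to $\mathbb{Z}/2^{n+1}\mathbb{Z}\rtimes_h\mathbb{Z}/2\mathbb{Z}$, where $\tau_2\tau_1=\tau_1^{2^n+1}\tau_2$.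
   Context: $\omega_m=\exp(2\pi i/m)$. $S_{a,\lambda}$ denotes the compact Riemann surface obtained by normalizing the projective closure of the plane curve, and $\mathrm{Aut}(S_{a,\lambda})$ is its group of biholomorphic self-maps; $\tau_1,\tau_2$ are understood as maps of the compact surface determined by the given formulas. In (2), $h:\mathbb{Z}/2\mathbb{Z}\to\mathrm{Aut}(\mathbb{Z}/2^{n+1}\mathbb{Z})$ sends the generator to multiplication by $2^n+1$. *)

(* Defs.v *)
From HB Require Import structures.
From mathcomp Require Import all_boot all_order all_algebra all_fingroup.
From mathcomp Require Import all_classical all_reals all_analysis.
From mathcomp Require Import complex zify.
From mathcomp Require mpoly.
Import (canonicals, coercions) mpoly.

Set Implicit Arguments.
Unset Strict Implicit.
Unset Printing Implicit Defensive.

Import Order.TTheory GRing.Theory Num.Theory numFieldNormedType.Exports.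

Local Open Scope classical_set_scope.
Local Open Scope ring_scope.

(* The regular module R[i]^o is the copy of the complex numbers that carries
   the norm topology. *)
Notation Cplx R := ((R[i])^o).

Definition holomorphic_on (R : realType) (D : set (Cplx R))
    (f : Cplx R -> Cplx R) : Prop :=
  forall z, D z -> derivable f z 1.

(* chart_inv is only meaningful on the open set chart_map @` chart_dom. *)
Record chart (R : realType) (S : topologicalType) := Chart {
  chart_dom : set S;
  chart_map : S -> Cplx R;
  chart_inv : Cplx R -> S;
  chart_dom_open : open chart_dom;
  chart_img_open : open (chart_map @` chart_dom);
  chart_mapK : forall p, chart_dom p -> chart_inv (chart_map p) = p;
  chart_map_cont : forall p, chart_dom p -> {for p, continuous chart_map};
  chart_inv_cont : forall z, (chart_map @` chart_dom) z ->
    {for z, continuous chart_inv} }.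

Record riemannSurface (R : realType) := RiemannSurface {
  rs_carrier :> topologicalType;
  rs_hausdorff : hausdorff_space rs_carrier;
  rs_connected : connected [set: rs_carrier];
  rs_atlas : set (chart R rs_carrier);
  rs_cover : forall p, exists2 phi, rs_atlas phi & chart_dom phi p;
  rs_compat : forall phi psi, rs_atlas phi -> rs_atlas psi ->
    holomorphic_on (chart_map phi @` (chart_dom phi `&` chart_dom psi))
      (chart_map psi \o chart_inv phi) }.

Definition holomorphic_fun (R : realType) (S : riemannSurface R) (U : set S)
    (g : S -> Cplx R) : Prop :=
  forall phi, rs_atlas phi ->
    holomorphic_on (chart_map phi @` (chart_dom phi `&` U))
      (g \o chart_inv phi).

Definition holomorphic_map (R : realType) (S T : riemannSurface R)
    (f : S -> T) : Prop :=
  continuous f /\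
  forall phi psi, rs_atlas phi -> rs_atlas psi ->
    holomorphic_on (chart_map phi @` (chart_dom phi `&` f @^-1` chart_dom psi))
      (chart_map psi \o f \o chart_inv phi).

Section HolomorphicMaps.
Variable R : realType.
Implicit Types S T U : riemannSurface R.

Lemma holomorphic_id S : holomorphic_map (@idfun S).
Proof.
split; first by move=> p.
by move=> phi psi Aphi Apsi; exact: rs_compat.
Qed.

Lemma holomorphic_comp S T U (f : S -> T) (g : T -> U) :
  holomorphic_map f -> holomorphic_map g -> holomorphic_map (g \o f).
Proof.
move=> [fc fh] [gc gh]; split.
  by move=> p; apply: continuous_comp; [exact: fc|exact: gc].
move=> phi chi Aphi Achi _ [p [phip chip] <-].
have [psi Apsi psip] := rs_cover (f p).
have dF : derivable (chart_map psi \o f \o chart_inv phi) (chart_map phi p) 1.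
  by apply: fh => //; exists p.
have dG : derivable (chart_map chi \o g \o chart_inv psi)
    (chart_map psi (f p)) 1.
  by apply: gh => //; exists (f p).
have E : (chart_map psi \o f \o chart_inv phi) (chart_map phi p) =
    chart_map psi (f p) by rewrite /= chart_mapK.
have near_dom : \forall z \near chart_map phi p,
    chart_dom psi (f (chart_inv phi z)).
  have cfp : {for chart_map phi p, continuous (f \o chart_inv phi)}.
    by apply: continuous_comp; [apply: chart_inv_cont; exists p|exact: fc].
  apply: cfp; rewrite /= chart_mapK //.
  exact: open_nbhs_nbhs (conj (chart_dom_open psi) psip).
apply: (@near_eq_derivable _ _ _ ((chart_map chi \o g \o chart_inv psi) \o
   (chart_map psi \o f \o chart_inv phi))).
  near=> z; rewrite /= chart_mapK //; near: z; exact: near_dom.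
move/derivable1_diffP: dF => dF; move/derivable1_diffP: dG => dG.
apply/derivable1_diffP; apply: differentiable_comp; first exact: dF.
by rewrite E.
Unshelve. all: by end_near. Qed.

End HolomorphicMaps.

Definition biholomorphic (R : realType) (S : riemannSurface R) (f : S -> S) :
    Prop :=
  exists g : S -> S,
    [/\ cancel f g, cancel g f, holomorphic_map f & holomorphic_map g].

Record AutRS (R : realType) (S : riemannSurface R) := MkAut {
  aut_fun :> S -> S;
  aut_biholo : biholomorphic aut_fun }.

Section AutGroup.
Variables (R : realType) (S : riemannSurface R).
Implicit Types f g h : AutRS S.

Lemma aut_eq f g : f =1 g :> (S -> S) -> f = g.
Proof.
case: f g => [f fP] [g gP] /= /funext fg; case: g / fg gP => gP.
by congr MkAut; exact: Prop_irrelevance.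
Qed.

Lemma aut_one_subproof : biholomorphic (@idfun S).
Proof. by exists idfun; split => //; exact: holomorphic_id. Qed.

Definition aut_one : AutRS S := MkAut aut_one_subproof.

Lemma aut_mul_subproof f g : biholomorphic (f \o g).
Proof.
have [f' [fK f'K fh f'h]] := aut_biholo f.
have [g' [gK g'K gh g'h]] := aut_biholo g.
exists (g' \o f'); split; [exact: can_comp|exact: can_comp| |];
  exact: holomorphic_comp.
Qed.

Definition aut_mul f g : AutRS S := MkAut (aut_mul_subproof f g).

Lemma aut_inv_subproof f : biholomorphic (projT1 (cid (aut_biholo f))).
Proof. by case: cid => f' [fK f'K fh f'h] /=; exists f. Qed.

Definition aut_inv f : AutRS S := MkAut (aut_inv_subproof f).

Lemma aut_mulA : associative aut_mul.
Proof. by move=> f g h; exact: aut_eq. Qed.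

Lemma aut_mul1g : left_id aut_one aut_mul.
Proof. by move=> f; exact: aut_eq. Qed.

Lemma aut_mulg1 : right_id aut_one aut_mul.
Proof. by move=> f; exact: aut_eq. Qed.

Lemma aut_mulVg : left_inverse aut_one aut_inv aut_mul.
Proof.
by move=> f; apply: aut_eq => p; rewrite /aut_inv /=; case: cid => f' [].
Qed.

Lemma aut_mulgV : right_inverse aut_one aut_inv aut_mul.
Proof.
by move=> f; apply: aut_eq => p; rewrite /aut_inv /=; case: cid => f' [].
Qed.

HB.instance Definition _ := gen_eqMixin (AutRS S).
HB.instance Definition _ := gen_choiceMixin (AutRS S).
HB.instance Definition _ := isGroup.Build (AutRS S)
  aut_mulA aut_mul1g aut_mulg1 aut_mulVg aut_mulgV.

End AutGroup.

(* A point of the complex projective plane is a line through 0 in C^3. *)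
Definition P2 (R : realType) := {L : {vspace 'rV[R[i]]_3} | \dim L == 1%N}.

Definition vec3 (R : realType) (x y z : R[i]) : 'rV[R[i]]_3 :=
  \row_(j < 3) [:: x; y; z]`_j.

(* P is the point [x : y : 1]. *)
Definition affine_point (R : realType) (P : P2 R) (x y : R[i]) : Prop :=
  val P = <[vec3 x y 1]>%VS.

(* Near every point, s = [v_0 : v_1 : v_2] for holomorphic v_0, v_1, v_2; they
   have no common zero because the line s q has dimension 1. *)
Definition holomorphic_to_P2 (R : realType) (S : riemannSurface R)
    (s : S -> P2 R) : Prop :=
  forall p, exists (U : set S) (v : S -> 'rV[R[i]]_3),
    [/\ open U, U p,
        forall q, U q -> val (s q) = <[v q]>%VS &
        forall j : 'I_3, holomorphic_fun U (fun q => v q ord0 j)].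

Definition mvar (R : realType) (n : nat) (i : 'I_n) : mpoly.mpoly n R[i] :=
  mpoly.mpolyX R[i] (mpoly.mnm1 i).

(* Z^d f(X/Z, Y/Z), where d is the total degree of f. *)
Definition homogenize (R : realType) (f : mpoly.mpoly 2 R[i]) :
    mpoly.mpoly 3 R[i] :=
  let d := (\max_(m <- mpoly.msupp f) mpoly.mdeg m)%N in
  \sum_(m <- mpoly.msupp f) mpoly.mcoeff m f *:
    (mvar R (inord 0 : 'I_3) ^+ m (inord 0) *
     mvar R (inord 1 : 'I_3) ^+ m (inord 1) *
     mvar R (inord 2 : 'I_3) ^+ (d - mpoly.mdeg m)%N).

Definition vanishes_at (R : realType) (F : mpoly.mpoly 3 R[i]) (P : P2 R) :
    Prop :=
  forall v : 'rV[R[i]]_3, v \in val P -> mpoly.meval (v ord0) F = 0.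

Definition projective_closure (R : realType) (f : mpoly.mpoly 2 R[i]) :
    set (P2 R) :=
  [set P | vanishes_at (homogenize f) P].

(* The Jacobian criterion; f is assumed to be square-free. *)
Definition singular_locus (R : realType) (f : mpoly.mpoly 2 R[i]) :
    set (P2 R) :=
  [set P | projective_closure f P /\
           forall j, vanishes_at (mpoly.mderiv j (homogenize f)) P].

(* s : S -> P2 exhibits S as the normalization of the projective closure C of
   the irreducible plane curve f = 0: S is a compact Riemann surface, s is
   holomorphic with image C, and s is injective outside the finite preimage of
   the singular points of C.  This determines (S, s) up to a unique
   biholomorphism over C. *)
Record normalization (R : realType) (f : mpoly.mpoly 2 R[i])
    (S : riemannSurface R) (s : S -> P2 R) : Prop := Normalization {
  norm_compact : compact [set: S];
  norm_holomorphic : holomorphic_to_P2 s;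
  norm_image : range s = projective_closure f;
  norm_finite : finite_set (s @^-1` singular_locus f);
  norm_inj : {in ~` (s @^-1` singular_locus f) &, injective s} }.

(* y^(2^n) - x^a (x^2 - 1)^a (x^2 - l^2) (x^2 - l^-2) *)
Definition curve (R : realType) (n a : nat) (l : R[i]) : mpoly.mpoly 2 R[i] :=
  let x := mvar R (inord 0 : 'I_2) in
  let y := mvar R (inord 1 : 'I_2) in
  y ^+ (2 ^ n) - x ^+ a * (x ^+ 2 - 1) ^+ a *
    (x ^+ 2 - (l ^+ 2)%:A) * (x ^+ 2 - (l ^- 2)%:A).

(* exp(2 pi i / m) *)
Definition omega (R : realType) (m : nat) : R[i] :=
  (cos (2 * pi / m%:R) +i* sin (2 * pi / m%:R))%C.

Definition tau1_formula (R : realType) (n : nat) (S : riemannSurface R)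
    (s : S -> P2 R) (t : S -> S) : Prop :=
  forall p x y, affine_point (s p) x y ->
    affine_point (s (t p)) (- x) (omega R (2 ^ n.+1) * y).

Definition tau2_formula (R : realType) (n c : nat) (S : riemannSurface R)
    (s : S -> P2 R) (t : S -> S) : Prop :=
  forall p x y, x != 0 -> affine_point (s p) x y ->
    affine_point (s (t p)) x^-1 (omega R (2 ^ n.+1) * y / x ^+ c).

(* The formula may be undefined at finitely many points; t is the only
   continuous self-map of S that satisfies it where it makes sense. *)
Definition determined_by (S : topologicalType) (formula : (S -> S) -> Prop)
    (t : S -> S) : Prop :=
  formula t /\ forall u : S -> S, continuous u -> formula u -> u = t.

Definition has_order (G : groupType) (g : G) (m : nat) : Prop :=
  [/\ (0 < m)%N, (g ^+ m = 1)%g &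
      forall k, (0 < k < m)%N -> (g ^+ k)%g <> 1%g].

(* The subgroup <g, h> of a possibly infinite group. *)
Definition gen2 (G : groupType) (g h : G) : set G :=
  [set k | forall H : {pred G},
     group_closed H -> g \in H -> h \in H -> k \in H].

Definition is_abelian (G : groupType) (H : set G) : Prop :=
  forall g h, H g -> H h -> (g * h = h * g)%g.

Definition isomorphic_to (G : groupType) (H : set G) (K : groupType) : Prop :=
  exists phi : K -> G,
    [/\ {morph phi : x y / (x * y)%g}, injective phi & range phi = H].

Section SemidirectAction.
Variables (n : nat) (n_gt0 : (0 < n)%N).

(* Multiplication by (2^n + 1)^e, so that the generator 1 of Z/2 acts as
   multiplication by 2^n + 1. *)
Definition h_act (x : 'Z_(2 ^ n.+1)) (e : 'Z_2) : 'Z_(2 ^ n.+1) :=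
  x *+ (2 ^ n).+1 ^ e.

Lemma h_act_twice (x : 'Z_(2 ^ n.+1)) : x *+ (2 ^ n).+1 *+ (2 ^ n).+1 = x.
Proof.
have N1 : (1 < 2 ^ n.+1)%N by rewrite -{1}(expn0 2) ltn_exp2l.
rewrite -mulrnA.
have -> : ((2 ^ n).+1 * (2 ^ n).+1 = 2 ^ n.+1 * (2 ^ n.-1).+1 + 1)%N.
  by case: n n_gt0 => // m _; rewrite -pred_Sn !expnS; nia.
by rewrite mulrnDr mulrnA -[x *+ 2 ^ _]mulr_natr pchar_Zp // mulr0 mul0rn add0r.
Qed.

Lemma h_act1 : h_act^~ 1%g =1 id.
Proof. by move=> x; rewrite /h_act expn0 mulr1n. Qed.

Lemma h_actM x : act_morph h_act x.
Proof.
case=> [[|[|[]]] Ha] // [[|[|[]]] Hb] //;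
  by rewrite /h_act /= ?expn0 ?expn1 ?mulr1n ?h_act_twice.
Qed.

Definition h_action : {action 'Z_2 &-> 'Z_(2 ^ n.+1)} :=
  TotalAction h_act1 h_actM.

Lemma h_is_groupAction : is_groupAction [set: 'Z_(2 ^ n.+1)]%SET h_action.
Proof.
move=> e _; rewrite inE; apply/andP; split.
  by apply/fintype.subsetP => x _; rewrite inE.
by apply/morphicP => x y _ _; rewrite !actpermE; exact: mulrnDl.
Qed.

(* h : Z/2 -> Aut(Z/2^(n+1)) *)
Definition h_groupAction : groupAction [set: 'Z_2]%SET [set: 'Z_(2 ^ n.+1)]%SET :=
  GroupAction h_is_groupAction.

End SemidirectAction.

(* Main.v *)
Require Import Defs.
From HB Require Import structures.
From mathcomp Require Import all_boot all_order all_algebra all_fingroup.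
From mathcomp Require Import all_classical all_reals all_analysis.
From mathcomp Require Import complex ring lra zify.
From mathcomp Require mpoly.
Import (canonicals, coercions) mpoly.

Import Order.TTheory GRing.Theory Num.Theory numFieldNormedType.Exports.
Import Normc.

Set Implicit Arguments.
Unset Strict Implicit.
Unset Printing Implicit Defensive.

Local Open Scope classical_set_scope.
Local Open Scope ring_scope.

Local Notation Re := complex.Re.
Local Notation Im := complex.Im.

(** On the part of the curve y^N = P(x), N = 2^n, where x and y do not vanish,
    both formulas define bijections: P(-x) = -P(x) since a is odd, the equation
    2a + 2 = c 2^(n-1) gives P(1/x) = -P(x) / x^(cN), and the 2^(n+1)-th root of
    unity w satisfies w^N = -1.  The points of the curve with x, y <> 0 are
    nonsingular, so the normalization [s] is injective above them, and only
    finitely many points of [S] remain.  The work consists in showing that such a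
    bijection of a cofinite subset of [S] is the restriction of an automorphism,
    knowing of [S] only that it is a compact Riemann surface and that [s] is
    holomorphic ([torus_map_lift]).

    Continuity.  Let [t] be the bijection.  If [t q] did not tend to [t p], it would
    accumulate at another point k of the compact surface; but homogeneous
    coordinates of [s] near k separate [s k] from the point to which the formula
    converges ([acts_by_continuous]).

    Extension.  Let B be the finite set of remaining points.  Near a point of B the
    map [t] takes values close to B, because its inverse is continuous outside B;
    and since a small punctured disc is connected, these values stay close to a
    single point of B, which is then the limit ([limit_at_exceptional]).  The
    extensions of [t] and of its inverse are inverse to each other by density.

    Holomorphy.  Where x, y <> 0 the function x is holomorphic and locally
    injective, and its composite with [t] is holomorphic, hence so is [t]
    ([derivable_lift]).  At the points of B one uses Riemann's theorem on removable
    singularities ([removable_singularity]).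

    Both results of complex analysis are derived from complex differentiability
    alone.  Goursat's bisection argument gives the vanishing of integrals over
    rectangles ([rect_int_eq0]), hence a local primitive F of a holomorphic f
    ([local_primitive]).  Difference quotients of F approximate f and have
    expansions of order two, and the modulus of a function with such expansions has
    no strict local maximum, as one sees by averaging over four points; this gives
    the maximum modulus principle for f ([max_modulus]).  It remains valid when f is
    only continuous at finitely many points ([max_modulus_punctured]), and applied
    to difference quotients it bounds them and makes them Lipschitz, so that a
    function holomorphic around c and continuous at c has a derivative at c.

    The groups.  Call t1 and t2 the two automorphisms.  Comparing the formulas at
    points with x, y <> 0, which determine an automorphism, gives
    t1^2 = t2^2 and t1^N = ((x, y) |-> (x, -y)),
    and t1, t2 commute up to the factor (-1)^c on y; moreover t2 is not a power of
    t1, since 1/x is neither x nor -x at a general point.  So t1 and t2 have order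
    2^(n+1), and the group they generate is the product of <t1> and the group
    generated by an involution b outside <t1>: one may take b = t1^-1 t2 if c is
    even and b = t2 t1^(2^(n-1) - 1) if c is odd, where n > 1 because
    c 2^(n-1) = 2 (a + 1) is even ([commuting_case], [twisted_case]). *)

(** * Modulus, neighbourhoods and derivatives of complex functions *)

Section Modulus.
Variable R : realType.
Implicit Types z w : R[i].

Lemma normc_ge0 z : 0 <= normc z.
Proof. by case: z => a b; exact: sqrtr_ge0. Qed.

Lemma normr_normc z : `|z| = (normc z)%:C%C.
Proof. by case: z => a b; rewrite normc_def. Qed.

Lemma normc_gt0 z : (0 < normc z) = (z != 0).
Proof. by rewrite -ltcR -normr_normc normr_gt0. Qed.

Lemma normcD z w : normc (z + w) <= normc z + normc w.
Proof. exact: le_normcD. Qed.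

Lemma normcB z w : normc (z - w) = normc (w - z).
Proof. by rewrite -opprB normcN. Qed.

Lemma normc_dist z w : normc z - normc w <= normc (z - w).
Proof. by have := normcD (z - w) w; rewrite subrK; lra. Qed.

Lemma normcX z n : normc (z ^+ n) = normc z ^+ n.
Proof. by elim: n => [|n IH]; rewrite ?normc1// !exprS normcM IH. Qed.

Lemma normc_div z w : normc (z / w) = normc z / normc w.
Proof. by rewrite normcM normcV. Qed.

Lemma normc_real (x : R) : normc x%:C%C = `|x|.
Proof. by rewrite /= expr0n addr0 sqrtr_sqr. Qed.

Lemma normcE2 z : normc z ^+ 2 = Re z ^+ 2 + Im z ^+ 2.
Proof. by case: z => a b; rewrite sqr_sqrtr// addr_ge0 ?sqr_ge0. Qed.

Lemma normc_Re z : `|Re z| <= normc z.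
Proof.
by rewrite -(ler_pXn2r (n := 2)) ?nnegrE ?normc_ge0// normcE2 real_normK ?num_real// lerDl sqr_ge0.
Qed.

Lemma normc_Im z : `|Im z| <= normc z.
Proof.
by rewrite -(ler_pXn2r (n := 2)) ?nnegrE ?normc_ge0// normcE2 real_normK ?num_real// lerDr sqr_ge0.
Qed.

Lemma normc_ReIm z : normc z <= `|Re z| + `|Im z|.
Proof.
rewrite -(ler_pXn2r (n := 2)) ?nnegrE ?normc_ge0 ?addr_ge0//.
rewrite normcE2 -(real_normK (num_real (Re z))) -(real_normK (num_real (Im z))).
by have := normr_ge0 (Re z); have := normr_ge0 (Im z); nra.
Qed.

(** The norm of [Cplx R] takes complex values, so balls have complex radii; all
    estimates below use real radii instead. *)
Lemma near_discP (z : Cplx R) (P : Cplx R -> Prop) :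
  (\forall w \near z, P w) <->
  exists2 d : R, 0 < d & forall w : R[i], normc (w - z) < d -> P w.
Proof.
split.
  move=> /nbhs_ballP[e /= e0 He]; move: e0; rewrite ltcE => /andP[/eqP /= ie re].
  exists (Re e) => // w wd; apply: He; rewrite /ball /= normr_normc ltcE /=.
  by rewrite -ie eqxx /= normcB.
move=> [d d0 H]; apply/nbhs_ballP; exists d%:C%C => /=; first by rewrite ltcR.
by move=> w; rewrite /ball /= normr_normc ltcR normcB; exact: H.
Qed.

Lemma continuous_normcP (T : topologicalType) (f : T -> Cplx R) (p : T) :
  {for p, continuous f} <->
  forall e : R, 0 < e -> \forall q \near p, normc ((f q : R[i]) - (f p : R[i])) < e.
Proof.
split=> [fc e e0|H].
  have : \forall w \near (f p : Cplx R), normc (w - f p) < e.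
    by apply/near_discP; exists e.
  by move/fc.
move=> A /near_discP[d d0 HA]; move: (H d d0); apply: filterS => q /=; exact: HA.
Qed.

(** Unlike ['D_1 f z], this comes as an inequality that also holds at w = z. *)
Definition has_deriv (f : R[i] -> R[i]) (z l : R[i]) :=
  forall e : R, 0 < e -> \forall w \near (z : Cplx R),
    normc (f w - f z - l * (w - z)) <= e * normc (w - z).

Lemma derivable_normcP (f : Cplx R -> Cplx R) (z : Cplx R) :
  derivable f z 1 <-> exists l, has_deriv f z l.
Proof.
split.
  move=> df; exists ('D_1 f z) => e e0.
  have : (fun h : Cplx R => h^-1 *: (f (h *: (1 : Cplx R) + z) - f z)) @ 0^' -->
    ('D_1 f z : Cplx R) by exact: df.
  set l := 'D_1 f z => Hl.
  have : \forall w \near (l : Cplx R), normc (w - l) <= e.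
    by apply/near_discP; exists e => // w /ltW.
  move=> /Hl; rewrite /fmap/= => -[/= d d0 Hd].
  apply/nbhs_ballP; exists d => // w wz.
  have [->|wnz] := eqVneq w z; first by rewrite !subrr mulr0 subr0 normc0 mulr0.
  have wz0 : w - z != 0 by rewrite subr_eq0.
  have bwz : ball (0 : Cplx R) d (w - z).
    by move: wz; rewrite /ball /= sub0r normrN distrC.
  have := Hd (w - z) bwz wz0.
  rewrite [(w - z) *: _]mulr1 subrK -ler_pdivrMr ?normc_gt0// -normc_div.
  rewrite mulrBl mulfK// => H; apply: le_trans H.
  by rewrite [X in normc (X - l)]mulrC.
move=> [l Hl]; apply/cvg_ex; exists l => A /near_discP[d d0 HA].
have d2 : 0 < d / 2 by lra.
have /near_discP[r r0 Hr] := Hl _ d2.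
exists r%:C%C => /=; first by rewrite ltcR.
move=> h; rewrite /ball /= sub0r normrN normr_normc ltcR => hr h0.
have := Hr (h + z); rewrite addrK => /(_ hr) H.
apply: HA; rewrite [h *: 1]mulr1.
rewrite [_ *: _]mulrC -[X in _ / h - X](mulfK h0) -mulrBl normc_div.
rewrite ltr_pdivrMr ?normc_gt0//.
apply: le_lt_trans H _; rewrite ltr_pM2r ?normc_gt0//; lra.
Qed.

End Modulus.

(** * Closure properties of continuity and complex differentiability *)

Section Closure.
Variable R : realType.
Implicit Types (f g : Cplx R -> Cplx R) (z c : Cplx R).

Section Continuity.
Variables (T : topologicalType) (p : T).
Implicit Types h k : T -> Cplx R.

Lemma continuous_cplx_cst c : {for p, continuous (fun _ : T => c)}.
Proof. exact: cvg_cst. Qed.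

Lemma continuous_cplxD h k : {for p, continuous h} -> {for p, continuous k} ->
  {for p, continuous (fun x => (h x : R[i]) + (k x : R[i]) : Cplx R)}.
Proof. move=> hc kc; exact: (@cvgD R[i] (Cplx R) T (nbhs p) _ h k (h p) (k p) hc kc). Qed.

Lemma continuous_cplxN h : {for p, continuous h} ->
  {for p, continuous (fun x => - (h x : R[i]) : Cplx R)}.
Proof. move=> hc; exact: (@cvgN R[i] (Cplx R) T (nbhs p) _ h (h p) hc). Qed.

Lemma continuous_cplxB h k : {for p, continuous h} -> {for p, continuous k} ->
  {for p, continuous (fun x => (h x : R[i]) - (k x : R[i]) : Cplx R)}.
Proof. move=> hc kc; exact: (@cvgB R[i] (Cplx R) T (nbhs p) _ h k (h p) (k p) hc kc). Qed.

Lemma continuous_cplxM h k : {for p, continuous h} -> {for p, continuous k} ->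
  {for p, continuous (fun x => (h x : R[i]) * (k x : R[i]) : Cplx R)}.
Proof. move=> hc kc; exact: (@cvgM R[i] T (nbhs p) _ h k (h p) (k p) hc kc). Qed.

Lemma continuous_cplxV h : {for p, continuous h} -> h p != 0 ->
  {for p, continuous (fun x => (h x : R[i])^-1 : Cplx R)}.
Proof. move=> hc hp; exact: (@cvgV R[i] T (nbhs p) _ h (h p) hp hc). Qed.

Lemma continuous_cplx_div h k : {for p, continuous h} -> {for p, continuous k} ->
  k p != 0 -> {for p, continuous (fun x => (h x : R[i]) / (k x : R[i]) : Cplx R)}.
Proof. by move=> hc kc k0; exact: (continuous_cplxM hc (continuous_cplxV kc k0)). Qed.

Lemma continuous_cplxX h n : {for p, continuous h} ->
  {for p, continuous (fun x => (h x : R[i]) ^+ n : Cplx R)}.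
Proof.
move=> hc; elim: n => [|n IH]; first exact: continuous_cplx_cst.
rewrite (_ : (fun _ => _) = (fun x => (h x : R[i]) * (h x : R[i]) ^+ n : Cplx R)).
  exact: (continuous_cplxM hc IH).
by apply/funext => x; rewrite exprS.
Qed.

Lemma continuous_cplx_prod (I : Type) (s : seq I) (F : I -> T -> Cplx R) :
  (forall i, {for p, continuous (F i)}) ->
  {for p, continuous (fun x => \prod_(i <- s) (F i x : R[i]) : Cplx R)}.
Proof.
move=> Fc; elim: s => [|i s IH].
  by rewrite (_ : (fun _ => _) = fun=> 1); [exact: continuous_cplx_cst|apply/funext => x;
    rewrite big_nil].
rewrite (_ : (fun _ => _) = (fun x => (F i x : R[i]) * \prod_(i <- s) (F i x : R[i]) : Cplx R)).
  exact: (continuous_cplxM (Fc i) IH).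
by apply/funext => x; rewrite big_cons.
Qed.

Lemma near_eq_continuous h k : (\forall x \near p, h x = k x) ->
  {for p, continuous h} -> {for p, continuous k}.
Proof.
move=> hk /continuous_normcP hc; apply/continuous_normcP => e /hc.
have hp := nbhs_singleton hk; apply: filterS2 hk => x -> ; rewrite hp.
exact.
Qed.

End Continuity.

Lemma continuous_cplx_id z : {for z, continuous (fun x : Cplx R => x)}.
Proof. exact: cvg_id. Qed.

Lemma derivable_cplx_continuous f z : derivable f z 1 -> {for z, continuous f}.
Proof. by move=> /derivable1_diffP /differentiable_continuous. Qed.

Lemma derivable_cplx_cst c z : derivable (fun _ : Cplx R => c) z 1.
Proof. exact: derivable_cst. Qed.

Lemma derivable_cplx_id z : derivable (fun x : Cplx R => x) z 1.
Proof. exact: derivable_id. Qed.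

Lemma derivable_cplxN f z : derivable f z 1 -> derivable (fun x => - (f x : R[i]) : Cplx R) z 1.
Proof. exact: (@derivableN R[i] (Cplx R) (Cplx R) f z 1). Qed.

Lemma derivable_cplxB f g z : derivable f z 1 -> derivable g z 1 ->
  derivable (fun x => (f x : R[i]) - (g x : R[i]) : Cplx R) z 1.
Proof. exact: (@derivableB R[i] (Cplx R) (Cplx R) f g z 1). Qed.

Lemma derivable_cplxM f g z : derivable f z 1 -> derivable g z 1 ->
  derivable (fun x => (f x : R[i]) * (g x : R[i]) : Cplx R) z 1.
Proof. move=> df dg; exact: (@derivableM R[i] (Cplx R) f g z 1 df dg). Qed.

Lemma derivable_cplxV f z : f z != 0 -> derivable f z 1 ->
  derivable (fun x => (f x : R[i])^-1 : Cplx R) z 1.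
Proof. move=> f0 df; exact: (@derivableV R[i] (Cplx R) f z 1 f0 df). Qed.

Lemma derivable_cplx_div f g z : g z != 0 -> derivable f z 1 -> derivable g z 1 ->
  derivable (fun x => (f x : R[i]) / (g x : R[i]) : Cplx R) z 1.
Proof. by move=> g0 df dg; exact: (derivable_cplxM df (derivable_cplxV g0 dg)). Qed.

Lemma derivable_cplxX f n z : derivable f z 1 -> derivable (fun x => (f x : R[i]) ^+ n : Cplx R)
  z 1.
Proof.
move=> df; elim: n => [|n IH]; first exact: derivable_cplx_cst.
rewrite (_ : (fun _ => _) = (fun x => (f x : R[i]) * (f x : R[i]) ^+ n : Cplx R)).
  exact: (derivable_cplxM df IH).
by apply/funext => x; rewrite exprS.
Qed.

Lemma derivable_cplx_prod (I : Type) (s : seq I) (F : I -> Cplx R -> Cplx R) z :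
  (forall i, derivable (F i) z 1) -> derivable (fun x => \prod_(i <- s) (F i x : R[i]) : Cplx R)
    z 1.
Proof.
move=> Fd; elim: s => [|i s IH].
  by rewrite (_ : (fun _ => _) = fun=> 1); [exact: derivable_cplx_cst|apply/funext => x;
    rewrite big_nil].
rewrite (_ : (fun _ => _) = (fun x => (F i x : R[i]) * \prod_(i <- s) (F i x : R[i]) : Cplx R)).
  exact: (derivable_cplxM (Fd i) IH).
by apply/funext => x; rewrite big_cons.
Qed.

Lemma near_eq_derivable_cplx f g z : (\forall x \near z, f x = g x) ->
  derivable f z 1 -> derivable g z 1.
Proof. exact: near_eq_derivable. Qed.

Lemma derivable_cplx_comp f g z : derivable f z 1 -> derivable g (f z) 1 ->
  derivable (fun x => g (f x)) z 1.
Proof.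
move=> /derivable1_diffP df /derivable1_diffP dg; apply/derivable1_diffP.
exact: (@differentiable_comp R[i] (Cplx R) (Cplx R) (Cplx R) f g z df dg).
Qed.

End Closure.

(** * Goursat's theorem on rectangles *)

Section SegmentIntegral.
Variable R : realType.

Lemma continuous_primitive (g : R -> R) (a b : R) : a <= b ->
  (forall t, t \in `[a, b] -> {for t, continuous g}) ->
  exists G : R -> R, forall t : R, t \in `[a, b] -> is_derive t (1 : R) G (g t).
Proof.
move=> ab gc.
pose cl (t : R) := Num.max a (Num.min b t).
have clc : continuous cl.
  move=> t; apply: continuous_max; first exact: cvg_cst.
  by apply: continuous_min; [exact: cvg_cst|exact: cvg_id].
have cl_id t : t \in `[a, b] -> cl t = t.
  by rewrite in_itv /= /cl => /andP[at1 tb]; rewrite (min_idPr tb) (max_idPr at1).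
have cl_in t : cl t \in `[a, b].
  by rewrite in_itv /= /cl le_max lexx /= ge_max ab ge_min lexx.
have gcc : continuous (g \o cl).
  move=> t; apply: continuous_comp; first exact: clc.
  exact: gc.
exists (fun x => \int[lebesgue_measure]_(t in `[a - 1, x]) (g \o cl) t)%R => t tab.
have itb : t < b + 1 by move: tab; rewrite in_itv /=; lra.
have [||d1 d2] := @continuous_FTC1_closed R (g \o cl) (a - 1) t (b + 1) itb _ _ (gcc t).
- apply: continuous_compact_integrable; first exact: segment_compact.
  by apply: continuous_subspaceT.
- by move: tab; rewrite in_itv /=; lra.
apply: DeriveDef d1 _.
by rewrite -derive1E d2 /= cl_id.
Qed.

(** The mean value theorem for G minus the primitive of al + be t. *)
Lemma primitive_approx (G g : R -> R) (a b al be M : R) : a <= b ->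
  (forall t : R, t \in `[a, b] -> is_derive t (1 : R) G (g t)) ->
  (forall t, t \in `[a, b] -> `|g t - (al + be * t)| <= M) ->
  `|G b - G a - al * (b - a) - be * ((b ^+ 2 - a ^+ 2) / 2)| <= M * (b - a).
Proof.
move=> ab dG gM.
have dsq (t : R) : is_derive t (1 : R) (fun x : R => al * x + be / 2 * (x * x)) (al + be * t).
  have di := is_derive_id t (1 : R).
  have d1 := @is_deriveZ R _ _ _ al _ _ _ di.
  have d2 := @is_deriveM R _ _ _ _ _ _ _ di di.
  have d3 := @is_deriveZ R _ _ _ (be / 2) _ _ _ d2.
  have d4 := @is_deriveD R _ _ _ _ _ _ _ _ d1 d3.
  by apply: (is_derive_eq d4); rewrite /GRing.scale /=; field.
pose K t := G t - (al * t + be / 2 * (t * t)).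
have dK t : t \in `[a, b] -> is_derive t (1 : R) K (g t - (al + be * t)).
  by move=> tab; exact: (@is_deriveB R _ _ _ _ _ _ _ _ (dG _ tab) (dsq t)).
have Kc : {within `[a, b], continuous K}.
  apply: derivable_within_continuous => t tab.
  by have := dK _ tab => -[].
have dKo (t : R) : t \in `]a, b[ -> is_derive t (1 : R) K (g t - (al + be * t)).
  by move=> tab; apply: dK; apply: subset_itv_oo_cc.
have [c cab] := @MVT_segment R K (fun t => g t - (al + be * t)) a b ab dKo Kc.
rewrite /K => E; rewrite (_ : _ - _ = (g c - (al + be * c)) * (b - a)); last by rewrite -E; field.
rewrite normrM (ger0_norm (_ : 0 <= b - a)) ?subr_ge0//.
by apply: ler_wpM2r; rewrite ?subr_ge0//; exact: gM.
Qed.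

Lemma continuous_ReIm (T : topologicalType) (f : T -> Cplx R) (p : T) :
  {for p, continuous f} ->
  {for p, continuous (fun x => Re (f x))} /\ {for p, continuous (fun x => Im (f x))}.
Proof.
move=> /continuous_normcP fc.
split; apply/cvgrPdist_lt => e e0; have := fc e e0; apply: filterS => q; apply: le_lt_trans.
  by rewrite -raddfB normcB; exact: normc_Re.
by rewrite -raddfB normcB; exact: normc_Im.
Qed.

(** G is a primitive of g.  This is recorded through the estimate that it yields when
    g is within M of an affine function, which is the only property of integrals
    used below; the factor 2 comes from treating real and imaginary parts
    separately. *)
Definition is_segment_integral (g G : R -> R[i]) (a b : R) :=
  forall t t' al be M, a <= t -> t <= t' -> t' <= b ->
    (forall s, t <= s <= t' -> normc (g s - (al + be * s%:C%C)) <= M) ->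
    normc (G t' - G t - al * (t' - t)%:C%C - be * ((t' ^+ 2 - t ^+ 2) / 2)%:C%C)
      <= 2 * M * (t' - t).

Lemma segment_integral (g : R -> Cplx R) (a b : R) : a <= b ->
  (forall t, t \in `[a, b] -> {for t, continuous g}) ->
  exists G : R -> R[i], is_segment_integral g G a b.
Proof.
move=> ab gc.
have [|G1 G1P] := @continuous_primitive (fun x => Re (g x)) a b ab.
  by move=> t /gc /continuous_ReIm[].
have [|G2 G2P] := @continuous_primitive (fun x => Im (g x)) a b ab.
  by move=> t /gc /continuous_ReIm[].
exists (fun t => (G1 t +i* G2 t)%C) => t t' al be M at1 tt' t'b gM.
have sub s : s \in `[t, t'] -> s \in `[a, b] by rewrite !in_itv /=; lra.
apply: le_trans (normc_ReIm _) _.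
rewrite (_ : 2 * M * (t' - t) = M * (t' - t) + M * (t' - t)); last by ring.
have G1b : `|G1 t' - G1 t - Re al * (t' - t) - Re be * ((t' ^+ 2 - t ^+ 2) / 2)| <= M * (t' - t).
  apply: (primitive_approx tt' (fun s st => G1P s (sub s st))) => s.
  rewrite in_itv /= => /gM; apply: le_trans.
  apply: le_trans (normc_Re _); rewrite le_eqVlt; apply/orP; left; apply/eqP; congr `|_|.
  by case: (g s) (al) (be) => ? ? [? ?] [? ?] /=; ring.
have G2b : `|G2 t' - G2 t - Im al * (t' - t) - Im be * ((t' ^+ 2 - t ^+ 2) / 2)| <= M * (t' - t).
  apply: (primitive_approx tt' (fun s st => G2P s (sub s st))) => s.
  rewrite in_itv /= => /gM; apply: le_trans.
  apply: le_trans (normc_Im _); rewrite le_eqVlt; apply/orP; left; apply/eqP; congr `|_|.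
  by case: (g s) (al) (be) => ? ? [? ?] [? ?] /=; ring.
apply: lerD.
  move: G1b; congr (`|_| <= _).
  by case: (al) (be) => ? ? [? ?] /=; ring.
move: G2b; congr (`|_| <= _).
by case: (al) (be) => ? ? [? ?] /=; ring.
Qed.

End SegmentIntegral.

Section Goursat.
Variable R : realType.
Variables (f : Cplx R -> Cplx R) (a b p q : R).

Definition in_rect (a b p q : R) (z : R[i]) :=
  (a <= Re z <= b) && (p <= Im z <= q).

(* H y and V x integrate f along the lines Im z = y and Re z = x; on the latter
   dz = i dt, whence the factors i in rect_int. *)
Variables H V : R -> R -> R[i].
Hypothesis H_int : forall y, p <= y <= q -> is_segment_integral (fun t => f (t +i* y)%C) (H y) a b.
Hypothesis V_int : forall x, a <= x <= b -> is_segment_integral (fun t => f (x +i* t)%C) (V x) p q.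
Hypothesis df : forall z, in_rect a b p q z -> derivable f z 1.

(** The integral of [f] along the boundary of the rectangle, counterclockwise. *)
Definition rect_int (x x' y y' : R) : R[i] :=
  (H y x' - H y x) + 'i%C * (V x' y' - V x' y)
  - (H y' x' - H y' x) - 'i%C * (V x y' - V x y).

(** Affine functions have a primitive, so only the error term M contributes, in
    proportion to the perimeter. *)
Lemma rect_int_affine x x' y y' al be M :
  a <= x -> x <= x' -> x' <= b -> p <= y -> y <= y' -> y' <= q ->
  (forall z, in_rect x x' y y' z -> normc (f z - (al + be * z)) <= M) ->
  normc (rect_int x x' y y') <= 4 * M * ((x' - x) + (y' - y)).
Proof.
move=> ax xx' x'b py yy' y'q fM.
have Hb t : y <= t <= y' -> normc (H t x' - H t x - (al + be * (t *i)%C) * (x' - x)%:C%C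
    - be * ((x' ^+ 2 - x ^+ 2) / 2)%:C%C) <= 2 * M * (x' - x).
  move=> tyy'; have tpq : p <= t <= q by lra.
  apply: (H_int tpq) => // s sx.
  have := fM (s +i* t)%C; rewrite /in_rect /= sx tyy' => /(_ isT).
  rewrite (_ : al + be * _ + _ = al + be * (s +i* t)%C)//.
  by case: (al) (be) => ? ? [? ?]; apply/eqP; rewrite eq_complex /=; apply/andP; split;
    apply/eqP; ring.
have Vb t : x <= t <= x' -> normc (V t y' - V t y - (al + be * t%:C%C) * (y' - y)%:C%C
    - (be * 'i%C) * ((y' ^+ 2 - y ^+ 2) / 2)%:C%C) <= 2 * M * (y' - y).
  move=> txx'; have tab : a <= t <= b by lra.
  apply: (V_int tab) => // s sy.
  have := fM (t +i* s)%C; rewrite /in_rect /= sy txx' => /(_ isT).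
  rewrite (_ : al + be * _ + _ = al + be * (t +i* s)%C)//.
  by case: (al) (be) => ? ? [? ?]; apply/eqP; rewrite eq_complex /=; apply/andP; split;
    apply/eqP; ring.
have H1 := Hb y; have H2 := Hb y'; have V1 := Vb x; have V2 := Vb x'.
rewrite lexx yy' in H1; rewrite lexx yy' in H2; rewrite lexx xx' in V1; rewrite lexx xx' in V2.
move: (H1 isT) (H2 isT) (V1 isT) (V2 isT).
set h1 := (X in normc X <= _ -> _); set h2 := (X in _ -> normc X <= _ -> _).
set v1 := (X in _ -> _ -> normc X <= _ -> _); set v2 := (X in _ -> _ -> _ -> normc X <= _ -> _).
move=> {}H1 {}H2 {}V1 {}V2.
have -> : rect_int x x' y y' = h1 - h2 + ('i%C * v2 - 'i%C * v1).
  rewrite /rect_int /h1 /h2 /v1 /v2.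
  case: (H y x') (H y x) (V x' y') (V x' y) (H y' x') (H y' x) (V x y') (V x y) (al) (be)
    => [? ?] [? ?] [? ?] [? ?] [? ?] [? ?] [? ?] [? ?] [? ?] [? ?].
  by apply/eqP; rewrite eq_complex /=; apply/andP; split; apply/eqP; field.
have ni : normc ('i%C : R[i]) = 1 by rewrite /= expr0n expr1n add0r sqrtr1.
have := normcD (h1 - h2) ('i%C * v2 - 'i%C * v1).
have := normcD h1 (- h2); have := normcD ('i%C * v2) (- ('i%C * v1)).
rewrite !normcN !normcM ni !mul1r; lra.
Qed.

(** The integrals along the inner sides cancel. *)
Lemma rect_int_split x m x' y n y' :
  rect_int x x' y y' = rect_int x m y n + rect_int m x' y n
                     + rect_int x m n y' + rect_int m x' n y'.
Proof. by rewrite /rect_int; ring. Qed.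

Lemma half_pow_lt (u d : R) : 0 <= u -> 0 < d -> exists k, u / 2 ^+ k < d.
Proof.
move=> u0 d0; exists (Num.bound (u / d)).
rewrite ltr_pdivrMr ?exprn_gt0// mulrC -ltr_pdivrMr//.
apply: lt_le_trans (archi_boundP (divr_ge0 u0 (ltW d0))) _.
by rewrite -natrX ler_nat ltnW// ltn_expl.
Qed.

Lemma nested_bisection (w : R) (X : nat -> R) : 0 <= w ->
  (forall k, X k <= X k.+1 <= X k + w / 2 ^+ k.+1) ->
  exists x, forall k, X k <= x <= X k + w / 2 ^+ k.
Proof.
move=> w0 HX.
have p2 k : 0 < 2 ^+ k :> R by rewrite exprn_gt0.
have wS k : w / 2 ^+ k.+1 + w / 2 ^+ k.+1 = w / 2 ^+ k.
  by rewrite exprS; field; rewrite gt_eqF.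
have up k j : X k <= X (k + j)%N /\ X (k + j)%N + w / 2 ^+ (k + j) <= X k + w / 2 ^+ k.
  elim: j => [|j [IH1 IH2]]; first by rewrite addn0.
  rewrite addnS; have := HX (k + j)%N; have := wS (k + j)%N; split; lra.
have le_all j k : X j <= X k + w / 2 ^+ k.
  have w2 i : 0 <= w / 2 ^+ i by rewrite divr_ge0// ltW.
  have [jk|/ltnW kj] := leqP j k.
    by have := up j (k - j)%N; rewrite subnKC//; have := w2 k; lra.
  by have := up k (j - k)%N; rewrite subnKC//; have := w2 j; lra.
exists (sup (range X)) => k; apply/andP; split.
  apply: ub_le_sup; last by exists k.
  by exists (X 0%N + w / 2 ^+ 0) => _ [j _ <-].
by apply: ge_sup; [exists (X 0%N), 0%N | move=> _ [j _ <-]].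
Qed.

(** One of the four quarters of a rectangle carries at least a quarter of the
    integral; choose it repeatedly. *)
Lemma rect_int_bisection x y w h : 0 <= w -> 0 <= h ->
  exists X Y : nat -> R, [/\ X 0%N = x, Y 0%N = y,
    forall k, X k <= X k.+1 <= X k + w / 2 ^+ k.+1,
    forall k, Y k <= Y k.+1 <= Y k + h / 2 ^+ k.+1 &
    forall k, normc (rect_int x (x + w) y (y + h)) / 4 ^+ k
      <= normc (rect_int (X k) (X k + w / 2 ^+ k) (Y k) (Y k + h / 2 ^+ k))].
Proof.
move=> w0 h0.
pose N k (P : R * R) :=
  normc (rect_int P.1 (P.1 + w / 2 ^+ k) P.2 (P.2 + h / 2 ^+ k)).
have p2 k : 0 < 2 ^+ k :> R by rewrite exprn_gt0.
have dS (u : R) k : u / 2 ^+ k.+1 + u / 2 ^+ k.+1 = u / 2 ^+ k.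
  by rewrite exprS; field; rewrite gt_eqF.
have w2 i : 0 <= w / 2 ^+ i by rewrite divr_ge0// ltW.
have h2 i : 0 <= h / 2 ^+ i by rewrite divr_ge0// ltW.
have step (kP : nat * (R * R)) : exists Q : R * R,
    [/\ kP.2.1 <= Q.1 <= kP.2.1 + w / 2 ^+ kP.1.+1,
        kP.2.2 <= Q.2 <= kP.2.2 + h / 2 ^+ kP.1.+1 &
        N kP.1 kP.2 / 4 <= N kP.1.+1 Q].
  case: kP => k [u v] /=.
  have := w2 k.+1; have := h2 k.+1; move=> hk wk.
  have S := rect_int_split u (u + w / 2 ^+ k.+1) (u + w / 2 ^+ k)
    v (v + h / 2 ^+ k.+1) (v + h / 2 ^+ k).
  have : N k (u, v) <= N k.+1 (u, v) + N k.+1 (u + w / 2 ^+ k.+1, v)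
     + N k.+1 (u, v + h / 2 ^+ k.+1) + N k.+1 (u + w / 2 ^+ k.+1, v + h / 2 ^+ k.+1).
    rewrite /N /= S -(addrA u) dS -(addrA v) dS.
    by do 3!(apply: le_trans (normcD _ _) _; apply: lerD => //).
  set n1 := N _ _; set n2 := N _ _; set n3 := N _ _; set n4 := N _ _; set n5 := N _ _ => nle.
  have [H1|H1] := lerP (n1 / 4) n2; first by exists (u, v); split => //=; lra.
  have [H2|H2] := lerP (n1 / 4) n3.
    by exists (u + w / 2 ^+ k.+1, v); split => //=; lra.
  have [H3|H3] := lerP (n1 / 4) n4.
    by exists (u, v + h / 2 ^+ k.+1); split => //=; lra.
  exists (u + w / 2 ^+ k.+1, v + h / 2 ^+ k.+1); split => //=; try lra.
  rewrite -/n5; lra.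
have [nx nxP] := boolp.choice step.
pose fix Z k := if k is j.+1 then nx (j, Z j) else (x, y).
exists (fun k => (Z k).1), (fun k => (Z k).2); split => // [k|k|k].
- by have [] := nxP (k, Z k).
- by have [] := nxP (k, Z k).
elim: k => [|k IH]; first by rewrite !expr0 !divr1.
have [_ _] := nxP (k, Z k); apply: le_trans.
rewrite /N /= exprSr invfM mulrA; apply: ler_wpM2r => //; lra.
Qed.

(** Goursat's argument: in the k-th rectangle of a bisection sequence, of size 2^-k,
    [f] differs by o(2^-k) from an affine function, by differentiability at the
    common point of these rectangles.  Hence the integral over its boundary is
    o(4^-k), while it is at least 4^-k times the initial one. *)
Lemma rect_int_eq0 x x' y y' :
  a <= x -> x <= x' -> x' <= b -> p <= y -> y <= y' -> y' <= q ->
  rect_int x x' y y' = 0.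
Proof.
move=> ax xx' x'b py yy' y'q.
have w0 : 0 <= x' - x by lra.
have h0 : 0 <= y' - y by lra.
have [X [Y [X0 Y0 HX HY HN]]] := rect_int_bisection x y w0 h0.
set w := x' - x in w0 HX HN; set h := y' - y in h0 HY HN.
have [xs xsP] := nested_bisection w0 HX.
have [ys ysP] := nested_bisection h0 HY.
have p2 k : 0 < 2 ^+ k :> R by rewrite exprn_gt0.
have := xsP 0%N; have := ysP 0%N; rewrite X0 Y0 expr0 !divr1 => ys0 xs0.
have zs : in_rect a b p q (xs +i* ys)%C by rewrite /in_rect /=; apply/andP; split;
  rewrite /w /h in xs0 ys0; lra.
have [l fl] := (derivable_normcP _ _).1 (df zs).
have bnd k : a <= X k /\ X k + w / 2 ^+ k <= b /\ p <= Y k /\ Y k + h / 2 ^+ k <= q.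
  elim: k => [|k [IH1 [IH2 [IH3 IH4]]]].
    by rewrite X0 Y0 expr0 !divr1 /w /h; lra.
  have dS (u : R) : u / 2 ^+ k.+1 + u / 2 ^+ k.+1 = u / 2 ^+ k.
    by rewrite exprS; field; rewrite gt_eqF.
  by have := HX k; have := HY k; have := dS w; have := dS h; lra.
suff small : forall e : R, 0 < e -> normc (rect_int x (x + w) y (y + h)) <= e * (4 * (w + h) ^+ 2).
  have : normc (rect_int x x' y y') <= 0.
    rewrite (_ : x' = x + w); last by rewrite /w; lra.
    rewrite (_ : y' = y + h); last by rewrite /h; lra.
    apply/ler_addgt0Pr => e e0; rewrite add0r.
    have K0 : 0 < 4 * (w + h) ^+ 2 + 1 by have := sqr_ge0 (w + h); lra.
    have := small (e / (4 * (w + h) ^+ 2 + 1)) (divr_gt0 e0 K0).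
    move/le_trans; apply; rewrite mulrAC -mulrA ler_piMr ?(ltW e0)//.
    by rewrite ler_pdivrMr//; lra.
  by move=> r0; apply: eq0_normc; apply/eqP; rewrite eq_le r0 normc_ge0.
move=> e e0; have /near_discP[d d0 Hd] := fl e e0.
have [k Hk] := half_pow_lt (addr_ge0 w0 h0) d0.
have [b1 [b2 [b3 b4]]] := bnd k; have := xsP k; have := ysP k => yk xk.
have wk : 0 <= w / 2 ^+ k by rewrite divr_ge0// ltW.
have hk : 0 <= h / 2 ^+ k by rewrite divr_ge0// ltW.
have whE : (w + h) / 2 ^+ k = w / 2 ^+ k + h / 2 ^+ k by rewrite mulrDl.
have E : normc (rect_int x (x + w) y (y + h)) / 4 ^+ k
     <= 4 * (e * ((w + h) / 2 ^+ k)) * ((w + h) / 2 ^+ k).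
  apply: le_trans (HN k) _.
  rewrite {2}whE (_ : w / 2 ^+ k + _ = ((X k + w / 2 ^+ k) - X k) + ((Y k + h / 2 ^+ k) - Y k));
    last by ring.
  apply: (@rect_int_affine _ _ _ _ (f (xs +i* ys)%C - l * (xs +i* ys)%C) l); rewrite ?lerDl//.
  move=> z /andP[/= zx zy].
  have zd : normc (z - (xs +i* ys)%C) <= (w + h) / 2 ^+ k.
    apply: le_trans (normc_ReIm _) _; rewrite whE; apply: lerD.
      by rewrite raddfB /= ler_norml; apply/andP; split; lra.
    by rewrite raddfB /= ler_norml; apply/andP; split; lra.
  have -> : f z - (f (xs +i* ys)%C - l * (xs +i* ys)%C + l * z) =
     f z - f (xs +i* ys)%C - l * (z - (xs +i* ys)%C) by ring.
  apply: le_trans (Hd z (le_lt_trans zd Hk)) _.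
  by rewrite ler_pM2l.
move: E; rewrite ler_pdivrMr ?exprn_gt0// => /le_trans; apply.
rewrite (_ : 4 ^+ k = 2 ^+ k * 2 ^+ k :> R); last by rewrite -exprMn -natrM.
by rewrite le_eqVlt; apply/orP; left; apply/eqP; field; rewrite gt_eqF.
Qed.

End Goursat.

(** * Local primitives *)

Section LocalPrimitive.
Variable R : realType.
Implicit Types (f F : Cplx R -> Cplx R).

Lemma segment_integral_sym (g G : R -> R[i]) (a b : R) : is_segment_integral g G a b ->
  forall t t' al be M, a <= t <= b -> a <= t' <= b ->
    (forall s, Num.min t t' <= s <= Num.max t t' -> normc (g s - (al + be * s%:C%C)) <= M) ->
    normc (G t' - G t - al * (t' - t)%:C%C - be * ((t' ^+ 2 - t ^+ 2) / 2)%:C%C)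
      <= 2 * M * `|t' - t|.
Proof.
move=> gG t t' al be M tab t'ab; have [tt'|/ltW t't] := leP t t' => gM.
  by rewrite (ger0_norm (_ : 0 <= t' - t)) ?subr_ge0//; apply: gG => //; lra.
rewrite distrC (ger0_norm (_ : 0 <= t - t')) ?subr_ge0// -normcN.
have at' : a <= t' by lra.
have tb : t <= b by lra.
have := gG t' t al be M at' t't tb gM; congr (normc _ <= _).
by rewrite -[t - t']opprB -[t ^+ 2 - _]opprB mulNr !rmorphN /=; ring.
Qed.

(** A primitive, recorded as in [is_segment_integral].  The case be = 0 says that the
    derivative is [f]; the general case gives expansions of order two. *)
Definition primitive_on f F (a b p q : R) := forall z z' al be M,
  in_rect a b p q z -> in_rect a b p q z' ->
  (forall w, in_rect a b p q w -> normc (w - z) <= normc (z' - z) ->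
    normc (f w - (al + be * w)) <= M) ->
  normc (F z' - F z - al * (z' - z) - be * ((z' ^+ 2 - z ^+ 2) / 2)) <= 4 * M * normc (z' - z).

(** F integrates along a horizontal and then a vertical side, both starting from the
    corner (a, p).  By [rect_int_eq0] the increment from z to z' is then also the
    integral along the path from z with one horizontal and one vertical side, which
    stays at distance at most |z' - z| from z. *)
Theorem local_primitive f (a b p q : R) : a <= b -> p <= q ->
  (forall z, in_rect a b p q z -> derivable f z 1) ->
  exists F, primitive_on f F a b p q.
Proof.
move=> ab pq df.
have fc z : in_rect a b p q z -> {for z, continuous f}.
  by move=> /df /derivable1_diffP /differentiable_continuous.
have hline (y x0 : R) : {for x0, continuous (fun t : R => (t +i* y)%C : Cplx R)}.
  apply/continuous_normcP => e e0; near=> t.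
  rewrite (_ : _ - _ = (t - x0)%:C%C) ?normc_real; last first.
    by apply/eqP; rewrite eq_complex /= subrr !eqxx.
  by near: t; apply: cvgr_distC_lt.
have vline (x y0 : R) : {for y0, continuous (fun t : R => (x +i* t)%C : Cplx R)}.
  apply/continuous_normcP => e e0; near=> t.
  rewrite (_ : _ - _ = 'i%C * (t - y0)%:C%C); last first.
    by apply/eqP; rewrite eq_complex /= subrr; apply/andP; split; apply/eqP; ring.
  rewrite normcM normc_real /= expr0n expr1n add0r sqrtr1 mul1r.
  by near: t; apply: cvgr_distC_lt.
have hint (y : R) : exists Hy : R -> R[i], p <= y <= q ->
    is_segment_integral (fun t => f (t +i* y)%C) Hy a b.
  have [ypq|] := boolP (p <= y <= q); last by exists (fun=> 0).
  have [t tab|G GP] := @segment_integral R (fun t => f (t +i* y)%C) a b ab.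
    apply: (@continuous_comp _ _ _ (fun t : R => (t +i* y)%C : Cplx R) f); first exact: hline.
    by apply: fc; rewrite /in_rect /= ypq andbT.
  by exists G.
have [H HP] := boolp.choice hint.
have vint (x : R) : exists Vx : R -> R[i], a <= x <= b ->
    is_segment_integral (fun t => f (x +i* t)%C) Vx p q.
  have [xab|] := boolP (a <= x <= b); last by exists (fun=> 0).
  have [t tpq|G GP] := @segment_integral R (fun t => f (x +i* t)%C) p q pq.
    apply: (@continuous_comp _ _ _ (fun t : R => (x +i* t)%C : Cplx R) f); first exact: vline.
    by apply: fc; rewrite /in_rect /= xab /=.
  by exists G.
have [V VP] := boolp.choice vint.
have rect0 x x' y y' : a <= x <= b -> a <= x' <= b -> p <= y <= q -> p <= y' <= q ->
    rect_int H V x x' y y' = 0.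
  move=> xab x'ab ypq y'pq.
  wlog xx' : x x' xab x'ab / x <= x'.
    move=> W; have [/W|/ltW /W] := leP x x'; first exact.
    by move=> /(_ x'ab xab) E; rewrite -[RHS]oppr0 -E /rect_int; ring.
  wlog yy' : y y' ypq y'pq / y <= y'.
    move=> W; have [/W|/ltW /W] := leP y y'; first exact.
    by move=> /(_ y'pq ypq) E; rewrite -[RHS]oppr0 -E /rect_int; ring.
  by apply: (rect_int_eq0 HP VP df) => //; lra.
pose F (z : R[i]) := H p (Re z) - H p a + 'i%C * (V (Re z) (Im z) - V (Re z) p).
exists F => z z' al be M zr z'r fM.
case: z z' zr z'r fM => x y [x' y'] /andP[/= xab ypq] /andP[/= x'ab y'pq] fM.
have ppq : p <= p <= q by rewrite lexx.
have -> : F (x' +i* y')%C - F (x +i* y)%C =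
    (H y x' - H y x) + 'i%C * (V x' y' - V x' y).
  have := rect0 x x' p y xab x'ab ppq ypq; rewrite /rect_int /F /= => E.
  by rewrite -[RHS]addr0 -E; ring.
have dx : `|x' - x| <= normc ((x' +i* y')%C - (x +i* y)%C) by exact: (normc_Re ((x' +i* y')%C -
  (x +i* y)%C)).
have dy : `|y' - y| <= normc ((x' +i* y')%C - (x +i* y)%C) by exact: (normc_Im ((x' +i* y')%C -
  (x +i* y)%C)).
have M0 : 0 <= M.
  by apply: le_trans (normc_ge0 _) (fM (x +i* y)%C _ _);
    [rewrite /in_rect /= xab ypq | rewrite subrr normc0 sqrtr_ge0].
have B1 : normc (H y x' - H y x - (al + be * (y *i)%C) * (x' - x)%:C%C
    - be * ((x' ^+ 2 - x ^+ 2) / 2)%:C%C) <= 2 * M * `|x' - x|.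
  apply: (segment_integral_sym (HP _ ypq)) => // s sx.
  have sab : a <= s <= b.
    by move: sx; rewrite ge_min le_max; case/andP => /orP[] ? /orP[] ?; lra.
  have := fM (s +i* y)%C; rewrite /in_rect /= sab ypq => /(_ isT).
  rewrite (_ : al + be * _ + _ = al + be * (s +i* y)%C); last first.
    by case: (al) (be) => ? ? [? ?]; apply/eqP; rewrite eq_complex /=; apply/andP; split;
      apply/eqP; ring.
  apply; apply: le_trans dx.
  rewrite subrr expr0n addr0 sqrtr_sqr.
  move: sx; rewrite ge_min le_max ler_norml.
  by have := ler_norm (x' - x); have := ler_norm (- (x' - x)); rewrite normrN;
    move=> ? ? /andP[/orP[] ? /orP[] ?]; lra.
have B2 : normc (V x' y' - V x' y - (al + be * x'%:C%C) * (y' - y)%:C%C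
    - (be * 'i%C) * ((y' ^+ 2 - y ^+ 2) / 2)%:C%C) <= 2 * M * `|y' - y|.
  apply: (segment_integral_sym (VP _ x'ab)) => // s sy.
  have spq : p <= s <= q.
    by move: sy; rewrite ge_min le_max; case/andP => /orP[] ? /orP[] ?; lra.
  have := fM (x' +i* s)%C; rewrite /in_rect /= spq x'ab => /(_ isT).
  rewrite (_ : al + be * _ + _ = al + be * (x' +i* s)%C); last first.
    by case: (al) (be) => ? ? [? ?]; apply/eqP; rewrite eq_complex /=; apply/andP; split;
      apply/eqP; ring.
  apply; rewrite ler_sqrt ?addr_ge0 ?sqr_ge0// lerD2l.
  rewrite -(real_normK (num_real (s - y))) -(real_normK (num_real (y' - y))).
  rewrite ler_pXn2r ?nnegrE//.
  move: sy; rewrite ge_min le_max ler_norml.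
  by have := ler_norm (y' - y); have := ler_norm (- (y' - y)); rewrite normrN;
    move=> ? ? /andP[/orP[] ? /orP[] ?]; lra.
move: B1 B2; set u1 := (X in normc X <= _ -> _); set u2 := (X in _ -> normc X <= _ -> _) => B1 B2.
have -> : H y x' - H y x + 'i%C * (V x' y' - V x' y)
    - al * ((x' +i* y')%C - (x +i* y)%C) - be * (((x' +i* y')%C ^+ 2 - (x +i* y)%C ^+ 2) / 2)
    = u1 + 'i%C * u2.
  have half : (2^-1 : R[i]) = (2^-1 : R)%:C%C by rewrite fmorphV rmorph_nat.
  rewrite /u1 /u2 half.
  case: (H y x') (H y x) (V x' y') (V x' y) (al) (be)
    => [? ?] [? ?] [? ?] [? ?] [? ?] [? ?].
  by apply/eqP; rewrite eq_complex /=; apply/andP; split; apply/eqP; field.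
apply: le_trans (normcD _ _) _.
have ni : normc ('i%C : R[i]) = 1 by rewrite /= expr0n expr1n add0r sqrtr1.
rewrite normcM ni mul1r.
have K1 : M * `|x' - x| <= M * Num.sqrt ((x' - x) ^+ 2 + (y' - y) ^+ 2) := ler_wpM2l M0 dx.
have K2 : M * `|y' - y| <= M * Num.sqrt ((x' - x) ^+ 2 + (y' - y) ^+ 2) := ler_wpM2l M0 dy.
lra.
Unshelve. all: by end_near. Qed.

End LocalPrimitive.

(** * Second-order expansions forbid local maxima of the modulus *)

Section NoLocalMax.
Variable R : realType.
Implicit Types (f g F : Cplx R -> Cplx R).

Definition second_order g (z : Cplx R) := exists c1 c2 : R[i], forall e : R, 0 < e ->
  \forall w \near z, normc (g w - g z - c1 * (w - z) - c2 * (w - z) ^+ 2) <= e * normc (w - z) ^+ 2.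

(** Near z the function [f] is within e |w - z| of its affine approximation. *)
Lemma primitive_second_order f F a b p q (z : Cplx R) : primitive_on f F a b p q ->
  (\forall w \near z, in_rect a b p q w) -> derivable f z 1 -> second_order F z.
Proof.
move=> FP zr /derivable_normcP[l fl]; exists (f z), (l / 2) => e e0.
have e4 : 0 < e / 4 by lra.
have /near_discP[d d0 Hd] := fl _ e4.
have /near_discP[r r0 Hr] := zr.
apply/near_discP; exists (Num.min d r) => [|w]; first by rewrite lt_min d0.
rewrite lt_min => /andP[wd wr].
have zin : in_rect a b p q z by apply: Hr; rewrite subrr normc0.
have := FP z w (f z - l * z) l (e / 4 * normc (w - z)) zin (Hr _ wr) => K.
apply: le_trans (le_trans _ (K _)) _.
- rewrite le_eqVlt; apply/orP; left; apply/eqP; congr normc.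
  by field.
- move=> u ur uw.
  have -> : f u - (f z - l * z + l * u) = f u - f z - l * (u - z) by ring.
  apply: le_trans (Hd u (le_lt_trans uw wd)) _.
  by rewrite ler_pM2l.
- by rewrite le_eqVlt; apply/orP; left; apply/eqP; field.
Qed.

Lemma second_order_continuous g z : second_order g z -> {for z, continuous g}.
Proof.
move=> [c1 [c2 H]]; apply/continuous_normcP => e e0.
have /near_discP[d d0 Hd] := H 1 ltr01.
pose K := normc c1 + normc c2 + 1.
have K0 : 0 < K by have := normc_ge0 c1; have := normc_ge0 c2; rewrite /K; lra.
have m0 : 0 < Num.min d (Num.min 1 (e / K)) by rewrite !lt_min d0 ltr01 divr_gt0.
apply/near_discP; exists (Num.min d (Num.min 1 (e / K))) => // w.
rewrite !lt_min => /andP[wd /andP[w1 we]].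
have := Hd w wd; set u := w - z in wd w1 we *; rewrite mul1r => Hw.
have -> : g w - g z = (g w - g z - c1 * u - c2 * u ^+ 2) + (c1 * u + c2 * u ^+ 2) by ring.
apply: le_lt_trans (normcD _ _) _.
have := normcD (c1 * u) (c2 * u ^+ 2); rewrite (normcM c1) (normcM c2) normcX.
move: we; rewrite ltr_pdivlMr// /K => we.
have u0 := normc_ge0 u; have u2 : normc u ^+ 2 <= normc u by rewrite expr2; nra.
have := normc_ge0 c2; nra.
Qed.

(** The mean of [g] over the four points [w + i^k d] is [g w + o(d^2)], since
    [i^k d] and its square sum to zero; so the mean of [|g|^2 + e |x|^2] over
    these points exceeds its value at [w] by about [e d^2]. *)
Lemma second_order_no_max g (w : Cplx R) (c : R[i]) (e : R) : 0 < e -> second_order g w ->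
  ~ \forall x \near w, normc (g x) ^+ 2 + Re (c * x) + e * normc x ^+ 2
      <= normc (g w) ^+ 2 + Re (c * w) + e * normc w ^+ 2.
Proof.
move=> e0 [c1 [c2 H]] Hm.
pose k := e / (4 * (normc (g w) + 1)).
have g0 := normc_ge0 (g w).
have k0 : 0 < k by rewrite divr_gt0//; lra.
have kg : k * normc (g w) <= e / 4.
  by rewrite /k mulrAC ler_pdivrMr; [nra|lra].
have /near_discP[d d0 Hd] := H k k0.
have /near_discP[r r0 Hr] := Hm.
pose t := Num.min d r / 2.
have m0 : 0 < Num.min d r by rewrite lt_min d0.
have t0 : 0 < t by rewrite /t; lra.
have md : Num.min d r <= d by rewrite ge_min lexx.
have mr : Num.min d r <= r by rewrite ge_min lexx orbT.
have td : t < d by rewrite /t; lra.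
have tr : t < r by rewrite /t; lra.
pose T : R[i] := t%:C%C.
have nT : normc T = t by rewrite normc_real gtr0_norm.
have ni : normc ('i%C : R[i]) = 1 by rewrite /= expr0n expr1n add0r sqrtr1.
have key (z : R[i]) : normc z = t ->
    normc (g (w + z) - g w - c1 * z - c2 * z ^+ 2) <= k * t ^+ 2 /\
    normc (g (w + z)) ^+ 2 + Re (c * (w + z)) + e * normc (w + z) ^+ 2
      <= normc (g w) ^+ 2 + Re (c * w) + e * normc w ^+ 2.
  move=> zt; have zE : w + z - w = z by ring.
  have := Hd (w + z); rewrite zE zt => /(_ td) H1.
  by have := Hr (w + z); rewrite zE zt => /(_ tr) H2.
have [A1 B1] := key T nT.
have [A2 B2] : _ /\ _ := key (- T) (etrans (normcN _) nT).
have [A3 B3] : _ /\ _ := key ('i%C * T) (etrans (normcM _ _) (etrans (congr1 ( *%R^~ _) ni)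
  (etrans (mul1r _) nT))).
have [A4 B4] : _ /\ _ := key (- ('i%C * T)) (etrans (normcN _) (etrans (normcM _ _) (etrans
  (congr1 ( *%R^~ _) ni) (etrans (mul1r _) nT)))).
move: A1 B1 A2 B2 A3 B3 A4 B4.
set E1 := (X in normc X <= _); set E2 := (X in _ -> _ -> normc X <= _ -> _).
set E3 := (X in _ -> _ -> _ -> _ -> normc X <= _ -> _).
set E4 := (X in _ -> _ -> _ -> _ -> _ -> _ -> normc X <= _ -> _).
set g1 := g (w + T); set g2 := g (w + - T); set g3 := g (w + 'i%C * T);
  set g4 := g (w + - ('i%C * T)).
move=> A1 B1 A2 B2 A3 B3 A4 B4.
have ii : ('i%C : R[i]) * 'i%C = -1 by rewrite -expr2 sqr_i.
have sumE : g1 + g2 + g3 + g4 = 4 * g w + (E1 + E2 + E3 + E4).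
  rewrite /E1 /E2 /E3 /E4 -/g1 -/g2 -/g3 -/g4 !sqrrN exprMn sqr_i; ring.
have par (u1 u2 u3 u4 : R[i]) : normc (u1 + u2 + u3 + u4) ^+ 2
   <= 4 * (normc u1 ^+ 2 + normc u2 ^+ 2 + normc u3 ^+ 2 + normc u4 ^+ 2).
  have sq (x1 x2 x3 x4 : R) : (x1 + x2 + x3 + x4) ^+ 2 <= 4 * (x1 ^+ 2 + x2 ^+ 2 + x3 ^+ 2 + x4
    ^+ 2).
    have := sqr_ge0 (x1 - x2); have := sqr_ge0 (x1 - x3); have := sqr_ge0 (x1 - x4).
    have := sqr_ge0 (x2 - x3); have := sqr_ge0 (x2 - x4); have := sqr_ge0 (x3 - x4). lra.
  rewrite !normcE2; case: u1 u2 u3 u4 => [x1 y1] [x2 y2] [x3 y3] [x4 y4] /=.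
  by have := sq x1 x2 x3 x4; have := sq y1 y2 y3 y4; lra.
have := par g1 g2 g3 g4; rewrite sumE => P1.
have P2 : normc (E1 + E2 + E3 + E4) <= 4 * (k * t ^+ 2).
  have := normcD (E1 + E2 + E3) E4; have := normcD (E1 + E2) E3; have := normcD E1 E2; lra.
have P3 : normc (4 * g w) = 4 * normc (g w).
  by rewrite normcM (_ : 4 = 4%:C%C :> R[i]) ?normc_real ?normr_nat// rmorph_nat.
have P4 := normc_dist (4 * g w) (- (E1 + E2 + E3 + E4)); rewrite opprK normcN P3 in P4.
have lin : normc (w + T) ^+ 2 + normc (w + - T) ^+ 2 + normc (w + 'i%C * T) ^+ 2 + normc (w + -
  ('i%C * T)) ^+ 2
   = 4 * normc w ^+ 2 + 4 * t ^+ 2.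
  by rewrite !normcE2 /T; case: (w) => x y /=; ring.
have linc : Re (c * (w + T)) + Re (c * (w + - T)) + Re (c * (w + 'i%C * T)) + Re (c * (w + -
  ('i%C * T)))
   = 4 * Re (c * w).
  by rewrite /T; case: (c) (w) => ? ? [? ?] /=; ring.
have S : normc g1 ^+ 2 + normc g2 ^+ 2 + normc g3 ^+ 2 + normc g4 ^+ 2 + 4 * e * t ^+ 2 <= 4 *
  normc (g w) ^+ 2.
  have lin' := congr1 ( *%R e) lin; lra.
have Q : (4 * normc (g w)) ^+ 2 - 2 * (4 * normc (g w)) * (4 * (k * t ^+ 2)) <= normc (4 * g w +
  (E1 + E2 + E3 + E4)) ^+ 2.
  set X := normc (4 * g w + _) in P4 *; set Y := normc (E1 + _ + _ + _) in P2 P4.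
  have X0 : 0 <= X by exact: normc_ge0.
  set Z := 4 * (k * t ^+ 2) in P2 *.
  have Z0 : 0 <= Z by rewrite /Z mulr_ge0// mulr_ge0 ?(ltW k0)// sqr_ge0.
  set G := 4 * normc (g w) in P4 *.
  have G0 : 0 <= G by rewrite /G; lra.
  have [GZ|ZG] := lerP G Z; nra.
have t2 : 0 < t ^+ 2 by rewrite exprn_gt0.
have kgt : k * normc (g w) * t ^+ 2 <= e / 4 * t ^+ 2 by rewrite ler_pM2r.
have et : 0 < e * t ^+ 2 by rewrite mulr_gt0.
lra.
Qed.

Lemma compact_rect (a b p q : R) : compact [set z : Cplx R | in_rect a b p q z].
Proof.
pose h (xy : R * R) : Cplx R := (xy.1 +i* xy.2)%C.
have -> : [set z : Cplx R | in_rect a b p q z] = h @` (`[a, b] `*` `[p, q]).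
  apply/seteqP; split => [[x y] /andP[/= xab ypq]|_ [[x y] [/= xab ypq] <-]].
    by exists (x, y); rewrite //= !in_itv.
  by rewrite /= !in_itv /= in xab ypq; rewrite /in_rect /= xab ypq.
apply: continuous_compact; last by apply: compact_setX; exact: segment_compact.
apply: continuous_subspaceT => -[x y]; apply/continuous_normcP => e e0.
have e2 : 0 < e / 2 by lra.
near=> uv; apply: le_lt_trans (normc_ReIm _) _.
have H1 : `|uv.1 - x| < e / 2.
  near: uv; apply: (@cvgr_distC_lt _ _ _ _ _ (@fst R R)) => //; exact: cvg_fst.
have H2 : `|uv.2 - y| < e / 2.
  near: uv; apply: (@cvgr_distC_lt _ _ _ _ _ (@snd R R)) => //; exact: cvg_snd.
by rewrite /= in H1 H2 *; lra.
Unshelve. all: by end_near. Qed.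

End NoLocalMax.

(** * The maximum modulus principle *)

Section MaxModulus.
Variable R : realType.
Implicit Types (f g F : Cplx R -> Cplx R).

Lemma continuous_modulus (T : topologicalType) (f : T -> Cplx R) (p : T) :
  {for p, continuous f} -> {for p, continuous (fun x => normc (f x) : R)}.
Proof.
move=> /continuous_normcP fc; apply/cvgrPdist_lt => e e0; have := fc e e0.
apply: filterS => q; apply: le_lt_trans; rewrite ler_norml.
have := normc_dist (f p) (f q); have := normc_dist (f q) (f p).
by rewrite (normcB (f p) (f q)) => ? ?; apply/andP; split; lra.
Qed.

Lemma continuous_sqr_modulus g (c : R[i]) (e : R) (z : Cplx R) : {for z, continuous g} ->
  {for z, continuous (fun x => normc (g x) ^+ 2 + Re (c * x) + e * normc x ^+ 2 : R)}.
Proof.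
move=> gc.
have n1 := continuous_modulus gc.
have n2 : {for z, continuous (fun x : Cplx R => normc x : R)}.
  by apply: (@continuous_modulus _ id); exact: cvg_id.
have mc : {for z, continuous (fun x : Cplx R => c * x : Cplx R)}.
  exact: (@continuous_cplxM _ _ z (fun=> c) id (@continuous_cplx_cst _ _ z c)
    (@continuous_cplx_id _ z)).
have [n3 _] := continuous_ReIm mc.
rewrite (_ : (fun x => _) = (fun x : Cplx R =>
  normc (g x) * normc (g x) + Re (c * x) + e * (normc x * normc x) : R)); last first.
  by apply/funext => x; rewrite !expr2.
have fz := nbhs_filter z.
have n4 := @cvgM R _ (nbhs z) fz _ _ _ _ n1 n1.
have n5 := @cvgM R _ (nbhs z) fz _ _ _ _ (@cvg_cst R e _ (nbhs z) fz) (@cvgM R _ (nbhs z) fz _ _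
  _ _ n2 n2).
exact: (@cvgD R R _ (nbhs z) fz _ _ _ _ (@cvgD R R _ (nbhs z) fz _ _ _ _ n4 n3) n5).
Qed.

Lemma compact_max (K : set (Cplx R)) (v : Cplx R -> R) (z : Cplx R) : compact K -> K z ->
  (forall x, K x -> {for x, continuous v}) ->
  exists2 w, K w & forall x, K x -> v x <= v w.
Proof.
move=> cK Kz vc.
have [|c] := @compact_EVT_max _ R v K (ex_intro _ z Kz) cK.
  by apply: continuous_in_subspaceT => x; rewrite inE; exact: vc.
by rewrite inE => Kc cmax; exists c => // x Kx; apply: cmax; rewrite inE.
Qed.

(** Uniform continuity on K, for increments that may leave K. *)
Lemma compact_uniform f (K : set (Cplx R)) (e : R) : compact K -> 0 < e ->
  (forall z, K z -> {for z, continuous f}) ->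
  \forall h \near (0 : R)^'+, forall z, K z -> forall w, normc (w - z) <= h ->
    normc (f w - f z) <= e.
Proof.
move=> /compact_near_coveringP cK e0 fc.
apply: (cK R _ (fun h z => forall w, normc (w - z) <= h -> normc (f w - f z) <= e)) => z Kz.
have e2 : 0 < e / 2 by lra.
have /continuous_normcP/(_ _ e2)/near_discP[d d0 Hd] := fc z Kz.
have d2 : 0 < d / 2 by lra.
exists ([set z' : Cplx R | normc (z' - z) < d / 2], [set h : R | h < d / 2]).
  split; first by apply/near_discP; exists (d / 2).
  by apply: nbhs_right_lt.
move=> [z' h] /= [z'd hd] w wz'.
have H1 := Hd z' _; have H2 := Hd w.
have := normcD (w - z') (z' - z); rewrite addrA subrK => H3.
have {}H1 : normc (f z' - f z) < e / 2 by apply: H1; lra.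
have {}H2 : normc (f w - f z) < e / 2 by apply: H2; lra.
have := normcD (f w - f z) (f z - f z'); rewrite addrA subrK (normcB (f z)); lra.
Qed.

(** Unlike in [second_order_no_max], [f] is only assumed differentiable; its
    primitive F has second-order expansions, hence so do the difference
    quotients of F, which converge to [f] uniformly.  Half of the term
    [e |z|^2] is spent on making the maximum strict, so that it survives this
    approximation. *)
Lemma derivable_no_max f (z0 : Cplx R) (e : R) : 0 < e ->
  (\forall z \near z0, derivable f z 1) ->
  ~ \forall z \near z0, normc (f z) ^+ 2 + e * normc z ^+ 2
      <= normc (f z0) ^+ 2 + e * normc z0 ^+ 2.
Proof.
move=> e0 /near_discP[d1 d10 fd] /near_discP[d2 d20 fmax].
pose rho := Num.min d1 d2 / 8.
have m0 : 0 < Num.min d1 d2 by rewrite lt_min d10.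
have md1 : Num.min d1 d2 <= d1 by rewrite ge_min lexx.
have md2 : Num.min d1 d2 <= d2 by rewrite ge_min lexx orbT.
have rho0 : 0 < rho by rewrite /rho; lra.
pose x0 := Re z0; pose y0 := Im z0.
have rect_dist r (z : R[i]) : in_rect (x0 - r) (x0 + r) (y0 - r) (y0 + r) z ->
  normc (z - z0) <= 2 * r.
  move=> /andP[zx zy]; apply: le_trans (normc_ReIm _) _.
  rewrite !raddfB /= -/x0 -/y0 (_ : 2 * r = r + r); last by ring.
  by apply: lerD; rewrite ler_norml; apply/andP; split; lra.
have dist_rect r (z : R[i]) : normc (z - z0) <= r -> in_rect (x0 - r) (x0 + r) (y0 - r) (y0 + r) z.
  move=> zr; have := le_trans (normc_Re _) zr; have := le_trans (normc_Im _) zr.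
  rewrite !raddfB /= -/x0 -/y0 !ler_norml => /andP[? ?] /andP[? ?].
  by rewrite /in_rect; apply/andP; split; apply/andP; split; lra.
have [|| z zr|F FP] := @local_primitive R f (x0 - 2 * rho) (x0 + 2 * rho) (y0 - 2 * rho) (y0 + 2
  * rho).
- lra.
- lra.
- by apply: fd; apply: le_lt_trans (rect_dist _ _ zr) _; rewrite /rho; lra.
pose B := [set z : Cplx R | in_rect (x0 - rho) (x0 + rho) (y0 - rho) (y0 + rho) z].
have cB : compact B by exact: compact_rect.
have Bz0 : B z0 by apply: dist_rect; rewrite subrr normc0 ltW.
have Bd z : B z -> normc (z - z0) < d1 /\ normc (z - z0) < d2.
  by move=> /rect_dist zB; split; apply: le_lt_trans zB _; rewrite /rho; lra.
have fB z : B z -> derivable f z 1 by move=> /Bd[/fd].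
pose K := normc (f z0) ^+ 2 + e * normc z0 ^+ 2 + 1.
have K1 : 1 <= K.
  by rewrite /K lerDr addr_ge0 ?sqr_ge0// mulr_ge0 ?sqr_ge0// ltW.
have fK z : B z -> normc (f z) <= K.
  move=> /Bd[_ /fmax fz]; have := sqr_ge0 (normc z); have := normc_ge0 (f z) => n0 n1.
  have : e * normc z ^+ 2 >= 0 by rewrite mulr_ge0// ltW.
  rewrite /K; nra.
pose V z := normc (f z) ^+ 2 + Re ((e%:C * z0^*)%C * z) + e / 2 * normc z ^+ 2.
have Vmax z : B z -> V z <= V z0 - e / 2 * normc (z - z0) ^+ 2.
  move=> /Bd[_ /fmax]; rewrite /V !normcE2.
  by case: (f z) (f z0) (z) (z0) => [? ?] [? ?] [? ?] [? ?] /=; lra.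
pose eta := e * rho ^+ 2 / 16.
have eta0 : 0 < eta by rewrite /eta !mulr_gt0// exprn_gt0.
pose n := Num.min 1 (eta / (2 * K + 1)).
have n0 : 0 < n by rewrite /n lt_min ltr01 divr_gt0//; lra.
have n4 : 0 < n / 4 by lra.
have fcB z : B z -> {for z, continuous f}.
  by move=> /fB /derivable1_diffP /differentiable_continuous.
have [h [h0 hrho Hh]] : exists h : R, [/\ 0 < h, h < rho &
    forall z, B z -> forall w, normc (w - z) <= h -> normc (f w - f z) <= n / 4].
  have F1 := compact_uniform cB n4 fcB.
  have F2 : \forall h \near (0 : R)^'+, h < rho by exact: nbhs_right_lt.
  have F3 : \forall h \near (0 : R)^'+, 0 < h by exact: nbhs_right_gt.
  near (0 : R)^'+ => h; exists h; split.
  - by near: h; exact: F3.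
  - by near: h; exact: F2.
  - by near: h; exact: F1.
pose g (z : Cplx R) : Cplx R := (F (z + h%:C%C) - F z) / h%:C%C.
have hC0 : h%:C%C != 0 :> R[i] by rewrite -normc_gt0 normc_real gtr0_norm.
have B2 z u : B z -> normc u <= rho -> in_rect (x0 - 2 * rho) (x0 + 2 * rho) (y0 - 2 * rho) (y0 +
  2 * rho) (z + u).
  move=> /andP[/andP[zx1 zx2] /andP[zy1 zy2]] un.
  have := le_trans (normc_Re _) un; have := le_trans (normc_Im _) un.
  rewrite !ler_norml => /andP[? ?] /andP[? ?].
  by rewrite /in_rect !raddfD /=; apply/andP; split; apply/andP; split; lra.
have gf z : B z -> normc (g z - f z) <= n.
  move=> Bz.
  have nh : normc h%:C%C = h by rewrite normc_real gtr0_norm.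
  have zin : in_rect (x0 - 2 * rho) (x0 + 2 * rho) (y0 - 2 * rho) (y0 + 2 * rho) z.
    by rewrite -[z]addr0; apply: B2 => //; rewrite normc0 ltW.
  have zhin := B2 z h%:C%C Bz; rewrite nh (ltW hrho) in zhin.
  have := FP z (z + h%:C%C) (f z) 0 (n / 4) zin (zhin isT).
  rewrite addrC [z + _ - z]addrC addKr mul0r subr0 nh => FPz.
  have -> : g z - f z = (F (z + h%:C%C) - F z - f z * h%:C%C) / h%:C%C.
    by rewrite /g; field.
  rewrite normc_div nh ler_pdivrMr//.
  apply: le_trans (FPz _) _.
    by move=> w wr wz; rewrite mul0r addr0; apply: Hh.
  by rewrite le_eqVlt; apply/orP; left; apply/eqP; field.
have F2 z u : B z -> normc u < rho -> second_order F (z + u).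
  move=> Bz un.
  apply: (primitive_second_order FP); last first.
    apply: fd; apply: le_lt_trans (rect_dist _ _ (B2 z u Bz (ltW un))) _.
    by rewrite /rho; lra.
  apply/near_discP; exists (rho - normc u) => [|w wz]; first by rewrite subr_gt0.
  have -> : w = z + (u + (w - (z + u))) by ring.
  apply: B2 => //; apply: le_trans (normcD _ _) _; lra.
have g2 z : B z -> second_order g z.
  move=> Bz.
  have [|a1 [a2 A]] := F2 z h%:C%C Bz; first by rewrite normc_real gtr0_norm.
  have [|b1 [b2 Bb]] := F2 z 0 Bz; first by rewrite normc0.
  rewrite addr0 in Bb.
  exists ((a1 - b1) / h%:C%C), ((a2 - b2) / h%:C%C) => k k0.
  have kh : 0 < k * h / 2 by rewrite divr_gt0// mulr_gt0.
  have /near_discP[r1 r10 R1] := A _ kh; have /near_discP[r2 r20 R2] := Bb _ kh.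
  apply/near_discP; exists (Num.min r1 r2) => [|w]; first by rewrite lt_min r10.
  rewrite lt_min => /andP[w1 w2].
  have := R1 (w + h%:C%C); rewrite (_ : w + _ - _ = w - z); last by ring.
  move=> /(_ w1); have := R2 w w2.
  set E2 := (X in normc X <= _ -> _); set E1 := (X in _ -> normc X <= _ -> _) => Q2 Q1.
  have -> : g w - g z - (a1 - b1) / h%:C%C * (w - z) - (a2 - b2) / h%:C%C * (w - z) ^+ 2
     = (E1 - E2) / h%:C%C by rewrite /E1 /E2 /g; field.
  rewrite normc_div normc_real (gtr0_norm h0) ler_pdivrMr//.
  have := normcD E1 (- E2); rewrite normcN; lra.
pose v z := normc (g z) ^+ 2 + Re ((e%:C * z0^*)%C * z) + e / 2 * normc z ^+ 2.
have vV z : B z -> `|v z - V z| <= eta.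
  move=> Bz; have := gf z Bz; have := fK z Bz => fz gz.
  have d_1 := normc_dist (g z) (f z); have d_2 := normc_dist (f z) (g z);
    rewrite (normcB (f z)) in d_2.
  have n1 : n <= 1 by rewrite /n ge_min lexx.
  have n2 : n * (2 * K + 1) <= eta.
    rewrite -ler_pdivlMr; last lra.
    by rewrite /n ge_min lexx orbT.
  have f0 := normc_ge0 (f z); have g0 := normc_ge0 (g z).
  rewrite (_ : v z - V z = (normc (g z) - normc (f z)) * (normc (g z) + normc (f z)));
    last by rewrite /v /V; ring.
  apply: le_trans n2; rewrite normrM; apply: ler_pM => //.
    by rewrite ler_norml; apply/andP; split; lra.
  by rewrite ger0_norm; lra.
have [w Bw wmax] : exists2 w, B w & forall x, B x -> v x <= v w.
  apply: (compact_max cB Bz0) => x Bx; apply: continuous_sqr_modulus.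
  exact: second_order_continuous (g2 x Bx).
have wz0 : normc (w - z0) ^+ 2 <= rho ^+ 2 / 4.
  have := vV w Bw; have := vV z0 Bz0; rewrite !ler_norml => /andP[a1 a2] /andP[b1 b2].
  have := wmax z0 Bz0; have := Vmax w Bw => c1 c2.
  have : e * normc (w - z0) ^+ 2 <= e * (rho ^+ 2 / 4) by rewrite /eta in a1 a2 b1 b2; lra.
  by rewrite ler_pM2l.
have wlt : normc (w - z0) < rho.
  have := normc_ge0 (w - z0) => ?; nra.
have e20 : 0 < e / 2 by lra.
apply: (second_order_no_max e20 (g2 w Bw) (c := (e%:C * z0^*)%C)).
apply/near_discP; exists (rho - normc (w - z0)) => [|x xw]; first by rewrite subr_gt0.
apply: wmax; apply: dist_rect.
have := normcD (x - w) (w - z0); rewrite addrA subrK; lra.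
Unshelve. all: by end_near. Qed.

(** If |f| exceeds M somewhere, then for small e > 0 the maximum over K of
    |f|^2 + e |z|^2 is not reached outside U, where |f| <= M; and it is not reached
    in U by [derivable_no_max]. *)
Theorem max_modulus f (K U : set (Cplx R)) (M : R) :
  compact K -> 0 <= M ->
  (forall z, U z -> K z) ->
  (forall z, U z -> \forall w \near z, U w) ->
  (forall z, U z -> derivable f z 1) ->
  (forall z, K z -> {for z, continuous f}) ->
  (forall z, K z -> ~ U z -> normc (f z) <= M) ->
  forall z, K z -> normc (f z) <= M.
Proof.
move=> cK M0 UK Uo fd fc fM z1 Kz1; rewrite leNgt; apply/negP => Mz1.
have [r _ rmax] : exists2 w, K w & forall x, K x -> normc x <= normc w :> R.
  apply: (compact_max cK Kz1) => x _; apply: (@continuous_modulus _ id); exact: cvg_id.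
have gap : 0 < normc (f z1) ^+ 2 - M ^+ 2 by nra.
pose e := (normc (f z1) ^+ 2 - M ^+ 2) / (normc r ^+ 2 + 1) / 2.
have r1 : 0 < normc r ^+ 2 + 1 by have := sqr_ge0 (normc r); lra.
have e0 : 0 < e by rewrite /e !divr_gt0.
have er : e * normc r ^+ 2 < normc (f z1) ^+ 2 - M ^+ 2.
  rewrite /e mulrAC ltr_pdivrMr// mulrAC ltr_pdivrMr//.
  by have := sqr_ge0 (normc r); nra.
have [w Kw wmax] : exists2 w, K w & forall x, K x ->
    normc (f x) ^+ 2 + Re (0 * x) + e * normc x ^+ 2
    <= normc (f w) ^+ 2 + Re (0 * w) + e * normc w ^+ 2.
  by apply: (compact_max cK Kz1) => x Kx; apply: continuous_sqr_modulus; exact: fc.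
have Re0 (x : R[i]) : Re (0 * x) = 0 by rewrite mul0r.
have {}wmax x : K x -> normc (f x) ^+ 2 + e * normc x ^+ 2 <= normc (f w) ^+ 2 + e * normc w ^+ 2.
  by move=> /wmax; rewrite !Re0 !addr0.
have Uw : U w.
  apply: contrapT => nUw; have fw := fM w Kw nUw.
  have := wmax z1 Kz1; have rw := rmax w Kw.
  have : normc w ^+ 2 <= normc r ^+ 2 by rewrite ler_pXn2r ?nnegrE ?normc_ge0.
  rewrite -(ler_pM2l e0) => ew.
  have : 0 <= e * normc z1 ^+ 2 by rewrite mulr_ge0 ?sqr_ge0// ltW.
  have := normc_ge0 (f w); nra.
apply: (@derivable_no_max f w e e0).
  by apply: filterS (Uo w Uw) => x; exact: fd.
by apply: filterS (Uo w Uw) => x /UK; exact: wmax.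
Qed.

End MaxModulus.

(** * The maximum principle with finitely many exceptional points *)

Section Removable.
Variable R : realType.
Implicit Types (f g q : Cplx R -> Cplx R) (c z u : Cplx R).

Lemma has_deriv_near f z l : has_deriv f z l -> derivable f z 1.
Proof. by move=> fl; apply/derivable_normcP; exists l. Qed.

(** The value at [z] is chosen so that continuity at [z] means that [l] is the
    derivative (Caratheodory). *)
Definition dquot f (l : R[i]) (z : Cplx R) : Cplx R -> Cplx R :=
  fun u => if u == z then l else (f u - f z) / (u - z).

Lemma dquotE f l z u : f u - f z = dquot f l z u * (u - z).
Proof.
rewrite /dquot; have [->|uz] := eqVneq u z; first by rewrite !subrr mulr0.
by rewrite divfK// subr_eq0.
Qed.

Lemma dquot_continuous_at f l z : has_deriv f z l -> {for z, continuous (dquot f l z)}.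
Proof.
move=> fl; apply/continuous_normcP => e e0.
have e2 : 0 < e / 2 by lra.
have zE : dquot f l z z = l by rewrite /dquot eqxx.
apply: filterS (fl _ e2) => u; rewrite zE.
have [->|uz] := eqVneq u z; first by move=> _; rewrite zE subrr normc0.
have uz0 : 0 < normc (u - z) by rewrite normc_gt0 subr_eq0.
rewrite (dquotE f l z u) -mulrBl normcM ler_pM2r//; lra.
Qed.

Lemma caratheodory f q z : (\forall u \near z, f u - f z = q u * (u - z)) ->
  {for z, continuous q} -> has_deriv f z (q z).
Proof.
move=> fq /continuous_normcP qc e e0; have := qc e e0; apply: filterS2 fq => u -> qu.
by rewrite -mulrBl normcM ler_wpM2r ?normc_ge0// ltW.
Qed.

Lemma near_neq z p : z != p -> \forall u \near z, u != p.
Proof.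
move=> zp; apply/near_discP; exists (normc (z - p)); first by rewrite normc_gt0 subr_eq0.
by move=> u uz; apply: contraTneq uz => ->; rewrite normcB ltxx.
Qed.

Lemma dquot_near f l z u : u != z -> \forall v \near u, (f v - f z) / (v - z) = dquot f l z v.
Proof. by move=> /near_neq; apply: filterS => v; rewrite /dquot => /negbTE ->. Qed.

Lemma dquot_continuous f l z u : u != z -> {for u, continuous f} ->
  {for u, continuous (dquot f l z)}.
Proof.
move=> uz fc; apply: near_eq_continuous (dquot_near f l uz) _.
have c1 := continuous_cplxB fc (@continuous_cplx_cst R (Cplx R) u (f z)).
have c2 := continuous_cplxB (@continuous_cplx_id R u) (@continuous_cplx_cst R (Cplx R) u z).
by apply: (continuous_cplx_div c1 c2); rewrite subr_eq0.
Qed.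

Lemma dquot_derivable f l z u : u != z -> derivable f u 1 -> derivable (dquot f l z) u 1.
Proof.
move=> uz fd; apply: near_eq_derivable_cplx (dquot_near f l uz) _.
have d1 := derivable_cplxB fd (@derivable_cplx_cst R (f z) u).
have d2 := derivable_cplxB (@derivable_cplx_id R u) (@derivable_cplx_cst R z u).
by apply: (derivable_cplx_div _ d1 d2); rewrite subr_eq0.
Qed.

Lemma compact_cdisc c (r : R) : compact [set z : Cplx R | normc (z - c) <= r].
Proof.
apply: (@subclosed_compact _ _ [set z : Cplx R | in_rect (Re c - r) (Re c + r) (Im c - r) (Im c +
  r) z]).
- rewrite (_ : [set _ | _] = (fun z : Cplx R => normc (z - c) : R) @^-1` [set x | x <= r])//.
  have nc z : {for z, continuous (fun z : Cplx R => normc (z - c) : R)}.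
    exact: (@continuous_modulus R (Cplx R) (fun z => (z : R[i]) - c) z
      (continuous_cplxB (@continuous_cplx_id R z) (@continuous_cplx_cst R (Cplx R) z c))).
  by apply: closed_comp; [move=> z _; exact: nc|exact: closed_le].
- exact: compact_rect.
move=> z /= zr; have := le_trans (normc_Re _) zr; have := le_trans (normc_Im _) zr.
rewrite !raddfB /= !ler_norml => /andP[? ?] /andP[? ?].
by rewrite /in_rect; apply/andP; split; apply/andP; split; lra.
Qed.

Lemma near_right_shift u (P : Cplx R -> Prop) : (\forall v \near u, P v) ->
  \forall h \near (0 : R)^'+, P (u + h%:C%C).
Proof.
move=> /near_discP[d d0 Hd]; near=> h; apply: Hd.
have h0 : 0 < h by near: h; exact: nbhs_right_gt.
rewrite [X in normc X](_ : _ = h%:C%C); last by rewrite addrC addKr.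
rewrite normc_real gtr0_norm//; near: h; exact: nbhs_right_lt.
Unshelve. all: by end_near. Qed.

Lemma near_right_notin u (s : seq R[i]) : \forall h \near (0 : R)^'+, u + h%:C%C \notin s.
Proof.
elim: s => [|p s IH]; first by near=> h.
have [E|up] := eqVneq u p.
  near=> h; rewrite in_cons negb_or; apply/andP; split; last by near: h; exact: IH.
  have h0 : 0 < h by near: h; exact: nbhs_right_gt.
  by rewrite -E -subr_eq0 addrC addKr -normc_gt0 normc_real gtr0_norm.
have nn := near_right_shift (near_neq up).
near=> h; rewrite in_cons negb_or; apply/andP; split; last by near: h; exact: IH.
by near: h; exact: nn.
Unshelve. all: by end_near. Qed.

Lemma expr_small (x e : R) : 0 <= x -> x < 1 -> 0 < e -> exists n, x ^+ n < e.
Proof.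
move=> x0 x1 e0.
have /cvgrPdist_lt/(_ e e0) : (fun n => x ^+ n) @ \oo --> (0 : R).
  by apply: cvg_expr; rewrite ger0_norm.
move=> [N _ HN]; exists N; have := HN N (leqnn N).
by rewrite sub0r normrN ger0_norm ?exprn_ge0.
Qed.

(** The exceptional points are absorbed by applying the maximum principle to P f^N,
    where P vanishes at them, and taking N-th roots for N large. *)
Lemma max_modulus_punctured f c (r M : R) (s : seq R[i]) : 0 < r -> 0 <= M ->
  (forall z, normc (z - c) <= r -> {for z, continuous f}) ->
  (forall z, normc (z - c) < r -> z \notin s -> derivable f z 1) ->
  (forall z, normc (z - c) = r -> normc (f z) <= M) ->
  forall z, normc (z - c) <= r -> normc (f z) <= M.
Proof.
move=> r0 M0 fc fd fM z; rewrite le_eqVlt => /orP[/eqP/fM//|zr]; rewrite leNgt; apply/negP => Mz.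
have : \forall u \near z, normc (u - c) < r /\ M < normc (f u).
  have n1 : \forall u \near z, normc (u - c) < r.
    apply/near_discP; exists (r - normc (z - c)) => [|u uz]; first by rewrite subr_gt0.
    by have := normcD (u - z) (z - c); rewrite addrA subrK; lra.
  have n2 : \forall u \near z, M < normc (f u).
    have e0 : 0 < normc (f z) - M by rewrite subr_gt0.
    have /continuous_normcP/(_ _ e0) := fc z (ltW zr); apply: filterS => u fu.
    by have := normc_dist (f z) (f u); rewrite (normcB (f z)); lra.
  by apply: filterS2 n1 n2.
move=> /near_right_shift H1; have H2 := near_right_notin z s.
have [v [[vr vM] vs]] : exists v, (normc (v - c) < r /\ M < normc (f v)) /\ v \notin s.
  near (0 : R)^'+ => h; exists (z + h%:C%C); split; first by near: h; exact: H1.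
  by near: h; exact: H2.
pose P (u : Cplx R) : Cplx R := \prod_(p <- s) (u - p : R[i]).
have Pc u : {for u, continuous P}.
  apply: (@continuous_cplx_prod R (Cplx R) u R[i] s (fun p u => u - p)) => p.
  exact: continuous_cplxB (@continuous_cplx_id R u) (@continuous_cplx_cst R (Cplx R) u p).
have Pd u : derivable P u 1.
  apply: (@derivable_cplx_prod R R[i] s (fun p u => u - p)) => p.
  exact: derivable_cplxB (@derivable_cplx_id R u) (@derivable_cplx_cst R p u).
have Pv : P v != 0.
  by rewrite prodf_seq_neq0; apply/allP => p ps /=; rewrite subr_eq0; apply: contraNneq vs => ->.
have cK := @compact_cdisc c r.
have cin : normc (c - c) <= r by rewrite subrr normc0 ltW.
have [w _ Pw] : exists2 w, normc (w - c) <= r & forall x, normc (x - c) <= r ->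
  normc (P x) <= normc (P w).
  by apply: (compact_max cK cin) => u _; apply: continuous_modulus; exact: Pc.
have bound N : normc (P v) * normc (f v) ^+ N <= normc (P w) * M ^+ N.
  rewrite -normcX -normcM.
  pose F : Cplx R -> Cplx R := fun u => (P u : R[i]) * ((f u : R[i]) ^+ N).
  have B0 : 0 <= normc (P w) * M ^+ N by rewrite mulr_ge0 ?normc_ge0 ?exprn_ge0.
  refine (@max_modulus R F _ [set z : Cplx R | normc (z - c) < r /\ z \notin s]
    (normc (P w) * M ^+ N) cK B0 _ _ _ _ _ v (ltW vr)).
  - by move=> u [/ltW].
  - move=> u [ur us].
    have n1 : \forall x \near u, normc (x - c) < r.
      apply/near_discP; exists (r - normc (u - c)) => [|x xu]; first by rewrite subr_gt0.
      by have := normcD (x - u) (u - c); rewrite addrA subrK; lra.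
    have n2 : \forall x \near u, x \notin s.
      elim: (s) us => [|p t IH]; first by move=> _; exact: (filterS (fun _ _ => isT) filterT).
      rewrite in_cons negb_or => /andP[up ut].
      by apply: filterS2 (near_neq up) (IH ut) => y yp yt; rewrite in_cons negb_or yp.
    by apply: filterS2 n1 n2.
  - move=> u [ur us]; rewrite /F; exact: derivable_cplxM (Pd u) (derivable_cplxX (n := N) (fd u
    ur us)).
  - move=> u ur; rewrite /F; exact: continuous_cplxM (Pc u) (continuous_cplxX (n := N) (fc u ur)).
  - move=> u ur nU; rewrite /F normcM normcX.
    have [us|us] := boolP (u \in s).
      have -> : P u = 0.
        by apply/eqP; rewrite prodf_seq_eq0; apply/hasP; exists u => //=; rewrite subrr.
      by rewrite normc0 mul0r mulr_ge0 ?normc_ge0 ?exprn_ge0.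
    have ue : normc (u - c) = r.
      by apply/eqP; rewrite eq_le ur /= leNgt; apply/negP => u'r; apply: nU.
    apply: ler_pM; rewrite ?normc_ge0 ?exprn_ge0 ?normc_ge0//; first exact: Pw.
    by rewrite lerXn2r ?nnegrE ?normc_ge0// fM.
have fv0 : 0 < normc (f v) by lra.
have x0 : 0 <= M / normc (f v) by rewrite divr_ge0// ltW.
have x1 : M / normc (f v) < 1 by rewrite ltr_pdivrMr// mul1r.
have Pv0 : 0 < normc (P v) by rewrite normc_gt0.
have Pw1 : 0 < normc (P w) + 1 by have := normc_ge0 (P w); lra.
have [N HN] := expr_small x0 x1 (divr_gt0 Pv0 Pw1).
have := bound N.
move: HN; rewrite expr_div_n ltr_pdivlMr// mulrAC ltr_pdivrMr ?exprn_gt0//.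
by have := exprn_ge0 N M0; lra.
Unshelve. all: by end_near. Qed.

End Removable.

(** * Removable singularities *)

Section RemovableSingularity.
Variable R : realType.
Implicit Types (f g q : Cplx R -> Cplx R) (c z u : Cplx R).

(** The limit at c of a real Lipschitz function, given by McShane's extension
    formula. *)
Lemma lipschitz_extension (h : R[i] -> R) c (r K : R) : 0 < r -> 0 <= K ->
  (forall z z', 0 < normc (z - c) < r -> 0 < normc (z' - c) < r ->
    `|h z - h z'| <= K * normc (z - z')) ->
  exists L : R, forall z, 0 < normc (z - c) < r -> `|h z - L| <= K * normc (z - c).
Proof.
move=> r0 K0 hK.
pose A := [set y | exists2 z : R[i], 0 < normc (z - c) < r & y = h z - K * normc (z - c)].
have key z z' : 0 < normc (z - c) < r -> 0 < normc (z' - c) < r ->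
    h z - K * normc (z - c) <= h z' + K * normc (z' - c).
  move=> zr z'r; have := hK z z' zr z'r; rewrite ler_norml => /andP[_ H].
  have : normc (z - z') <= normc (z - c) + normc (z' - c).
    by have := normcD (z - c) (c - z'); rewrite addrA subrK (normcB c).
  move=> /(ler_wpM2l K0); lra.
pose p : R[i] := c + (r / 2)%:C%C.
have pr : 0 < normc (p - c) < r.
  by rewrite /p addrC addKr normc_real gtr0_norm; lra.
exists (sup A) => z zr; rewrite ler_norml; apply/andP; split.
  suff : sup A <= h z + K * normc (z - c) by lra.
  apply: ge_sup; first by exists (h p - K * normc (p - c)), p.
  by move=> _ [z' z'r ->]; exact: key.
suff : h z - K * normc (z - c) <= sup A by lra.
apply: ub_le_sup; last by exists z.
by exists (h p + K * normc (p - c)) => _ [z' z'r ->]; exact: key.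
Qed.

Definition punctured_derivable g c (r : R) :=
  forall z, 0 < normc (z - c) < r -> derivable g z 1.

Lemma normc_shift z c : normc (z - c) = 0 -> z = c.
Proof. by move=> /eq0_normc /eqP; rewrite subr_eq0 => /eqP. Qed.

Lemma near_derivs g c (r : R) (z : R[i]) : punctured_derivable g c r ->
  0 < normc (z - c) < r -> exists l, has_deriv g z l.
Proof. by move=> gd zr; apply/derivable_normcP; exact: gd. Qed.

Lemma punctured_continuous g c (r : R) : {for c, continuous g} -> punctured_derivable g c r ->
  forall z, normc (z - c) < r -> {for z, continuous g}.
Proof.
move=> gc gd z zr; have [->//|zc] := eqVneq z c.
by apply: derivable_cplx_continuous; apply: gd; rewrite normc_gt0 subr_eq0 zc.
Qed.

(** By the maximum principle, with the exceptional points c and z, the difference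
    quotient u |-> (g u - g z) / (u - z) is bounded by its values on the circle
    |u - c| = r / 2, where the denominator is at least r / 4. *)
Lemma dquot_bound g c (r : R) : 0 < r -> {for c, continuous g} -> punctured_derivable g c r ->
  exists2 M, 0 <= M & forall z l, 0 < normc (z - c) < r / 4 -> has_deriv g z l ->
    forall u, normc (u - c) <= r / 2 -> normc (dquot g l z u) <= M.
Proof.
move=> r0 gc gd; have gcD := punctured_continuous gc gd.
have cK := @compact_cdisc R c (r / 2).
have cin : normc (c - c) <= r / 2 by rewrite subrr normc0; lra.
have [w _ gw] : exists2 w, normc (w - c) <= r / 2 &
    forall x, normc (x - c) <= r / 2 -> normc (g x) <= normc (g w).
  apply: (compact_max cK cin) => u ur; apply: continuous_modulus; apply: gcD.
  by rewrite /= in ur; lra.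
have G0 := normc_ge0 (g w).
exists (8 * normc (g w) / r) => [|z l zr gl u ur]; first by rewrite divr_ge0// ?mulr_ge0// ltW.
have r2 : 0 < r / 2 by lra.
have M0 : 0 <= 8 * normc (g w) / r by rewrite divr_ge0// ?mulr_ge0// ltW.
refine (@max_modulus_punctured R (dquot g l z) c (r / 2) _ [:: (c : R[i]);
  (z : R[i])] r2 M0 _ _ _ u ur).
- move=> v vr; have [->|vz] := eqVneq v z; first exact: dquot_continuous_at.
  have vr' : normc (v - c) < r by lra.
  exact: dquot_continuous vz (gcD v vr').
- move=> v vr; rewrite !inE negb_or => /andP[vc vz].
  have vin : 0 < normc (v - c) < r by rewrite normc_gt0 subr_eq0 vc /=; lra.
  exact: dquot_derivable vz (gd v vin).
move=> v vr.
have vz : r / 4 <= normc (v - z).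
  by have := normcD (v - z) (z - c); rewrite addrA subrK; lra.
have vz0 : v != z by rewrite -subr_eq0 -normc_gt0; lra.
have -> : dquot g l z v = (g v - g z) / (v - z) by rewrite /dquot (negbTE vz0).
rewrite normc_div ler_pdivrMr; last lra.
have h1 : normc (g v) <= normc (g w) by apply: gw; lra.
have h2 : normc (g z) <= normc (g w) by apply: gw; lra.
have h3 := normcD (g v) (- (g z : R[i])); rewrite normcN in h3.
have h4 : 8 * normc (g w) / r * (r / 4) <= 8 * normc (g w) / r * normc (v - z) by rewrite ler_wpM2l.
have h5 : 8 * normc (g w) / r * (r / 4) = 2 * normc (g w) by field; rewrite gt_eqF.
by apply: le_trans h3 _; lra.
Qed.

(** Riemann's theorem, for a function continuous at the singularity.  The maximum
    principle for the difference of two difference quotients, based at z and z',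
    makes z |-> (g c - g z) / (c - z) Lipschitz on the punctured disc, so that it
    has a limit at [c]. *)
Theorem removable_singularity g c (r : R) : 0 < r -> {for c, continuous g} ->
  punctured_derivable g c r -> derivable g c 1.
Proof.
move=> r0 gc gd; have gcD := punctured_continuous gc gd.
have [M M0 gM] := dquot_bound r0 gc gd.
have H z : exists l : R[i], 0 < normc (z - c) < r -> has_deriv g z l.
  have [zr|] := boolP (0 < normc (z - c) < r); last by exists 0.
  by have [l gl] := near_derivs gd zr; exists l.
have [g' g'P] := boolp.choice H.
pose q (z : R[i]) := dquot g (g' z) z c.
pose K := 8 * M / r.
have K0 : 0 <= K by rewrite /K divr_ge0// ?mulr_ge0// ltW.
have r4 : 0 < r / 4 by lra.
have r2 : 0 < r / 2 by lra.
have lt4 (z : R[i]) : 0 < normc (z - c) < r / 4 -> 0 < normc (z - c) < r by lra.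
have qK z z' : 0 < normc (z - c) < r / 4 -> 0 < normc (z' - c) < r / 4 ->
    normc (q z - q z') <= K * normc (z - z').
  move=> zr z'r.
  have gz := g'P z (lt4 z zr); have gz' := g'P z' (lt4 z' z'r).
  have bz := gM z _ zr gz; have bz' := gM z' _ z'r gz'.
  pose D : Cplx R -> Cplx R := fun u => (dquot g (g' z) z u : R[i]) - (dquot g (g' z') z' u : R[i]).
  have KM : 0 <= K * normc (z - z') by rewrite mulr_ge0 ?normc_ge0.
  have cin : normc (c - c) <= r / 2 by rewrite subrr normc0; lra.
  refine (@max_modulus_punctured R D c (r / 2) _ [:: (c : R[i]); (z : R[i]);
    (z' : R[i])] r2 KM _ _ _ c cin).
  - move=> v vr; have vr' : normc (v - c) < r by lra.
    rewrite /D; apply: continuous_cplxB.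
      have [->|vz] := eqVneq v z; first exact: dquot_continuous_at.
      exact: dquot_continuous vz (gcD v vr').
    have [->|vz] := eqVneq v z'; first exact: dquot_continuous_at.
    exact: dquot_continuous vz (gcD v vr').
  - move=> v vr; rewrite !inE !negb_or => /and3P[vc vz vz'].
    have vin : 0 < normc (v - c) < r by rewrite normc_gt0 subr_eq0 vc /=; lra.
    have d1 := dquot_derivable (l := g' z) vz (gd v vin).
    have d2 := dquot_derivable (l := g' z') vz' (gd v vin).
    exact: derivable_cplxB d1 d2.
  move=> v vr.
  have far (x : R[i]) : 0 < normc (x - c) < r / 4 -> r / 4 <= normc (v - x).
    by have := normcD (v - x) (x - c); rewrite addrA subrK; lra.
  have vz := far z zr; have vz' := far z' z'r.
  have vz0 : v - z != 0 by rewrite -normc_gt0; lra.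
  have vz'0 : v - z' != 0 by rewrite -normc_gt0; lra.
  have E : D v * (v - z') = (dquot g (g' z') z' z - dquot g (g' z) z v) * (z' - z).
    rewrite /D /dquot.
    rewrite -(subr_eq0 v z) (negbTE vz0) -(subr_eq0 v z') (negbTE vz'0).
    have [->|zz'] := eqVneq z z'; first by rewrite subrr mul0r subrr mulr0.
    by field; rewrite vz0 vz'0 subr_eq0 zz'.
  have h1 : normc (dquot g (g' z') z' z) <= M by apply: bz'; lra.
  have h2 : normc (dquot g (g' z) z v) <= M by apply: bz; lra.
  have h3 := normcD (dquot g (g' z') z' z) (- (dquot g (g' z) z v : R[i])); rewrite normcN in h3.
  have h4 : normc (D v) * normc (v - z') <= 2 * M * normc (z - z').
    rewrite -normcM E normcM (normcB z'); apply: ler_wpM2r; first exact: normc_ge0.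
    by apply: le_trans h3 _; lra.
  have h5 := ler_wpM2l (normc_ge0 (D v)) vz'.
  have h6 : normc (D v) * (r / 4) <= 2 * M * normc (z - z') by lra.
  rewrite -ler_pdivlMr// in h6; apply: le_trans h6 _.
  by rewrite le_eqVlt; apply/orP; left; apply/eqP; rewrite /K; field; rewrite gt_eqF.
have reK z z' : 0 < normc (z - c) < r / 4 -> 0 < normc (z' - c) < r / 4 ->
    `|Re (q z) - Re (q z')| <= K * normc (z - z').
  by move=> zr z'r; apply: le_trans (qK _ _ zr z'r); rewrite -raddfB; exact: normc_Re.
have imK z z' : 0 < normc (z - c) < r / 4 -> 0 < normc (z' - c) < r / 4 ->
    `|Im (q z) - Im (q z')| <= K * normc (z - z').
  by move=> zr z'r; apply: le_trans (qK _ _ zr z'r); rewrite -raddfB; exact: normc_Im.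
have [L1 HL1] := lipschitz_extension r4 K0 reK.
have [L2 HL2] := lipschitz_extension r4 K0 imK.
apply: (@has_deriv_near R g c (L1 +i* L2)%C) => e e0.
have eK : 0 < e / (2 * K + 1) by rewrite divr_gt0//; lra.
apply/near_discP; exists (Num.min (r / 4) (e / (2 * K + 1))) => [|z]; first by rewrite lt_min r4.
rewrite lt_min => /andP[zr ze].
have [->|zc] := eqVneq z c; first by rewrite !subrr mulr0 subr0 normc0 mulr0.
have zc0 : 0 < normc (z - c) by rewrite normc_gt0 subr_eq0.
have zin : 0 < normc (z - c) < r / 4 by rewrite zc0.
have := HL1 z zin; have := HL2 z zin => b2 b1.
have -> : g z - g c - (L1 +i* L2)%C * (z - c) = (q z - (L1 +i* L2)%C) * (z - c).
  rewrite /q /dquot eq_sym (negbTE zc).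
  by field; rewrite subr_eq0 eq_sym.
rewrite normcM ler_wpM2r ?normc_ge0//.
apply: le_trans (normc_ReIm _) _; rewrite !raddfB /=.
move: ze; rewrite ltr_pdivlMr; last lra.
lra.
Qed.

(** Difference quotients based at points near c are bounded by [dquot_bound]. *)
Lemma derivable_lipschitz g c : (\forall z \near c, derivable g z 1) ->
  exists r M : R, [/\ 0 < r, 0 <= M & forall u z, normc (u - c) < r -> normc (z - c) < r ->
    normc (g u - g z) <= M * normc (u - z)].
Proof.
move=> /near_discP[r r0 gd].
have gc : {for c, continuous g} by apply: derivable_cplx_continuous; apply: gd;
  rewrite subrr normc0.
have gp : punctured_derivable g c r by move=> z /andP[_]; exact: gd.
have [M M0 gM] := dquot_bound r0 gc gp.
have key (z u : R[i]) : 0 < normc (z - c) -> normc (z - c) < r / 4 -> normc (u - c) < r / 4 ->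
    normc (g u - g z) <= M * normc (u - z).
  move=> z0 zr ur; have zin : 0 < normc (z - c) < r by lra.
  have [l gl] := near_derivs gp zin.
  rewrite (dquotE g l z u) normcM; apply: ler_wpM2r; first exact: normc_ge0.
  by apply: (gM z l); rewrite ?z0//; lra.
exists (r / 4), M; split => // [|u z ur zr]; first lra.
have [zc|] := eqVneq (normc (z - c)) 0; last first.
  by move=> zc; apply: key => //; rewrite lt_neqAle eq_sym zc normc_ge0.
have [uc|uc] := eqVneq (normc (u - c)) 0.
  by rewrite (normc_shift zc) (normc_shift uc) !subrr normc0 mulr0.
rewrite (normcB (g u)) (normcB u); apply: key => //.
by rewrite lt_neqAle eq_sym uc normc_ge0.
Qed.

(** The difference quotient is continuous at c, which is thus removable. *)
Lemma dquot_derivable_disc g l c (r : R) : has_deriv g c l ->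
  (forall z, normc (z - c) < r -> derivable g z 1) ->
  forall z, normc (z - c) < r -> derivable (dquot g l c) z 1.
Proof.
move=> gl gd z zr; have [->|zc] := eqVneq z c; last exact: dquot_derivable zc (gd z zr).
apply: (@removable_singularity _ c r).
- by apply: le_lt_trans zr; exact: normc_ge0.
- exact: dquot_continuous_at.
move=> u /andP[u0 ur]; have uc : u != c by rewrite -subr_eq0 -normc_gt0.
exact: dquot_derivable uc (gd u ur).
Qed.

End RemovableSingularity.

(** * Injective holomorphic functions *)

Section InjectiveDerivative.
Variable R : realType.
Implicit Types (f g h q xi tau : Cplx R -> Cplx R) (c z u : Cplx R).

Definition disc_injective f c (r : R) :=
  forall z w, normc (z - c) < r -> normc (w - c) < r -> f z = f w -> z = w.

(** Divide f - f c by u - c as long as the quotient vanishes at c.  If this never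
    ended, then f - f c = (u - c)^k h_k for every k, with |h_k| <= C / (r/2)^k on the
    disc of radius r / 2 by the maximum principle; hence |f - f c| <= C / 2^k at
    distance r / 4 from c, for all k, against injectivity. *)
Lemma injective_order f c (r : R) : 0 < r ->
  (forall z, normc (z - c) < r -> derivable f z 1) -> disc_injective f c r ->
  exists m h, [/\ forall z, normc (z - c) < r -> derivable h z 1, h c != 0 &
    forall u, normc (u - c) < r -> (f u : R[i]) = f c + ((u : R[i]) - c) ^+ m.+1 * h u].
Proof.
move=> r0 fd finj; apply: contrapT => no.
have cr : normc (c - c) < r by rewrite subrr normc0.
have all k : exists h, (forall z, normc (z - c) < r -> derivable h z 1) /\
    forall u, normc (u - c) < r -> (f u : R[i]) = f c + ((u : R[i]) - c) ^+ k.+1 * h u.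
  elim: k => [|k [h [hd hE]]].
    have /derivable_normcP[l fl] := fd c cr.
    exists (dquot f l c); split; first exact: dquot_derivable_disc fl fd.
    by move=> u _; rewrite -[f u](subrK (f c)) (dquotE f l c u); ring.
  have hc0 : h c = 0 by apply/eqP; apply: contrapT => /negP hc; apply: no; exists k, h.
  have /derivable_normcP[l hl] := hd c cr.
  exists (dquot h l c); split; first exact: dquot_derivable_disc hl hd.
  move=> u ur; rewrite (hE u ur) -[h u](subrK (h c)) (dquotE h l c u) hc0 !exprS; ring.
have cK := @compact_cdisc R c (r / 2).
have cin : normc (c - c) <= r / 2 by rewrite subrr normc0; lra.
pose F : Cplx R -> Cplx R := fun u => (f u : R[i]) - f c.
have Fd u : normc (u - c) < r -> derivable F u 1.
  by move=> ur; exact: derivable_cplxB (fd u ur) (@derivable_cplx_cst R (f c) u).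
have [w _ Fw] : exists2 w, normc (w - c) <= r / 2 &
    forall x, normc (x - c) <= r / 2 -> normc (F x) <= normc (F w).
  apply: (compact_max cK cin) => u ur; apply: continuous_modulus; apply: derivable_cplx_continuous.
  by apply: Fd; rewrite /= in ur; lra.
pose p : R[i] := c + (r / 4)%:C%C.
have pE : normc (p - c) = r / 4 by rewrite /p addrC addKr normc_real gtr0_norm//; lra.
have pc : p - c != 0 by rewrite -normc_gt0 pE; lra.
have r2 : 0 < r / 2 by lra.
have Fp k : normc (F p) <= normc (F w) * (1 / 2) ^+ k.+1.
  have [h [hd hE]] := all k.
  have hM u : normc (u - c) <= r / 2 -> normc (h u) <= normc (F w) / (r / 2) ^+ k.+1.
    apply: (@max_modulus_punctured R h c (r / 2) _ [::] r2).
    - by rewrite divr_ge0 ?normc_ge0 ?exprn_ge0// ltW.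
    - by move=> z zr; apply: derivable_cplx_continuous; apply: hd; lra.
    - by move=> z zr _; apply: hd; lra.
    move=> z zr; have zr' : normc (z - c) < r by lra.
    rewrite ler_pdivlMr ?exprn_gt0// -zr -normcX -normcM mulrC.
    have -> : ((z : R[i]) - c) ^+ k.+1 * h z = F z by rewrite /F (hE z zr'); ring.
    by apply: Fw; lra.
  have pr : normc (p - c) < r by lra.
  have -> : F p = (p - c) ^+ k.+1 * h p by rewrite /F (hE p pr); ring.
  rewrite normcM normcX pE.
  have -> : normc (F w) * (1 / 2) ^+ k.+1 = (r / 4) ^+ k.+1 * (normc (F w) / (r / 2) ^+ k.+1).
    rewrite mulrCA -expr_div_n; congr (_ * _ ^+ _); field; rewrite gt_eqF//.
  by rewrite ler_pM2l ?exprn_gt0//; [apply: hM; lra|lra].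
have Fp0 : normc (F p) = 0.
  apply/eqP; rewrite eq_le normc_ge0 andbT leNgt; apply/negP => Fp0.
  have w1 : 0 < normc (F w) + 1 by have := normc_ge0 (F w); lra.
  have half0 : 0 <= 1 / 2 :> R by lra.
  have half1 : 1 / 2 < 1 :> R by lra.
  have [k Hk] := expr_small half0 half1 (divr_gt0 Fp0 w1).
  rewrite ltr_pdivlMr// in Hk.
  have := Fp k; rewrite exprS.
  have x0 : 0 <= (1 / 2) ^+ k :> R by rewrite exprn_ge0.
  by have := mulr_ge0 x0 (normc_ge0 (F w)); lra.
have pr : normc (p - c) < r by lra.
have := finj p c pr cr; rewrite (normc_shift Fp0) => /(_ erefl) /eqP.
by rewrite -subr_eq0 (negbTE pc).
Qed.

Lemma has_deriv_linM h c u l : has_deriv h u l ->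
  has_deriv (fun v => ((v : R[i]) - c) * (h v : R[i])) u (h u + ((u : R[i]) - c) * l).
Proof.
move=> hl.
pose q : Cplx R -> Cplx R := fun v => (h v : R[i]) + ((u : R[i]) - c) * (dquot h l u v : R[i]).
have -> : h u + ((u : R[i]) - c) * l = q u by rewrite /q /dquot eqxx.
apply: caratheodory.
  apply: (filterS _ filterT) => v _; rewrite /q.
  transitivity ((h v : R[i]) * ((v : R[i]) - u) + ((u : R[i]) - c) * (dquot h l u v * ((v : R[i])
    - u))).
    by rewrite -(dquotE h l u v); ring.
  ring.
apply: continuous_cplxD; first exact: derivable_cplx_continuous (has_deriv_near hl).
apply: continuous_cplxM; first exact: continuous_cplx_cst.
exact: dquot_continuous_at.
Qed.

(** The derivative of (v - c)^k h is (u - c)^(k-1) (k h + (u - c) h'); multiplying by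
    u - c avoids the exponent k - 1. *)
Lemma has_deriv_expM h c u l k : has_deriv h u l -> exists2 d,
  has_deriv (fun v => ((v : R[i]) - c) ^+ k * (h v : R[i])) u d &
  ((u : R[i]) - c) * d = ((u : R[i]) - c) ^+ k * (k%:R * h u + ((u : R[i]) - c) * l).
Proof.
move=> hl; elim: k => [|k [d hd dE]].
  exists l; last by rewrite expr0 mul0r add0r mul1r.
  by rewrite (_ : (fun _ => _) = h)//; apply/funext => v; rewrite expr0 mul1r.
exists (((u : R[i]) - c) ^+ k * h u + ((u : R[i]) - c) * d).
  rewrite (_ : (fun _ => _) = (fun v => ((v : R[i]) - c) * (((v : R[i]) - c) ^+ k * (h v : R[i])))).
    exact: has_deriv_linM hd.
  by apply/funext => v; rewrite exprS mulrA.
rewrite dE exprS -natr1; ring.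
Qed.

Lemma has_deriv_le f z l (M r : R) : 0 < r -> has_deriv f z l ->
  (forall u, normc (u - z) < r -> normc (f u - f z) <= M * normc (u - z)) -> normc l <= M.
Proof.
move=> r0 fl fM; apply/ler_addgt0Pr => e e0.
have /near_discP[d d0 Hd] := fl e e0.
pose t := Num.min r d / 2.
have m0 : 0 < Num.min r d by rewrite lt_min r0.
have mr : Num.min r d <= r by rewrite ge_min lexx.
have md : Num.min r d <= d by rewrite ge_min lexx orbT.
have t0 : 0 < t by rewrite /t; lra.
pose u : R[i] := z + t%:C%C.
have uE : normc (u - z) = t by rewrite /u addrC addKr normc_real gtr0_norm.
have h1 : normc (f u - f z) <= M * t by rewrite -uE; apply: fM; rewrite uE /t; lra.
have h2 : normc (f u - f z - l * (u - z)) <= e * t by rewrite -uE; apply: Hd; rewrite uE /t; lra.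
have h3 := normc_dist (l * (u - z)) (f u - f z).
rewrite normcB normcM uE in h3.
have : (normc l - (M + e)) * t <= 0 by lra.
by rewrite pmulr_lle0// subr_le0.
Qed.

(** An injective holomorphic function may a priori have critical points; that they
    are isolated suffices for [derivable_lift]. *)
Lemma injective_deriv_neq0 f c (r : R) : 0 < r ->
  (forall z, normc (z - c) < r -> derivable f z 1) -> disc_injective f c r ->
  \forall u \near c, u != c -> exists2 l, l != 0 & has_deriv f u l.
Proof.
move=> r0 fd finj; have [m [h [hd hc fE]]] := injective_order r0 fd finj.
have hdn : \forall z \near c, derivable h z 1 by apply/near_discP; exists r.
have [r1 [M [r10 M0 hM]]] := derivable_lipschitz hdn.
have hc0 : 0 < normc (h c) by rewrite normc_gt0.
have M1 : 0 < 2 * M + 1 by lra.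
have rd : 0 < Num.min r (Num.min r1 (normc (h c) / (2 * M + 1))) by rewrite !lt_min r0 r10 divr_gt0.
apply/near_discP; exists (Num.min r (Num.min r1 (normc (h c) / (2 * M + 1)))) => // u.
rewrite !lt_min ltr_pdivlMr// => /and3P[ur ur1 uh] uc.
have uc0 : (u : R[i]) - c != 0 by rewrite subr_eq0.
have /derivable_normcP[l hl] := hd u ur.
have [d fd' dE] := has_deriv_expM c m.+1 hl.
exists d; last first.
  have /derivable_normcP[l' fl'] := fd u ur.
  move=> e e0; have := fd' e e0.
  have n1 : \forall v \near (u : Cplx R), normc (v - c) < r.
    apply/near_discP; exists (r - normc (u - c)) => [|v vu]; first by rewrite subr_gt0.
    by have := normcD (v - u) (u - c); rewrite addrA subrK; lra.
  apply: filterS2 n1 => v vr; rewrite (fE v vr) (fE u ur).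
  congr (normc _ <= _); ring.
have lM : normc l <= M.
  have rr : 0 < r1 - normc (u - c) by rewrite subr_gt0.
  apply: (has_deriv_le rr hl) => v vu; apply: hM => //.
  by have := normcD (v - u) (u - c); rewrite addrA subrK; lra.
apply/negP => /eqP d0; move: dE; rewrite d0 mulr0 => /esym/eqP.
rewrite mulf_eq0 expf_eq0 (negbTE uc0) andbF /= => /eqP E.
have hu : normc (h u - h c) <= M * normc (u - c) by apply: hM => //; rewrite subrr normc0.
have h1 := normc_dist (h c) (h u); rewrite (normcB (h c)) in h1.
have h2 : normc (m.+1%:R * h u) = m.+1%:R * normc (h u).
  by rewrite normcM -[m.+1%:R](rmorph_nat (real_complex R)) normc_real normr_nat.
have h3 : normc (m.+1%:R * h u) = normc (((u : R[i]) - c) * l).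
  by rewrite -normcN; congr normc; apply/eqP; rewrite eq_sym -addr_eq0 addrC E.
rewrite h2 normcM in h3.
have h4 : normc (h u) <= m.+1%:R * normc (h u).
  by rewrite ler_peMl ?normc_ge0// ler1n.
have h5 := ler_wpM2l (normc_ge0 (u - c)) lM.
have h6 := normc_ge0 (u - c); lra.
Qed.

(** A continuous lift [tau] of a holomorphic map through a locally injective holomorphic
    [xi] is holomorphic: by division where xi' does not vanish, and at the isolated
    critical points because they are removable. *)
Theorem derivable_lift xi tau c (r : R) : 0 < r ->
  (forall z, normc (z - c) < r -> {for z, continuous tau}) -> disc_injective tau c r ->
  (forall z, normc (z - tau c) < r -> derivable xi z 1) -> disc_injective xi (tau c) r ->
  (forall z, normc (z - c) < r -> derivable (fun v => xi (tau v)) z 1) ->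
  derivable tau c 1.
Proof.
move=> r0 tc tinj xd xinj xtd.
have cr : normc (c - c) < r by rewrite subrr normc0.
have := injective_deriv_neq0 r0 xd xinj; move=> /(tc c cr) /near_discP[d d0 Hd].
have m0 : 0 < Num.min r d by rewrite lt_min r0.
apply: (removable_singularity m0); first exact: tc.
move=> z /andP[zc0]; rewrite lt_min => /andP[zr zd].
have zc : z != c by rewrite -subr_eq0 -normc_gt0.
have tzc : tau z != tau c by apply: contraNneq zc => /(tinj _ _ zr cr) ->.
have [l l0 xl] := Hd z zd tzc.
have /derivable_normcP[l' xtl] := xtd z zr.
pose q : Cplx R -> Cplx R := fun v => dquot xi l (tau z) (tau v).
have qc : {for z, continuous q}.
  by apply: continuous_comp; [exact: tc|exact: dquot_continuous_at].
have qz : q z != 0 by rewrite /q /dquot eqxx.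
pose Q : Cplx R -> Cplx R := fun v => (dquot (fun v => xi (tau v)) l' z v : R[i]) / (q v : R[i]).
apply: (@has_deriv_near R tau z (Q z)); apply: caratheodory; last first.
  exact: continuous_cplx_div (dquot_continuous_at xtl) qc qz.
have q0 : \forall v \near z, q v != 0.
  have n0 : 0 < normc (q z) by rewrite normc_gt0.
  have /continuous_normcP/(_ _ n0) := qc; apply: filterS => v.
  by apply: contraTneq => ->; rewrite sub0r normcN ltxx.
apply: filterS q0 => v qv; rewrite /Q.
have E1 := dquotE xi l (tau z) (tau v).
have E2 := dquotE (fun v => xi (tau v)) l' z v.
apply: (mulfI qv); rewrite -E1 E2; field.
exact: qv.
Qed.

End InjectiveDerivative.

(** * Plane curves and their projective closures *)

Section PlaneCurves.
Variable R : realType.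
Implicit Types (f : mpoly.mpoly 2 R[i]) (x y : R[i]).

Lemma big_ord2 (T : Type) (idx : T) (op : Monoid.law idx) (F : 'I_2 -> T) :
  \big[op/idx]_i F i = op (F (inord 0)) (F (inord 1)).
Proof.
rewrite !big_ord_recl big_ord0 Monoid.mulm1; congr (op (F _) (F _)); apply: val_inj => /=.
  by rewrite inordK.
by rewrite inordK.
Qed.

Lemma big_ord3 (T : Type) (idx : T) (op : Monoid.law idx) (F : 'I_3 -> T) :
  \big[op/idx]_i F i = op (op (F (inord 0)) (F (inord 1))) (F (inord 2)).
Proof.
rewrite !big_ord_recl big_ord0 Monoid.mulm1 Monoid.mulmA.
by congr (op (op (F _) (F _)) (F _)); apply: val_inj => /=; rewrite inordK.
Qed.

Definition top_deg f : nat := (\max_(m <- mpoly.msupp f) mpoly.mdeg m)%N.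

Lemma top_deg_ge f m : m \in mpoly.msupp f -> (mpoly.mdeg m <= top_deg f)%N.
Proof. by move=> mf; rewrite /top_deg (big_rem m) //= leq_maxl. Qed.

Lemma bigmax_reached (I : eqType) (s : seq I) (F : I -> nat) : s != [::] ->
  exists2 i, i \in s & F i = (\max_(j <- s) F j)%N.
Proof.
elim: s => // i s IH _; rewrite big_cons.
have [->|/IH[j js E]] := eqVneq s [::].
  by exists i; rewrite ?mem_head// big_nil maxn0.
have [le|lt] := leqP (\max_(j <- s) F j) (F i).
  by exists i; rewrite ?mem_head.
by exists j; rewrite // in_cons js orbT.
Qed.

Lemma mdeg2 (m : mpoly.multinom 2) : mpoly.mdeg m = (m (inord 0) + m (inord 1))%N.
Proof. by rewrite mpoly.mdegE big_ord2. Qed.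

Lemma meval_homogenize f (v : 'rV[R[i]]_3) :
  mpoly.meval (v ord0) (homogenize f) =
  \sum_(m <- mpoly.msupp f) mpoly.mcoeff m f *
    (v ord0 (inord 0) ^+ m (inord 0) * v ord0 (inord 1) ^+ m (inord 1) *
     v ord0 (inord 2) ^+ (top_deg f - mpoly.mdeg m)).
Proof.
rewrite /homogenize raddf_sum /=; apply: eq_bigr => m _.
by rewrite mpoly.mevalZ !rmorphM !rmorphXn /= !mpoly.mevalXU.
Qed.

(** Euler: the homogenization is a form of degree [top_deg f]. *)
Lemma meval_homogenizeZ f (k : R[i]) (v : 'rV[R[i]]_3) :
  mpoly.meval ((k *: v) ord0) (homogenize f) =
  k ^+ top_deg f * mpoly.meval (v ord0) (homogenize f).
Proof.
rewrite !meval_homogenize mulr_sumr; apply: eq_big_seq => m /top_deg_ge md.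
have -> : k ^+ top_deg f = k ^+ m (inord 0) * k ^+ m (inord 1) * k ^+ (top_deg f - mpoly.mdeg m).
  by rewrite -!exprD -mdeg2 subnKC.
rewrite !mxE !exprMn.
move: (k ^+ _) (k ^+ _) (k ^+ _) (v ord0 _ ^+ _) (v ord0 _ ^+ _) (v ord0 _ ^+ _) (mpoly.mcoeff m f).
by move=> k0 k1 k2 v0 v1 v2 e; ring.
Qed.

Lemma projective_closureP f (P : P2 R) (v : 'rV[R[i]]_3) : val P = <[v]>%VS ->
  projective_closure f P <-> mpoly.meval (v ord0) (homogenize f) = 0.
Proof.
move=> Pv; split=> [|fv w]; first by apply; rewrite Pv memv_line.
by rewrite Pv => /vlineP[k ->]; rewrite meval_homogenizeZ fv mulr0.
Qed.

Lemma vec3E x y (z : R[i]) : [/\ vec3 x y z ord0 (inord 0) = x,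
  vec3 x y z ord0 (inord 1) = y & vec3 x y z ord0 (inord 2) = z].
Proof. by rewrite /vec3 !mxE !inordK. Qed.

Definition eval2 f x y : R[i] :=
  mpoly.meval (fun i : 'I_2 => if i == inord 0 then x else y) f.

Lemma inord10 : (inord 1 == inord 0 :> 'I_2) = false.
Proof. by apply/eqP => /(congr1 val); rewrite /= !inordK. Qed.

Lemma affine_closureP f (P : P2 R) x y : affine_point P x y ->
  projective_closure f P <-> eval2 f x y = 0.
Proof.
move=> /projective_closureP ->; rewrite meval_homogenize /eval2 mpoly.mevalE.
have [-> -> ->] := vec3E x y 1.
under eq_bigr do rewrite expr1n mulr1.
by under [in X in _ <-> X]eq_bigr do rewrite big_ord2 eqxx inord10.
Qed.

(** Setting Z = 1 commutes with the derivative in Y. *)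
Lemma affine_nonsingular f (P : P2 R) x y : affine_point P x y ->
  eval2 (mpoly.mderiv (inord 1) f) x y != 0 -> ~ singular_locus f P.
Proof.
move=> Pxy fy0 [_ /(_ (inord 1))]; rewrite /vanishes_at Pxy => /(_ _ (memv_line _)) E.
move/eqP: fy0; apply; rewrite -[RHS]E {E}.
have [v0 v1 v2] := vec3E x y 1.
rewrite {1}(mpoly.mpolyE f) /homogenize /eval2.
rewrite !(big_morph _ (@mpoly.mderivD _ _ _) (@mpoly.mderiv0 _ _ _)).
rewrite !(big_morph _ (@mpoly.mevalD _ _ _) (@mpoly.meval0 _ _ _)); apply: eq_bigr => m _.
rewrite !mpoly.mderivZ !mpoly.mevalZ; congr (_ * _).
rewrite /mvar !mpoly.mpolyXn -!mpoly.mpolyXD !mpoly.mderivX !mpoly.mevalZ !mpoly.mevalX.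
rewrite big_ord2 big_ord3 /= v0 v1 v2 expr1n mulr1 inord10 eqxx.
rewrite !mpoly.mnmBE !mpoly.mnmDE !mpoly.mulmnE !mpoly.mnm1E.
have I2 i j : (i < 2)%N -> (j < 2)%N -> (inord i == inord j :> 'I_2) = (i == j).
  by move=> i2 j2; rewrite -val_eqE /= !inordK.
have I3 i j : (i < 3)%N -> (j < 3)%N -> (inord i == inord j :> 'I_3) = (i == j).
  by move=> i2 j2; rewrite -val_eqE /= !inordK.
by rewrite !I2// !I3//= !mul0n !mul1n !add0n !addn0 !subn0.
Qed.

Lemma vec3_eta (v : 'rV[R[i]]_3) :
  v = vec3 (v ord0 (inord 0)) (v ord0 (inord 1)) (v ord0 (inord 2)).
Proof.
apply/rowP => j; rewrite /vec3 mxE; case: j => -[|[|[|//]]] jlt /=;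
  by congr (v _ _); apply: val_inj; rewrite /= inordK.
Qed.

Definition line3 x y z : {vspace 'rV[R[i]]_3} := <[vec3 x y z]>%VS.

Lemma vec3Z (k x y z : R[i]) : k *: vec3 x y z = vec3 (k * x) (k * y) (k * z).
Proof.
by rewrite [LHS]vec3_eta !mxE !inordK.
Qed.

Lemma P2_neq0 (P : P2 R) (v : 'rV[R[i]]_3) : val P = <[v]>%VS -> v != 0.
Proof.
move=> Pv; apply/eqP => v0; have := valP P; rewrite Pv v0.
by rewrite dim_vline eqxx.
Qed.

Lemma lineZ (k : R[i]) (v : 'rV[R[i]]_3) : k != 0 -> <[k *: v]>%VS = <[v]>%VS.
Proof.
move=> k0; apply/eqP; rewrite eqEsubv -!memvE; apply/andP; split.
  by rewrite memvZ ?memv_line.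
by rewrite -[v in v \in _](scalerK k0) memvZ ?memv_line.
Qed.

Lemma finite_points (s : seq {vspace 'rV[R[i]]_3}) :
  finite_set [set P : P2 R | val P \in s].
Proof.
apply: (finite_preimage (f := val : P2 R -> {vspace 'rV[R[i]]_3}) (B := [set` s])) => //.
by move=> P Q _ _; exact: val_inj.
Qed.

(** The points at infinity of a plane curve are the zeros of its form of top degree,
    which does not vanish identically. *)
Lemma finite_infinity f : f != 0 ->
  finite_set [set P : P2 R | projective_closure f P /\
    exists2 v : 'rV[R[i]]_3, val P = <[v]>%VS & v ord0 (inord 2) = 0].
Proof.
move=> f0.
pose top (m : mpoly.multinom 2) := mpoly.mdeg m == top_deg f.
pose q : {poly R[i]} := \sum_(m <- mpoly.msupp f | top m) mpoly.mcoeff m f *: 'X^(m (inord 0)).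
have q0 : q != 0.
  have [m mf md] : exists2 m, m \in mpoly.msupp f & mpoly.mdeg m = top_deg f.
    apply: bigmax_reached; by rewrite mpoly.msupp_eq0.
  apply/eqP => /(congr1 (fun p : {poly R[i]} => p`_(m (inord 0)))).
  rewrite coef0 coef_sum big_mkcond /= (bigD1_seq m) ?mpoly.msupp_uniq//= {1}/top md eqxx.
  rewrite coefZ coefXn eqxx mulr1 big1 ?addr0.
    by move=> /eqP; apply/negP; rewrite -mpoly.mcoeff_msupp.
  move=> m' m'm; case: ifP => // /eqP m'd; rewrite coefZ coefXn.
  case: eqP => [E|_]; last by rewrite mulr0.
  case/negP: m'm; apply/eqP/mpoly.mnmP => i.
  have E1 : m (inord 1) = m' (inord 1).
    by have := m'd; rewrite -md !mdeg2 E => /addnI ->.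
  have [->|->] : i = inord 0 \/ i = inord 1.
    by case: (i) => -[|[|//]] ilt; [left|right]; apply: val_inj; rewrite /= inordK.
  - by rewrite E.
  - by rewrite E1.
have [rs rsE] := closed_field_poly_normal q.
pose L := line3 1 0 0 :: [seq line3 r 1 0 | r <- rs].
apply: sub_finite_set (finite_points L) => P /= [fP [v Pv v2]].
have vn0 := P2_neq0 Pv.
rewrite /L Pv in_cons.
have vE := vec3_eta v; rewrite v2 in vE.
have [v1|v1] := eqVneq (v ord0 (inord 1)) 0.
  rewrite v1 in vE.
  have v00 : v ord0 (inord 0) != 0.
    by apply: contraNneq vn0 => v00; rewrite vE v00; apply/eqP/rowP => j; rewrite !mxE;
      case: j => -[|[|[]]].
  have -> : v = v ord0 (inord 0) *: vec3 1 0 0 by rewrite vec3Z mulr1 mulr0.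
  by rewrite lineZ ?eqxx.
apply/orP; right.
pose r := v ord0 (inord 0) / v ord0 (inord 1).
have vr : <[v]>%VS = line3 r 1 0.
  by rewrite /line3 -(lineZ (vec3 r 1 0) v1) vec3Z mulr0 mulr1 /r mulrC divfK// -vE.
rewrite vr; apply/mapP; exists r => //.
have : root q r.
  apply/rootP; rewrite horner_sum.
  have /(projective_closureP f)[/(_ fP) + _] : val P = line3 r 1 0 by exact: etrans Pv vr.
  rewrite meval_homogenize; have [-> -> ->] := vec3E r 1 0 => E.
  rewrite -[RHS]E [RHS](bigID top) /= [X in _ = _ + X]big_seq_cond.
  rewrite [X in _ = _ + X]big1 ?addr0.
    by apply: eq_bigr => m /eqP ->; rewrite hornerZ hornerXn subnn expr0 expr1n !mulr1.
  move=> m /andP[/top_deg_ge mle mtop].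
  rewrite expr0n subn_eq0 leqNgt ltn_neqAle mle andbT.
  by move: mtop; rewrite /top => ->; rewrite !mulr0.
rewrite rsE rootZ ?lead_coef_eq0// root_prod_XsubC.
exact.
Qed.

End PlaneCurves.

(** * The curve of the theorem *)

Section Curve.
Variables (R : realType) (n a : nat) (l : R[i]).
Hypothesis ha : (0 < a)%N.

Definition branch_poly (x : R[i]) : R[i] :=
  x ^+ a * (x ^+ 2 - 1) ^+ a * (x ^+ 2 - l ^+ 2) * (x ^+ 2 - l ^- 2).

Lemma eval2_curve (x y : R[i]) : eval2 (curve n a l) x y = y ^+ (2 ^ n) - branch_poly x.
Proof.
rewrite /eval2 /curve /mvar !(mpoly.mevalB, mpoly.mevalM, rmorphXn, mpoly.mevalXU, mpoly.mevalZ,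
  mpoly.meval1) /=.
rewrite ?(mpoly.mevalB, rmorphXn, mpoly.mevalXU, mpoly.meval1) /=.
rewrite ?(mpoly.mevalB, rmorphXn, mpoly.mevalXU, mpoly.meval1) /=.
by rewrite eqxx inord10 !mulr1 -!expr2.
Qed.

Lemma curve_neq0 : curve n a l != 0.
Proof.
apply/eqP => c0; have := eval2_curve 0 1; rewrite c0 /eval2 mpoly.meval0.
rewrite /branch_poly expr0n gtn_eqF// !mul0r subr0 expr1n => /esym/eqP.
by rewrite oner_eq0.
Qed.

Lemma eval2_curve_dy (x y : R[i]) :
  eval2 (mpoly.mderiv (inord 1) (curve n a l)) x y = (2 ^ n)%:R * y ^+ (2 ^ n).-1.
Proof.
pose D (p : mpoly.mpoly 2 R[i]) := mpoly.mderiv (inord 1) p.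
have DM p q : D p = 0 -> D q = 0 -> D (p * q) = 0.
  by rewrite /D mpoly.mderivM => -> ->; rewrite mul0r mulr0 addr0.
have D1 : D 1 = 0 by rewrite /D -mpoly.mpolyC1 mpoly.mderivC.
have DX p k : D p = 0 -> D (p ^+ k) = 0.
  by move=> Dp; elim: k => [|k IH]; rewrite ?expr0// exprS; exact: DM.
have DB p q : D p = 0 -> D q = 0 -> D (p - q) = 0.
  by rewrite /D mpoly.mderivB => -> ->; rewrite subrr.
have DC (k : R[i]) : D k%:A = 0 by rewrite /D mpoly.mderivZ; have := D1; rewrite /D => ->;
  rewrite scaler0.
have Dx : D (mvar R (inord 0)) = 0.
  by rewrite /D /mvar mpoly.mderivX mpoly.mnm1E eq_sym inord10 scale0r.
rewrite /curve mpoly.mderivB.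
rewrite [X in _ - X](_ : _ = 0); last first.
  by apply: (DM _ _ (DM _ _ (DM _ _ (DX _ _ Dx) (DX _ _ (DB _ _ (DX _ _ Dx) D1)))
    (DB _ _ (DX _ _ Dx) (DC _))) (DB _ _ (DX _ _ Dx) (DC _))).
rewrite subr0 /mvar mpoly.mpolyXn mpoly.mderivX /eval2 mpoly.mevalZ mpoly.mevalX.
rewrite big_ord2 /= !mpoly.mnmBE !mpoly.mulmnE !mpoly.mnm1E eqxx inord10 mul1n mul0n subn1.
by rewrite ?eqxx /= ?inord10 subn0 expr0 mul1r.
Qed.

Lemma P2_vpick (P : P2 R) : val P = <[vpick (val P)]>%VS.
Proof.
have dP := valP P.
apply/eqP; rewrite eq_sym eqEdim -memvE memv_pick (eqP dP) dim_vline vpick0.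
by rewrite -dimv_eq0 (eqP dP).
Qed.

Lemma affine_of_line (P : P2 R) (v : 'rV[R[i]]_3) : val P = <[v]>%VS -> v ord0 (inord 2) != 0 ->
  affine_point P (v ord0 (inord 0) / v ord0 (inord 2)) (v ord0 (inord 1) / v ord0 (inord 2)).
Proof.
move=> Pv v2; rewrite /affine_point Pv.
have vE := vec3_eta v.
rewrite {1}vE -(lineZ (vec3 _ _ 1) v2) vec3Z mulr1.
by rewrite ![v ord0 (inord 2) * _]mulrC !divfK.
Qed.

Lemma line_affine (P : P2 R) (v : 'rV[R[i]]_3) (x y : R[i]) : affine_point P x y ->
  val P = <[v]>%VS ->
  [/\ v ord0 (inord 2) != 0, x = v ord0 (inord 0) / v ord0 (inord 2) & y = v ord0 (inord 1) / v
    ord0 (inord 2)].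
Proof.
move=> Pxy Pv; have : v \in <[vec3 x y 1]>%VS by rewrite -Pxy Pv memv_line.
move=> /vlineP[k vk].
have vn0 := P2_neq0 Pv.
have k0 : k != 0 by apply: contraNneq vn0 => k0; rewrite vk k0 scale0r.
rewrite vk !mxE !inordK//= !mulr1; split=> //.
  by rewrite mulrC mulKf.
by rewrite mulrC mulKf.
Qed.

Lemma affine_point_inj (P : P2 R) (x y x' y' : R[i]) : affine_point P x y -> affine_point P x' y' ->
  x = x' /\ y = y'.
Proof.
move=> Pxy Pxy'; have [_ -> ->] := line_affine Pxy Pxy'.
by have [-> -> ->] := vec3E x' y' 1; rewrite !divr1.
Qed.

Definition on_torus (P : P2 R) := exists x y : R[i], [/\ affine_point P x y, x != 0 & y != 0].

Lemma finite_off_torus : finite_set [set P : P2 R | projective_closure (curve n a l) P /\ ~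
  on_torus P].
Proof.
pose L := [seq line3 r 0 1 | r <- [:: 0; 1; -1; l; -l; l^-1; -l^-1]].
apply: (@sub_finite_set _ _ ([set P : P2 R | projective_closure (curve n a l) P /\
    exists2 v : 'rV[R[i]]_3, val P = <[v]>%VS & v ord0 (inord 2) = 0] `|` [set P : P2 R | val P
      \in L])); last first.
  by rewrite finite_setU; split; [exact: finite_infinity curve_neq0|exact: finite_points].
move=> P [CP nP]; have Pv := P2_vpick P; set v := vpick _ in Pv.
have [v2|v2] := eqVneq (v ord0 (inord 2)) 0; first by left; split => //; exists v.
right => /=; move: (affine_of_line Pv v2); move: (_ / _) (_ / _) => y x Pxy.
have := (affine_closureP _ Pxy).1 CP; rewrite eval2_curve => /eqP; rewrite subr_eq0 => /eqP E.
have y0 : y = 0.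
  have [//|y0] := eqVneq y 0; exfalso; apply: nP; exists x, y; split => //.
  apply/negP => /eqP x0; case/negP: y0; rewrite x0 in E.
  move: E; rewrite /branch_poly expr0n gtn_eqF// !mul0r => /eqP.
  by rewrite expf_eq0 => /andP[].
rewrite Pxy y0; apply: (@map_f _ _ (fun r => line3 r 0 1) _ x); rewrite !inE.
move: E; rewrite y0 expr0n expn_eq0 /= /branch_poly => /esym/eqP.
rewrite !mulf_eq0 !expf_eq0 ha /= -{1}(expr1n R[i] 2) -exprVn !subr_eq0 !eqf_sqr.
by move=> /orP[/orP[/orP[|/orP[]]|/orP[]]|/orP[]] ->; rewrite ?orbT.
Qed.

End Curve.

(** * Finite subsets of a Riemann surface *)

Section PuncturedSurface.
Variables (R : realType) (S : riemannSurface R).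
Implicit Types (p q : S) (B : set S).

Lemma separate_points p q : p <> q -> exists U V : set S,
  [/\ open U, open V, U p, V q & U `&` V = set0].
Proof.
move=> pq; have pq' : p != q by apply/eqP.
have := @rs_hausdorff R S; rewrite open_hausdorff => /(_ p q pq')[[U V] /= [pU qV] [oU oV UV]].
exists U, V; rewrite !inE in pU qV; split => //.
by apply/eqP; rewrite UV.
Qed.

Lemma separate_finite B q : finite_set B -> exists U V : set S,
  [/\ open U, open V, U q, (forall b, B b -> b <> q -> V b) & U `&` V = set0].
Proof.
move=> /finite_seqP[s ->]; elim: s => [|b s [U [V [oU oV Uq VB UV]]]].
  by exists setT, set0; split=> //; [exact: openT|exact: open0|rewrite setI0].
have [bq|/eqP bq] := eqVneq b q.
  exists U, V; split=> // x /=; rewrite in_cons => /orP[/eqP->|]; [by rewrite bq|exact: VB].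
have [U' [V' [oU' oV' U'q V'b UV']]] := separate_points (nesym bq).
exists (U `&` U'), (V `|` V'); split; [exact: openI|exact: openU|by []| |].
  by move=> x /=; rewrite in_cons => /orP[/eqP-> _|xs xq]; [right|left; exact: VB].
apply/seteqP; split=> // x [[Ux U'x] [Vx|V'x]].
  by have : (U `&` V) x by []; rewrite UV.
by have : (U' `&` V') x by []; rewrite UV'.
Qed.

Lemma near_finite B q : finite_set B -> \forall x \near q, B x -> x = q.
Proof.
move=> /(separate_finite q)[U [V [oU oV Uq VB UV]]].
have : nbhs q U by exact: open_nbhs_nbhs.
apply: filterS => x Ux Bx; apply: contrapT => xq.
have UVx : (U `&` V) x by split=> //; exact: VB.
by rewrite UV in UVx.
Qed.

Lemma near_complement B q : finite_set B -> ~ B q -> \forall x \near q, ~ B x.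
Proof.
by move=> fB nBq; apply: filterS (near_finite q fB) => x + Bx => /(_ Bx) xq; rewrite -xq in nBq.
Qed.

Lemma chart_disc (phi : chart R S) p (V : set S) : chart_dom phi p -> nbhs p V ->
  exists2 d : R, 0 < d & forall z, normc (z - chart_map phi p) < d ->
    (chart_map phi @` chart_dom phi) z /\ V (chart_inv phi z).
Proof.
move=> php Vp.
have im : (chart_map phi @` chart_dom phi) (chart_map phi p) by exists p.
have n1 : \forall z \near (chart_map phi p), (chart_map phi @` chart_dom phi) z.
  by apply: open_nbhs_nbhs; split; [exact: chart_img_open|exact: im].
have n2 : \forall z \near (chart_map phi p), V (chart_inv phi z).
  by apply: (chart_inv_cont im); rewrite chart_mapK.
have n3 : \forall z \near (chart_map phi p), (chart_map phi @` chart_dom phi) z /\ V (chart_inv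
  phi z).
  exact: filterI n1 n2.
have /near_discP[d d0 Hd] := n3.
by exists d => // z /Hd.
Qed.

Lemma chart_invK (phi : chart R S) z : (chart_map phi @` chart_dom phi) z ->
  chart_dom phi (chart_inv phi z) /\ chart_map phi (chart_inv phi z) = z.
Proof. by move=> [q phq <-]; rewrite chart_mapK. Qed.

(** In a chart at p, go from p in the direction of the positive reals. *)
Lemma dense_complement B p (V : set S) : finite_set B -> nbhs p V -> exists2 q, V q & ~ B q.
Proof.
move=> /finite_seqP[s ->] Vp; have [phi _ php] := rs_cover p.
have [d d0 Hd] := chart_disc php Vp.
have H1 := near_right_notin (chart_map phi p) [seq (chart_map phi b : R[i]) | b <- s].
have n1 : \forall z \near chart_map phi p, normc (z - chart_map phi p) < d.
  by apply/near_discP; exists d.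
have H2 := near_right_shift n1.
near (0 : R)^'+ => h.
have h1 : chart_map phi p + h%:C%C \notin [seq (chart_map phi b : R[i]) | b <- s] by near: h;
  exact: H1.
have h2 : normc (chart_map phi p + h%:C%C - chart_map phi p) < d by near: h; exact: H2.
have [im Vz] := Hd _ h2.
exists (chart_inv phi (chart_map phi p + h%:C%C)) => //= bs; case/negP: h1.
by apply/mapP; exists (chart_inv phi (chart_map phi p + h%:C%C)) => //;
  have [_ ->] := chart_invK im.
Unshelve. all: by end_near. Qed.

Lemma eq_off_finite B (u v : S -> S) : finite_set B -> continuous u -> continuous v ->
  (forall p, ~ B p -> u p = v p) -> u = v.
Proof.
move=> fB uc vc uv; apply/funext => p; apply: contrapT => /separate_points[U [V [oU oV Up Vp UV]]].
have n1 : nbhs p (u @^-1` U) by apply: uc; exact: open_nbhs_nbhs.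
have n2 : nbhs p (v @^-1` V) by apply: vc; exact: open_nbhs_nbhs.
have [q [Uq Vq] nBq] := dense_complement fB (filterI n1 n2).
have UVq : (U `&` V) (u q) by split=> //=; rewrite uv.
by rewrite UV in UVq.
Qed.

Lemma connected_segment (A : set (Cplx R)) (z w : R[i]) :
  (forall t : R, 0 <= t <= 1 -> A (z + t%:C%C * (w - z))) ->
  exists B : set (Cplx R), [/\ B z, B w, B `<=` A & connected B].
Proof.
move=> zwA; exists ((fun t : R => z + t%:C%C * (w - z) : Cplx R) @` `[0, 1]); split.
- by exists 0; rewrite /= ?in_itv /= ?lexx ?ler01//; rewrite mul0r addr0.
- by exists 1; rewrite /= ?in_itv /= ?lexx ?ler01//; rewrite mul1r addrC subrK.
- by move=> _ [t /= + <-]; rewrite in_itv /= => /zwA.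
apply: connected_continuous_connected; first exact: segment_connected.
apply: continuous_subspaceT => t; apply/continuous_normcP => e e0.
have k0 : 0 < normc (w - z) + 1 by have := normc_ge0 (w - z); lra.
near=> t'.
rewrite (_ : _ - _ = (t' - t)%:C%C * (w - z)); last by rewrite rmorphB /=; ring.
rewrite normcM normc_real.
have : `|t' - t| < e / (normc (w - z) + 1).
  by near: t'; apply: cvgr_distC_lt => //; rewrite divr_gt0.
rewrite ltr_pdivlMr//; have := normr_ge0 (t' - t); have := normc_ge0 (w - z); nra.
Unshelve. all: by end_near. Qed.

(** Two points of the punctured disc are joined by a path of at most two segments:
    avoid the centre by going through i times the first point if necessary. *)
Lemma connected_punctured_disc (c : R[i]) (d : R) :
  connected [set z : Cplx R | 0 < normc (z - c) < d].
Proof.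
set A := [set z : Cplx R | _].
have seg (z w : R[i]) : A z -> A w ->
    (forall t : R, 0 <= t <= 1 -> (1 - t)%:C%C * (z - c) + t%:C%C * (w - c) != 0) ->
    connected_component A z w.
  move=> /andP[z0 zd] /andP[w0 wd] nz.
  have [|B [Bz Bw BA cB]] := @connected_segment A z w; last by exists B.
  move=> t t01; rewrite /A /=.
  have -> : z + t%:C%C * (w - z) - c = (1 - t)%:C%C * (z - c) + t%:C%C * (w - c).
    by rewrite rmorphB rmorph1 /=; ring.
  rewrite normc_gt0 nz//=; apply: le_lt_trans (normcD _ _) _.
  rewrite !normcM !normc_real !ger0_norm; [|lra..].
  have [->|t1] := eqVneq t 1; first by rewrite subrr mul0r add0r mul1r.
  have : 0 < 1 - t by rewrite subr_gt0 lt_neqAle t1 /=; lra.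
  nra.
have all (z w : R[i]) : A z -> A w -> connected_component A z w.
  move=> Az Aw.
  have [[t [t01 tE]]|no] := pselect (exists t : R, 0 <= t <= 1 /\
     (1 - t)%:C%C * (z - c) + t%:C%C * (w - c) = 0); last first.
    by apply: seg => // t t01; apply/eqP => E; apply: no; exists t.
  have Z0 : z - c != 0 by rewrite -normc_gt0; case/andP: Az.
  have W0 : w - c != 0 by rewrite -normc_gt0; case/andP: Aw.
  have t0 : t != 0.
    by apply: contraNneq Z0 => t0; move: tE; rewrite t0 subr0 rmorph0 mul0r addr0 mul1r => ->.
  have t1 : t != 1.
    by apply: contraNneq W0 => t1; move: tE; rewrite t1 subrr rmorph0 mul0r add0r mul1r => ->.
  pose u : R[i] := c + 'i%C * (z - c).
  have uE : u - c = 'i%C * (z - c) by rewrite /u addrC addKr.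
  have ni : normc ('i%C : R[i]) = 1 by rewrite /= expr0n expr1n add0r sqrtr1.
  have Au : A u by rewrite /A /= uE normcM ni mul1r.
  have cplx0 (x y : R) (v : R[i]) : v != 0 -> (x%:C%C + 'i%C * y%:C%C) * v = 0 -> x = 0 /\ y = 0.
    move=> v0 /eqP; rewrite mulf_eq0 (negbTE v0) orbF eq_complex /=.
    by move=> /andP[/eqP xE /eqP yE]; split; lra.
  apply: (@connected_component_trans _ A u).
    apply: seg => // x x01; apply/eqP; rewrite uE => E.
    have [] := cplx0 (1 - x) x (z - c) Z0; last lra.
    by rewrite -[RHS]E; ring.
  apply: seg => // x x01; apply/eqP; rewrite uE => E.
  have [] := cplx0 (- (x * (1 - t))) ((1 - x) * t) (z - c) Z0.
    rewrite rmorphN !rmorphM /=.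
    transitivity (t%:C%C * ((1 - x)%:C%C * ('i%C * (z - c)) + x%:C%C * (w - c))
       - x%:C%C * ((1 - t)%:C%C * (z - c) + t%:C%C * (w - c))); first by ring.
    by rewrite E tE !mulr0 subrr.
  move=> /eqP; rewrite oppr_eq0 mulf_eq0 subr_eq0 [1 == t]eq_sym (negbTE t1) orbF => /eqP ->.
  by rewrite subr0 mul1r => /eqP; rewrite (negbTE t0).
have [A0|/set0P[z Az]] := eqVneq A set0; first by rewrite A0; exact: connected0.
have -> : A = connected_component A z.
  by apply/seteqP; split=> [w Aw|]; [exact: all|exact: connected_component_sub].
exact: component_connected.
Qed.

(** W is the image of a punctured disc under an inverse chart. *)
Lemma connected_punctured_nbhs p (V : set S) : nbhs p V -> exists W : set S,
  [/\ W `<=` V, ~ W p, connected W & \forall q \near p, q <> p -> W q].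
Proof.
move=> Vp; have [phi _ php] := rs_cover p.
have [d d0 Hd] := chart_disc php Vp.
pose D := [set z : Cplx R | 0 < normc (z - chart_map phi p) < d].
exists (chart_inv phi @` D); split.
- by move=> _ [z /andP[_ /Hd[_ Vz]] <-].
- move=> [z /andP[z0 zd] zp]; have [im _] := Hd z zd.
  have [_ E] := chart_invK im.
  by move: z0; rewrite -E zp subrr normc0 ltxx.
- apply: connected_continuous_connected; first exact: connected_punctured_disc.
  apply: continuous_in_subspaceT => z; rewrite inE => /andP[_ /Hd[im _]].
  exact: chart_inv_cont.
have n1 : \forall q \near p, chart_dom phi q.
  by apply: open_nbhs_nbhs; split; [exact: chart_dom_open|exact: php].
have n2 : \forall q \near p, normc (chart_map phi q - chart_map phi p) < d.
  by have /continuous_normcP := chart_map_cont php; apply.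
apply: filterS2 n1 n2 => q phq qd qp; exists (chart_map phi q); last exact: chart_mapK.
rewrite /D /= qd andbT normc_gt0 subr_eq0; apply/eqP => E; apply: qp.
by rewrite -(chart_mapK phq) E chart_mapK.
Qed.

End PuncturedSurface.

(** * Extending maps across finite sets *)

Section Extension.
Variables (R : realType) (S : riemannSurface R).
Hypothesis S_compact : compact [set: S].
Implicit Types (p q : S) (B : set S) (T t : S -> S).

(** [t] and [t'] are inverse homeomorphisms of the complement of [B]; their values on
    [B] are arbitrary. *)
Section OverFiniteSet.
Variables (B : set S) (t t' : S -> S).
Hypothesis B_fin : finite_set B.
Hypotheses (tB : forall p, ~ B p -> ~ B (t p)) (t'B : forall p, ~ B p -> ~ B (t' p)).
Hypotheses (tK : forall p, ~ B p -> t' (t p) = p) (t'K : forall p, ~ B p -> t (t' p) = p).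
Hypotheses (t_cont : forall p, ~ B p -> {for p, continuous t})
           (t'_cont : forall p, ~ B p -> {for p, continuous t'}).

(** [t] is proper: points of a compact set disjoint from [B] have preimages away from [B],
    because the inverse is continuous there. *)
Lemma near_exceptional p (V : set S) : B p -> open V -> B `<=` V ->
  \forall q \near p, ~ B q -> V (t q).
Proof.
move=> Bp oV BV.
have cK : compact (~` V).
  by apply: (subclosed_compact _ S_compact) => //; exact: open_closedC.
have N : \forall q \near p, ~` V `<=` (fun k => ~ B q -> t q <> k).
  apply: ((compact_near_coveringP _).1 cK S (nbhs p) (fun q k => ~ B q ->
    t q <> k) (nbhs_filter p)).
  move=> k nVk; have nBk : ~ B k by move=> /BV.
  have kp : t' k <> p by move=> E; apply: (t'B nBk); rewrite E.
  have [U [W [oU oW Uk Wp UW]]] := separate_points kp.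
  have n1 : nbhs k (t' @^-1` U) by apply: (t'_cont nBk); exact: open_nbhs_nbhs.
  exists (t' @^-1` U, W); first by split=> //=; exact: open_nbhs_nbhs.
  move=> [k' q] [/= Uk' Wq] nBq E.
  have UWq : (U `&` W) q by split=> //; rewrite -(tK nBq) E.
  by rewrite UW in UWq.
apply: filterS N => q H nBq; apply: contrapT => nV.
exact: (H (t q) nV nBq).
Qed.

(** The values of [t] near an exceptional point cluster somewhere by compactness, and the
    image of a small punctured disc, being connected, stays near a single point. *)
Lemma limit_at_exceptional p : B p -> exists q, forall V : set S, nbhs q V ->
  \forall p' \near p, ~ B p' -> V (t p').
Proof.
move=> Bp.
pose G := [set A : set S | \forall p' \near p, ~ B p' -> A (t p')].
have GF : ProperFilter G.
  split.
    move=> G0; have [q] := dense_complement B_fin G0.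
    by move=> /[swap] nBq /(_ nBq).
  split=> [|A A' GA GA'|A A' AA' GA].
  - exact: (filterS (fun _ _ _ => I) filterT).
  - move: GA GA'; rewrite /G /= => GA GA'.
    by apply: filterS2 GA GA' => q H H' nBq; split; [exact: H|exact: H'].
  - by move: GA; rewrite /G /=; apply: filterS => q H /H /AA'.
have [q [_ qG]] := S_compact GF (filterS (fun _ _ _ => I) filterT : G setT).
exists q => V Vq.
have [U [W [oU oW Uq WB UW]]] := separate_finite q B_fin.
have Bq : B q.
  apply: contrapT => nBq.
  have BW : B `<=` W by move=> b Bb; apply: WB => // bq; apply: nBq; rewrite -bq.
  have GW : G W by exact: near_exceptional.
  have [x [Wx Ux]] := qG W U GW (open_nbhs_nbhs (conj oU Uq)).
  have UWx : (U `&` W) x by [].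
  by rewrite UW in UWx.
pose U' := U `&` V^°.
have oU' : open U' by apply: openI => //; exact: open_interior.
have U'q : U' q by split.
have BU'W : B `<=` U' `|` W.
  by move=> b Bb; have [->|bq] := pselect (b = q); [left|right; exact: WB].
have n1 := near_exceptional Bp (openU oU' oW) BU'W.
have n2 := near_finite p B_fin.
have n3 : nbhs p [set p' | p' <> p -> ~ B p' /\ (U' `|` W) (t p')].
  apply: filterS2 n1 n2 => x H1 H2 xp.
  have nBx : ~ B x by move=> /H2.
  by split=> //; exact: H1.
have [X [XV nXp cX nX]] := connected_punctured_nbhs n3.
have XP x : X x -> ~ B x /\ (U' `|` W) (t x).
  by move=> Xx; apply: (XV x Xx) => xp; apply: nXp; rewrite -xp.
have ctX : connected (t @` X).
  apply: connected_continuous_connected => //.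
  by apply: continuous_in_subspaceT => x; rewrite inE => /XP[/t_cont].
have GX : G (t @` X).
  by apply: filterS nX => x Xx nBx; exists x => //; apply: Xx => xp; apply: nBx; rewrite xp.
have [y [tXy U'y]] := qG _ _ GX (open_nbhs_nbhs (conj oU' U'q)).
have disj x : U' x -> W x -> False.
  by move=> [Ux _] Wx; have UWx : (U `&` W) x by []; rewrite UW in UWx.
have XU' : (t @` X) `&` U' = t @` X.
  apply: ctX; first by exists y.
    by exists U'.
  exists (~` W); first exact: open_closedC.
  apply/seteqP; split=> x [tXx Hx]; split=> //; first by move=> Wx; exact: disj Wx.
  by case: tXx Hx => x' /XP[_ [|//]] + <-.
have GU' : G U'.
  move: GX; rewrite /G /=; apply: filterS => x H nBx.
  have tXU : ((t @` X) `&` U') (t x) by rewrite XU'; exact: H.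
  exact: tXU.2.
by move: GU'; rewrite /G /=; apply: filterS => x H /H[_ /interior_subset].
Qed.

Lemma extend_over_finite : exists2 T : S -> S, continuous T & forall p, ~ B p -> T p = t p.
Proof.
have H p : exists q, B p -> forall V : set S, nbhs q V -> \forall p' \near p, ~ B p' -> V (t p').
  have [Bp|nBp] := pselect (B p); last by exists p.
  by have [q qP] := limit_at_exceptional Bp; exists q.
have [f fP] := boolp.choice H.
pose T p := if `[< B p >] then f p else t p.
have TB p : B p -> T p = f p by rewrite /T => Bp; case: asboolP.
have TnB p : ~ B p -> T p = t p by rewrite /T => Bp; case: asboolP.
exists T => // p; have [Bp|nBp] := pselect (B p).
  move=> V; rewrite TB// => Vp; have n1 := fP p Bp V Vp; have n2 := near_finite p B_fin.
  apply: filterS2 n1 n2 => x H1 H2 /=.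
  have [Bx|nBx] := pselect (B x); last by rewrite TnB//; exact: H1.
  by rewrite (H2 Bx) TB//; exact: nbhs_singleton.
move=> V; rewrite TnB// => Vp.
have n1 : nbhs p (t @^-1` V) by exact: (t_cont nBp).
have n2 := near_complement B_fin nBp.
by apply: (@filterS2 _ (nbhs p) _ _ _ _ _ n1 n2) => x /= Vx nBx; rewrite TnB.
Qed.

End OverFiniteSet.

Definition holomorphic_at T p := forall phi psi, rs_atlas phi -> rs_atlas psi ->
  chart_dom phi p -> chart_dom psi (T p) ->
  derivable (chart_map psi \o T \o chart_inv phi) (chart_map phi p) 1.

Lemma holomorphic_mapP T : continuous T -> (forall p, holomorphic_at T p) -> holomorphic_map T.
Proof.
by move=> Tc Th; split=> // phi psi Aphi Apsi _ [p [php psTp] <-]; exact: Th.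
Qed.

(** In charts, the points of [B] are removable singularities. *)
Lemma holomorphic_off_finite B T : finite_set B -> continuous T ->
  (forall p, ~ B p -> holomorphic_at T p) -> forall p, holomorphic_at T p.
Proof.
move=> fB Tc Th p phi psi Aphi Apsi php psTp.
have n1 : nbhs p (T @^-1` chart_dom psi).
  by apply: Tc; apply: open_nbhs_nbhs; split=> //; exact: chart_dom_open.
have n2 := near_finite p fB.
have [d d0 Hd] := chart_disc php (filterI n1 n2).
have im : (chart_map phi @` chart_dom phi) (chart_map phi p) by exists p.
apply: (removable_singularity d0).
  have E : chart_inv phi (chart_map phi p) = p by exact: chart_mapK.
  have c1 : {for chart_map phi p, continuous (T \o chart_inv phi)}.
    by apply: continuous_comp; [exact: chart_inv_cont|exact: Tc].
  have c2 : {for (T \o chart_inv phi) (chart_map phi p), continuous (chart_map psi)}.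
    by rewrite /= E; exact: chart_map_cont psTp.
  exact: (continuous_comp c1 c2).
move=> z /andP[z0 /Hd[imz [/= Tz Bz]]].
have [dz zE] := chart_invK imz.
rewrite -{1}zE; apply: Th => // /Bz E.
by move: z0; rewrite -zE E subrr normc0 ltxx.
Qed.

Definition holomorphic_fun_near (g : S -> Cplx R) p := forall phi, rs_atlas phi ->
  chart_dom phi p -> \forall z \near chart_map phi p, derivable (g \o chart_inv phi) z 1.

(** [derivable_lift] in charts: the locally injective function [x] serves as a
    coordinate in which [T] is known to be holomorphic. *)
Lemma holomorphic_at_lift (x : S -> Cplx R) T p (U : set S) : continuous T -> injective T ->
  holomorphic_fun_near x (T p) -> nbhs (T p) U -> {in U &, injective x} ->
  holomorphic_fun_near (x \o T) p -> holomorphic_at T p.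
Proof.
move=> Tc Tinj xh Uq xinj xTh phi psi Aphi Apsi php psTp.
have n1 : nbhs p (T @^-1` chart_dom psi).
  by apply: Tc; apply: open_nbhs_nbhs; split=> //; exact: chart_dom_open.
have [d1 d10 H1] := chart_disc php n1.
have /near_discP[d2 d20 H2] := xTh phi Aphi php.
have [d3 d30 H3] := chart_disc psTp Uq.
have /near_discP[d4 d40 H4] := xh psi Apsi psTp.
pose tau : Cplx R -> Cplx R := chart_map psi \o T \o chart_inv phi.
have im : (chart_map phi @` chart_dom phi) (chart_map phi p) by exists p.
have tau_c : tau (chart_map phi p) = chart_map psi (T p) by rewrite /tau /= chart_mapK.
pose r := Num.min d1 (Num.min d2 (Num.min d3 d4)).
have r0 : 0 < r by rewrite /r !lt_min d10 d20 d30.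
have r1 : r <= d1 by rewrite /r ge_min lexx.
have r2 : r <= d2 by rewrite /r !ge_min lexx !orbT.
have r3 : r <= d3 by rewrite /r !ge_min lexx !orbT.
have r4 : r <= d4 by rewrite /r !ge_min lexx !orbT.
have lt1 z : normc (z - chart_map phi p) < r -> normc (z - chart_map phi p) < d1 by move=> ?; lra.
apply: (@derivable_lift R (x \o chart_inv psi) tau (chart_map phi p) r r0).
- move=> z /lt1/H1[imz /= Tz]; have [dz zE] := chart_invK imz.
  have c1 : {for z, continuous (T \o chart_inv phi)}.
    by apply: continuous_comp; [exact: chart_inv_cont|exact: Tc].
  exact: (continuous_comp c1 (chart_map_cont Tz)).
- move=> z w /lt1/H1[imz /= Tz] /lt1/H1[imw /= Tw] E.
  have [_ zE] := chart_invK imz; have [_ wE] := chart_invK imw.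
  rewrite -zE -wE; congr chart_map; apply: Tinj.
  by rewrite -(chart_mapK Tz) -(chart_mapK Tw); congr chart_inv.
- by rewrite tau_c => z zr; apply: H4; lra.
- rewrite tau_c => z w zr wr E.
  have [imz Uz] := H3 z ltac:(lra); have [imw Uw] := H3 w ltac:(lra).
  have [_ zE] := chart_invK imz; have [_ wE] := chart_invK imw.
  by rewrite -zE -wE; congr chart_map; apply: xinj; rewrite ?inE.
move=> z zr; have d2z : derivable (x \o T \o chart_inv phi) z 1 by apply: H2; lra.
apply: near_eq_derivable_cplx d2z.
apply/near_discP; exists (r - normc (z - chart_map phi p)) => [|w wz]; first by rewrite subr_gt0.
have wr : normc (w - chart_map phi p) < r.
  by have := normcD (w - z) (z - chart_map phi p); rewrite addrA subrK; lra.
have [_ /= Tw] := H1 w (lt1 w wr).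
by rewrite /tau /= chart_mapK.
Qed.

End Extension.

(** * Coordinate functions on the normalization *)

Lemma continuous_cplx_sum (R : realType) (T : topologicalType) (p : T) (I : Type) (r : seq I)
    (F : I -> T -> Cplx R) : (forall i, {for p, continuous (F i)}) ->
  {for p, continuous (fun x => \sum_(i <- r) (F i x : R[i]) : Cplx R)}.
Proof.
move=> Fc; elim: r => [|i r IH].
  by rewrite (_ : (fun _ => _) = fun=> 0); [exact: continuous_cplx_cst|apply/funext => x;
    rewrite big_nil].
rewrite (_ : (fun _ => _) = (fun x => (F i x : R[i]) + \sum_(i <- r) (F i x : R[i]) : Cplx R)).
  exact: (continuous_cplxD (Fc i) IH).
by apply/funext => x; rewrite big_cons.
Qed.

Lemma continuous_neq0 (R : realType) (T : topologicalType) (p : T) (F : T -> Cplx R) :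
  {for p, continuous F} -> F p != 0 -> \forall q \near p, F q != 0.
Proof.
rewrite -normc_gt0 => /continuous_normcP Fc F0; apply: filterS (Fc _ F0) => q.
by apply: contraTneq => ->; rewrite sub0r normcN ltxx.
Qed.

Lemma continuous_fst (T U : topologicalType) (V : topologicalType) (f : T -> V) (p : T) (q : U) :
  {for p, continuous f} -> {for (p, q), continuous (fun r : T * U => f r.1)}.
Proof. by move=> fc; apply: (@continuous_comp _ _ _ (@fst T U) f) => //; exact: cvg_fst. Qed.

Lemma continuous_snd (T U : topologicalType) (V : topologicalType) (f : U -> V) (p : T) (q : U) :
  {for q, continuous f} -> {for (p, q), continuous (fun r : T * U => f r.2)}.
Proof. by move=> fc; apply: (@continuous_comp _ _ _ (@snd T U) f) => //; exact: cvg_snd. Qed.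

Section Normalization.
Variables (R : realType) (n a : nat) (l : R[i]).
Hypothesis ha : (0 < a)%N.
Variables (S : riemannSurface R) (s : S -> P2 R).
Hypothesis hS : normalization (curve n a l) s.
Implicit Types (p q : S).

Let N := (2 ^ n)%N.
Let N_gt0 : (0 < N)%N. Proof. by rewrite expn_gt0. Qed.

Definition on_curve (x y : R[i]) := [/\ x != 0, y != 0 & y ^+ N = branch_poly a l x].

Definition coord p (x y : R[i]) := affine_point (s p) x y.

Definition off_torus : set S := [set p | ~ on_torus (s p)].

Lemma s_on_closure p : projective_closure (curve n a l) (s p).
Proof. by rewrite -(norm_image hS); exists p. Qed.

Lemma coord_curve p x y : coord p x y -> y ^+ N = branch_poly a l x.
Proof.
move=> pxy; have := (affine_closureP _ pxy).1 (@s_on_closure p).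
by rewrite eval2_curve => /eqP; rewrite subr_eq0 => /eqP.
Qed.

Lemma coord_on_curve p x y : coord p x y -> x != 0 -> y != 0 -> on_curve x y.
Proof. by move=> /coord_curve. Qed.

Lemma coord_exists x y : y ^+ N = branch_poly a l x -> exists p, coord p x y.
Proof.
move=> E.
have d1 : \dim <[vec3 x y 1]>%VS == 1%N.
  rewrite dim_vline (_ : vec3 x y 1 != 0)//; apply/eqP => v0.
  have [_ _] := vec3E x y 1; rewrite v0 mxE => /esym/eqP.
  by rewrite oner_eq0.
pose P : P2 R := exist _ <[vec3 x y 1]>%VS d1.
have Pxy : affine_point P x y by [].
have : projective_closure (curve n a l) P.
  by apply/(affine_closureP _ Pxy); rewrite eval2_curve E subrr.
by rewrite -(norm_image hS) => -[p _ pP]; exists p; rewrite /coord pP.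
Qed.

Lemma nonsingular p x y : coord p x y -> y != 0 -> ~ (s @^-1` singular_locus (curve n a l)) p.
Proof.
move=> pxy y0; apply: (affine_nonsingular pxy).
rewrite eval2_curve_dy mulf_neq0 ?expf_neq0// -normr_gt0 normr_nat ltr0n.
Qed.

Lemma coord_inj p q x y : coord p x y -> coord q x y -> y != 0 -> p = q.
Proof.
move=> pxy qxy y0; apply: (norm_inj hS).
- by rewrite inE; exact: nonsingular pxy y0.
- by rewrite inE; exact: nonsingular qxy y0.
by apply: val_inj; rewrite /= pxy qxy.
Qed.

(** The singular points have finitely many preimages by assumption; the other points
    map injectively to the finitely many points of the curve off the torus. *)
Lemma finite_off : finite_set off_torus.
Proof.
have F1 := finite_off_torus n l ha; have F2 := norm_finite hS.
apply: (@sub_finite_set _ _ ((s @^-1` singular_locus (curve n a l)) `|`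
  [set p | off_torus p /\ ~ (s @^-1` singular_locus (curve n a l)) p])).
  by move=> p np; have [|ns] := pselect ((s @^-1` singular_locus (curve n a l)) p); [left|right].
rewrite finite_setU; split=> //.
set A := [set p | _ /\ _].
have sA : finite_set (s @` A).
  apply: sub_finite_set F1 => _ [p [np _] <-]; split=> //; exact: s_on_closure.
suff sinj : {in A &, injective s} by rewrite -(eq_finite_set (inj_card_eq sinj)).
by move=> p q; rewrite !inE => -[_ np] [_ nq]; apply: (norm_inj hS); rewrite inE.
Qed.

Lemma local_lift p : exists (U : set S) (v : S -> 'rV[R[i]]_3),
  [/\ open U, U p, forall q, U q -> val (s q) = <[v q]>%VS &
      forall j : 'I_3, holomorphic_fun U (fun q => v q ord0 j)].
Proof. exact: (norm_holomorphic hS). Qed.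

(** The affine coordinates of a point in terms of homogeneous coordinates, in a form
    without divisions that passes to limits. *)
Lemma coord_lift q (v : 'rV[R[i]]_3) X Y : val (s q) = <[v]>%VS ->
  coord q X Y <-> v ord0 (inord 0) = v ord0 (inord 2) * X /\ v ord0 (inord 1) = v ord0 (inord 2)
    * Y.
Proof.
move=> qv; split=> [qXY|[v0 v1]].
  by have [v2 -> ->] := line_affine qXY qv; split; rewrite mulrC divfK.
have vE := vec3_eta v; rewrite v0 v1 -{3}[v ord0 (inord 2)]mulr1 -vec3Z in vE.
have v2 : v ord0 (inord 2) != 0.
  by apply: contraNneq (P2_neq0 qv) => v2; rewrite vE v2 scale0r.
by rewrite /coord /affine_point qv vE lineZ.
Qed.

Lemma holomorphic_fun_near_of (U : set S) (g : S -> Cplx R) p : open U -> U p ->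
  holomorphic_fun U g -> holomorphic_fun_near g p.
Proof.
move=> oU Up gU phi Aphi php.
have [d d0 Hd] := chart_disc php (open_nbhs_nbhs (conj oU Up)).
apply/near_discP; exists d => // z /Hd[imz Uz]; have [dz zE] := chart_invK imz.
by apply: gU => //; exists (chart_inv phi z).
Qed.

Lemma holomorphic_fun_near_continuous (g : S -> Cplx R) p : holomorphic_fun_near g p ->
  {for p, continuous g}.
Proof.
move=> gp; have [phi Aphi php] := rs_cover p.
have /nbhs_singleton/derivable_cplx_continuous gc := gp phi Aphi php.
have c1 : {for p, continuous ((g \o chart_inv phi) \o chart_map phi)}.
  by apply: continuous_comp; [exact: chart_map_cont|exact: gc].
apply: near_eq_continuous c1.
have : nbhs p (chart_dom phi) by apply: open_nbhs_nbhs; split=> //; exact: chart_dom_open.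
by apply: filterS => q phq /=; rewrite chart_mapK.
Qed.

(** Any vector spanning the line [s p] gives the same quotients; at infinity the value
    is meaningless. *)
Definition xfun (p : S) : Cplx R :=
  let v := vpick (val (s p)) in v ord0 (inord 0) / v ord0 (inord 2).
Definition yfun (p : S) : Cplx R :=
  let v := vpick (val (s p)) in v ord0 (inord 1) / v ord0 (inord 2).

Lemma coord_fun p x y : coord p x y -> xfun p = x /\ yfun p = y.
Proof. by move=> pxy; have [_ -> ->] := line_affine pxy (P2_vpick (s p)). Qed.

Lemma coord_xyfun p x y : coord p x y -> coord p (xfun p) (yfun p).
Proof. by move=> pxy; have [-> ->] := coord_fun pxy. Qed.

Lemma coord_near p x y : coord p x y -> [/\ \forall q \near p, coord q (xfun q) (yfun q),
  holomorphic_fun_near xfun p & holomorphic_fun_near yfun p].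
Proof.
move=> pxy; have [U [v [oU Up vU vh]]] := local_lift p.
have nU : nbhs p U by exact: open_nbhs_nbhs.
have h j := holomorphic_fun_near_of oU Up (vh j).
have v2p : v p ord0 (inord 2) != 0 by have [] := line_affine pxy (vU p Up).
have v2n := continuous_neq0 (holomorphic_fun_near_continuous (h (inord 2))) v2p.
have H q : U q -> v q ord0 (inord 2) != 0 -> coord q (v q ord0 (inord 0) / v q ord0 (inord 2))
    (v q ord0 (inord 1) / v q ord0 (inord 2)).
  by move=> Uq v2; exact: affine_of_line (vU q Uq) v2.
have near_fun (g : S -> Cplx R) (j : 'I_3) :
    (forall q, U q -> v q ord0 (inord 2) != 0 -> g q = v q ord0 j / v q ord0 (inord 2)) ->
    holomorphic_fun_near g p.
  move=> gE phi Aphi php.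
  have [d d0 Hd] := chart_disc php (filterI nU v2n).
  have n1 : \forall z \near chart_map phi p, normc (z - chart_map phi p) < d.
    by apply/near_discP; exists d.
  have n2 := h j phi Aphi php; have n3 := h (inord 2) phi Aphi php.
  apply: filterS3 n1 n2 n3 => z zd dj d2.
  have [_ [_ v2z]] := Hd z zd.
  apply: near_eq_derivable_cplx (derivable_cplx_div v2z dj d2).
  apply/near_discP; exists (d - normc (z - chart_map phi p)) => [|w wz]; first by rewrite subr_gt0.
  have wd : normc (w - chart_map phi p) < d.
    by have := normcD (w - z) (z - chart_map phi p); rewrite addrA subrK; lra.
  by have [_ [Uw v2w]] := Hd w wd; rewrite /= gE.
split.
- by apply: filterS2 nU v2n => q Uq v2; exact: coord_xyfun (H q Uq v2).
- by apply: (near_fun _ (inord 0)) => q Uq v2; have [] := coord_fun (H q Uq v2).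
- by apply: (near_fun _ (inord 1)) => q Uq v2; have [] := coord_fun (H q Uq v2).
Qed.

Lemma torus_coord p : ~ off_torus p ->
  [/\ coord p (xfun p) (yfun p), xfun p != 0 & yfun p != 0].
Proof.
move=> /contrapT[x [y [pxy x0 y0]]].
by have [-> ->] := coord_fun pxy.
Qed.

Lemma coord_torus p x y : coord p x y -> x != 0 -> y != 0 -> ~ off_torus p.
Proof. by move=> pxy x0 y0; apply; exists x, y. Qed.

(** On the torus part [x] is a local coordinate: [y^N] is a function of [x], and the N-th
    power map is injective near a nonzero point. *)
Lemma xfun_injective p : ~ off_torus p -> exists2 U : set S, nbhs p U & {in U &, injective xfun}.
Proof.
move=> pT; have [pxy x0 y0] := torus_coord pT.
have [nc xh yh] := coord_near pxy.
have yc := holomorphic_fun_near_continuous yh.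
pose K (r : S * S) : Cplx R := \sum_(i < N) ((yfun r.1 ^+ (N.-1 - i) : R[i]) * (yfun r.2 ^+ i :
  R[i])).
have Kc : {for (p, p), continuous K}.
  apply: (@continuous_cplx_sum R _ (p, p) _ _ (fun (i : 'I_N) r => (yfun r.1 ^+ (N.-1 - i) :
    R[i]) * (yfun r.2 ^+ i : R[i]))) => i.
  have c1 := continuous_cplxX (n := (N.-1 - i)) (@continuous_fst _ S _ _ p p yc).
  have c2 := continuous_cplxX (n := i) (@continuous_snd S _ _ _ p p yc).
  exact: continuous_cplxM c1 c2.
have Kp : K (p, p) != 0.
  rewrite /K /= (eq_bigr (fun=> yfun p ^+ N.-1)); last first.
    move=> i _; rewrite -exprD subnK// -ltnS prednK//.
  rewrite sumr_const card_ord -mulr_natl mulf_neq0 ?expf_neq0//.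
  by rewrite -normr_gt0 normr_nat ltr0n.
have [[A A'] /= [pA pA'] AK] := continuous_neq0 Kc Kp.
have off := near_complement finite_off pT.
exists (A `&` A' `&` [set q | ~ off_torus q]); first by apply: filterI => //; exact: filterI.
move=> q q'; rewrite !inE => -[[Aq _] Tq] [[_ A'q'] Tq'] E.
have [qc qx0 qy0] := torus_coord Tq; have [q'c _ _] := torus_coord Tq'.
have /eqP := coord_curve qc; rewrite E -(coord_curve q'c) -subr_eq0 subrXX mulf_eq0.
have := AK (q, q') (conj Aq A'q'); rewrite /K /= => /negbTE -> .
rewrite orbF subr_eq0 => /eqP yE.
by apply: (coord_inj qc _ qy0); rewrite E yE.
Qed.

End Normalization.

(** * Lifting self-maps of the plane curve to the normalization *)

Section Lifting.
Variables (R : realType) (n a : nat) (l : R[i]).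
Hypothesis ha : (0 < a)%N.
Variables (S : riemannSurface R) (s : S -> P2 R).
Hypothesis hS : normalization (curve n a l) s.
Implicit Types (p q : S) (u : R[i] -> R[i]) (w : R[i] -> R[i] -> R[i]) (t T : S -> S).

Let off := off_torus s.
Let fin_off : finite_set off := finite_off ha hS.

(** The map (x, y) |-> (u x, w x y) on the part of the curve where x, y <> 0.  As x is
    a local coordinate there, holomorphy is a condition on the first component. *)
Record torus_map u w : Prop := TorusMap {
  tm_curve : forall x y, on_curve n a l x y -> on_curve n a l (u x) (w x y);
  tm_derivable : forall x : Cplx R, x != 0 -> derivable (u : Cplx R -> Cplx R) x 1;
  tm_continuous : forall (T : topologicalType) (b : T) (X Y : T -> Cplx R),
    {for b, continuous X} -> {for b, continuous Y} -> X b != 0 ->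
    {for b, continuous (fun r => w (X r) (Y r) : Cplx R)} }.

Definition acts_by t u w := forall p, ~ off p -> coord s (t p) (u (xfun s p)) (w (xfun s p) (yfun
  s p)).

Lemma torus_on_curve p : ~ off p -> on_curve n a l (xfun s p) (yfun s p).
Proof. by move=> /torus_coord[pc x0 y0]; exact: (coord_on_curve hS pc). Qed.

Lemma acts_by_exists u w : torus_map u w -> exists t, acts_by t u w.
Proof.
move=> tm.
have H p : exists q, ~ off p -> coord s q (u (xfun s p)) (w (xfun s p) (yfun s p)).
  have [|Tp] := pselect (off p); first by exists p.
  have [_ _ E] := tm_curve tm (torus_on_curve Tp).
  by have [q qc] := coord_exists hS E; exists q.
by have [t tP] := boolp.choice H; exists t.
Qed.

Lemma acts_by_off t u w : torus_map u w -> acts_by t u w -> forall p, ~ off p -> ~ off (t p).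
Proof.
move=> tm tP p Tp; have [x0 y0 _] := tm_curve tm (torus_on_curve Tp).
exact: coord_torus (tP p Tp) x0 y0.
Qed.

Lemma torus_map_continuous u w p x y : torus_map u w -> coord s p x y -> x != 0 ->
  {for p, continuous (fun q => u (xfun s q) : Cplx R)} /\
  {for p, continuous (fun q => w (xfun s q) (yfun s q) : Cplx R)}.
Proof.
move=> tm pxy x0; have [xE yE] := coord_fun pxy.
have [_ xh yh] := coord_near hS pxy.
have xc := holomorphic_fun_near_continuous xh; have yc := holomorphic_fun_near_continuous yh.
have xp0 : xfun s p != 0 by rewrite xE.
split; last exact: (tm_continuous tm xc yc xp0).
exact: (continuous_comp xc (derivable_cplx_continuous (tm_derivable tm xp0))).
Qed.

(** By compactness it suffices to separate [t q], for q near p, from each k outside a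
    given neighbourhood of [t p].  As [t p] is the only point above its image, k has
    an image different from that of [t p], and this is an inequality between
    homogeneous coordinates at k and the formula at p, which persists nearby. *)
Lemma acts_by_continuous t u w : torus_map u w -> acts_by t u w ->
  forall p, ~ off p -> {for p, continuous t}.
Proof.
move=> tm tP p Tp V; rewrite nbhsE => -[V' [oV' V'p] V'V].
have [pc x0 y0] := torus_coord Tp.
have [uc wc] := torus_map_continuous tm pc x0.
have [_ wy0 _] := tm_curve tm (torus_on_curve Tp).
have cK : compact (~` V').
  by apply: (subclosed_compact _ (norm_compact hS)) => //; exact: open_closedC.
suff N : \forall q \near p, ~` V' `<=` (fun k => ~ off q -> t q <> k).
  have N' := near_complement fin_off Tp.
  apply: filterS2 N N' => q H Tq; apply: V'V; apply: contrapT => nV'.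
  exact: (H (t q) nV' Tq).
apply: ((compact_near_coveringP _).1 cK S (nbhs p) (fun q k => ~ off q ->
  t q <> k) (nbhs_filter p)).
move=> k nV'k; have [U [v [oU Uk vU vh]]] := local_lift hS k.
have vc j : {for k, continuous (fun q => v q ord0 j : Cplx R)}.
  exact: holomorphic_fun_near_continuous (holomorphic_fun_near_of oU Uk (vh j)).
have nk : ~ coord s k (u (xfun s p)) (w (xfun s p) (yfun s p)).
  by move=> kc; apply: nV'k; rewrite (coord_inj hS kc (tP p Tp) wy0).
have close (j : 'I_3) (g : S -> Cplx R) : {for p, continuous g} ->
    v k ord0 j != v k ord0 (inord 2) * g p ->
    (forall q, ~ off q -> U (t q) -> v (t q) ord0 j = v (t q) ord0 (inord 2) * g q) ->
    \forall k' \near k & q \near p, ~ off q -> t q <> k'.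
  move=> gc vg tg.
  pose D (r : S * S) : Cplx R := (v r.1 ord0 j : R[i]) - (v r.1 ord0 (inord 2) : R[i]) * (g r.2 :
    R[i]).
  have Dc : {for (k, p), continuous D}.
    apply: continuous_cplxB; first exact: (@continuous_fst S S (Cplx R) (fun q => v q ord0 j) k p
      (vc j)).
    apply: continuous_cplxM; first exact: (@continuous_fst S S (Cplx R) (fun q => v q ord0 (inord
      2)) k p (vc (inord 2))).
    exact: (@continuous_snd S S (Cplx R) g k p gc).
  have D0 : D (k, p) != 0 by rewrite /D /= subr_eq0.
  have [[A B] /= [kA pB] AB] := continuous_neq0 Dc D0.
  exists (A `&` U, B) => /=.
    by split=> //; apply: filterI => //; exact: open_nbhs_nbhs.
  move=> [k' q] [/= [Ak' Uk'] Bq] Tq E.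
  have := AB (k', q) (conj Ak' Bq); rewrite /D /= subr_eq0 -E.
  by rewrite tg ?eqxx// E.
have tcoord q : ~ off q -> U (t q) ->
    v (t q) ord0 (inord 0) = v (t q) ord0 (inord 2) * u (xfun s q) /\
    v (t q) ord0 (inord 1) = v (t q) ord0 (inord 2) * w (xfun s q) (yfun s q).
  by move=> Tq Utq; apply/(coord_lift _ _ (vU _ Utq)); exact: tP.
have [E0|E0] := eqVneq (v k ord0 (inord 0)) (v k ord0 (inord 2) * u (xfun s p)); last first.
  by apply: (close (inord 0) (fun q => u (xfun s q))) => // q Tq Utq; have [] := tcoord q Tq Utq.
have [E1|E1] := eqVneq (v k ord0 (inord 1)) (v k ord0 (inord 2) * w (xfun s p) (yfun s p));
  last first.
  by apply: (close (inord 1) (fun q => w (xfun s q) (yfun s q))) => // q Tq Utq;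
    have [] := tcoord q Tq Utq.
by exfalso; apply: nk; apply/(coord_lift _ _ (vU k Uk)).
Qed.

(** Points with x, y <> 0 are dense, and the relations of [coord_lift] are closed. *)
Lemma acts_by_affine T u w p x y : continuous T -> acts_by T u w -> coord s p x y ->
  {for p, continuous (fun q => u (xfun s q) : Cplx R)} ->
  {for p, continuous (fun q => w (xfun s q) (yfun s q) : Cplx R)} ->
  coord s (T p) (u x) (w x y).
Proof.
move=> Tc TP pxy uc wc; have [xE yE] := coord_fun pxy.
have [U [v [oU UTp vU vh]]] := local_lift hS (T p).
have vc j : {for p, continuous (fun q => v (T q) ord0 j : Cplx R)}.
  apply: (@continuous_comp _ _ _ T (fun q => v q ord0 j : Cplx R)); first exact: Tc.
  exact: holomorphic_fun_near_continuous (holomorphic_fun_near_of oU UTp (vh j)).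
have NU : nbhs p (T @^-1` U) by apply: Tc; exact: open_nbhs_nbhs.
have lim (j : 'I_3) (g : S -> Cplx R) : {for p, continuous g} ->
    (forall q, ~ off q -> U (T q) -> v (T q) ord0 j = v (T q) ord0 (inord 2) * g q) ->
    v (T p) ord0 j = v (T p) ord0 (inord 2) * g p.
  move=> gc tg; apply/eqP; rewrite -subr_eq0; apply: contrapT => /negP D0.
  have Dc := continuous_cplxB (vc j) (continuous_cplxM (vc (inord 2)) gc).
  have [q [Dq Uq] Tq] := dense_complement fin_off (filterI (continuous_neq0 Dc D0) NU).
  by move: Dq; rewrite /= subr_eq0 tg ?eqxx.
have tcoord q : ~ off q -> U (T q) ->
    v (T q) ord0 (inord 0) = v (T q) ord0 (inord 2) * u (xfun s q) /\
    v (T q) ord0 (inord 1) = v (T q) ord0 (inord 2) * w (xfun s q) (yfun s q).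
  by move=> Tq Utq; apply/(coord_lift _ _ (vU _ Utq)); exact: TP.
apply/(coord_lift _ _ (vU _ UTp)); rewrite -xE -yE; split.
  by apply: (lim _ (fun q => u (xfun s q))) => // q Tq Uq; have [] := tcoord q Tq Uq.
by apply: (lim _ (fun q => w (xfun s q) (yfun s q))) => // q Tq Uq; have [] := tcoord q Tq Uq.
Qed.

Lemma acts_by_holomorphic T u w : torus_map u w -> continuous T -> injective T -> acts_by T u w ->
  holomorphic_map T.
Proof.
move=> tm Tc Tinj TP; apply: holomorphic_mapP => //.
apply: (holomorphic_off_finite fin_off Tc) => p Tp.
have [pc x0 y0] := torus_coord Tp.
have TTp := acts_by_off tm TP Tp; have [Tpc Tx0 Ty0] := torus_coord TTp.
have [V nV Vinj] := xfun_injective ha hS TTp.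
have [_ xh _] := coord_near hS pc; have [_ Txh _] := coord_near hS Tpc.
apply: (holomorphic_at_lift Tc Tinj Txh nV Vinj) => phi Aphi php.
have n1 := near_complement fin_off Tp.
have [d d0 Hd] := chart_disc php n1.
have n2 : \forall z \near chart_map phi p, normc (z - chart_map phi p) < d.
  by apply/near_discP; exists d.
have n3 := xh phi Aphi php.
apply: filterS2 n2 n3 => z zd xd.
have [_ Tz] := Hd z zd; have [zc xz0 _] := torus_coord Tz.
have dux := derivable_cplx_comp xd (tm_derivable tm xz0).
apply: near_eq_derivable_cplx dux.
apply/near_discP; exists (d - normc (z - chart_map phi p)) => [|v vz]; first by rewrite subr_gt0.
have vd : normc (v - chart_map phi p) < d.
  by have := normcD (v - z) (z - chart_map phi p); rewrite addrA subrK; lra.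
have [_ Tv] := Hd v vd.
by have [E _] := coord_fun (TP _ Tv); rewrite /= E.
Qed.

(** Both the map and its inverse are lifted to the complement of a finite set, where
    they are continuous; their extensions to [S] are inverse to each other by density. *)
Theorem torus_map_lift u w u' w' : torus_map u w -> torus_map u' w' ->
  (forall x y, on_curve n a l x y -> u' (u x) = x /\ w' (u x) (w x y) = y) ->
  (forall x y, on_curve n a l x y -> u (u' x) = x /\ w (u' x) (w' x y) = y) ->
  exists tau : AutRS S, acts_by tau u w.
Proof.
move=> tm tm' K K'.
have [t tP] := acts_by_exists tm; have [t' t'P] := acts_by_exists tm'.
have toff := acts_by_off tm tP; have t'off := acts_by_off tm' t'P.
have cancel_off t1 t2 u1 w1 u2 w2 : torus_map u1 w1 -> acts_by t1 u1 w1 -> acts_by t2 u2 w2 ->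
    (forall x y, on_curve n a l x y -> u2 (u1 x) = x /\ w2 (u1 x) (w1 x y) = y) ->
    forall p, ~ off p -> t2 (t1 p) = p.
  move=> tm1 t1P t2P K1 p Tp; have [pc x0 y0] := torus_coord Tp.
  have T1 := acts_by_off tm1 t1P Tp.
  apply: (coord_inj hS _ pc y0).
  have := t2P _ T1; have [-> ->] := coord_fun (t1P _ Tp).
  by have [-> ->] := K1 _ _ (torus_on_curve Tp).
have tK := cancel_off _ _ _ _ _ _ tm tP t'P K.
have t'K := cancel_off _ _ _ _ _ _ tm' t'P tP K'.
have tc := acts_by_continuous tm tP; have t'c := acts_by_continuous tm' t'P.
have [T Tc TE] := extend_over_finite (norm_compact hS) fin_off t'off tK tc t'c.
have [T' T'c T'E] := extend_over_finite (norm_compact hS) fin_off toff t'K t'c tc.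
have TP : acts_by T u w by move=> p Tp; rewrite TE//; exact: tP.
have T'P : acts_by T' u' w' by move=> p Tp; rewrite T'E//; exact: t'P.
have comp_id (f g : S -> S) : continuous f -> continuous g ->
    (forall p, ~ off p -> g (f p) = p) -> cancel f g.
  move=> fc gc fg p; have fgc : continuous (g \o f).
    by move=> q; apply: continuous_comp; [exact: fc|exact: gc].
  have idc : continuous (@idfun S) by move=> q.
  have E : g \o f = idfun by apply: (eq_off_finite fin_off fgc idc).
  by rewrite -[LHS]/((g \o f) p) E.
have TK : cancel T T'.
  by apply: comp_id => // p Tp; rewrite TE// T'E ?tK//; exact: toff.
have T'K : cancel T' T.
  by apply: comp_id => // p Tp; rewrite T'E// TE ?t'K//; exact: t'off.
have Th := acts_by_holomorphic tm Tc (can_inj TK) TP.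
have T'h := acts_by_holomorphic tm' T'c (can_inj T'K) T'P.
have bT : biholomorphic T by exists T'.
by exists (MkAut bT).
Qed.

Lemma aut_continuous (tau : AutRS S) : continuous tau.
Proof. by have [g [_ _ [] ]] := aut_biholo tau. Qed.

Lemma acts_by_unique (t1 t2 : S -> S) u w : torus_map u w -> continuous t1 -> continuous t2 ->
  acts_by t1 u w -> acts_by t2 u w -> t1 = t2.
Proof.
move=> tm c1 c2 P1 P2; apply: (eq_off_finite fin_off c1 c2) => p Tp.
have [_ y0 _] := tm_curve tm (torus_on_curve Tp).
exact: (coord_inj hS (P1 p Tp) (P2 p Tp) y0).
Qed.

End Lifting.

(** * Groups generated by two elements with equal squares *)

Section GroupLemmas.
Local Open Scope group_scope.
Variable G : groupType.
Implicit Types (g h t b : G).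

Lemma expg_modM g M k : g ^+ M = 1 -> g ^+ (k %% M) = g ^+ k.
Proof.
by move=> gM; rewrite [in RHS](divn_eq k M) expgnDr mulnC expgM gM expg1n mul1g.
Qed.

Lemma expg_gcd g m k : g ^+ m = 1 -> g ^+ k = 1 -> g ^+ gcdn m k = 1.
Proof.
case: m => [|m] gm gk; first by rewrite gcd0n.
have [km kn E _] := egcdnP k (ltn0Sn m).
have : g ^+ (km * m.+1) = 1 by rewrite mulnC expgM gm expg1n.
by rewrite E expgnDr mulnC expgM gk expg1n mul1g.
Qed.

(** A proper divisor of 2^(n+1) divides 2^n. *)
Lemma has_order_2power g n : g ^+ (2 ^ n.+1) = 1 -> g ^+ (2 ^ n) <> 1 -> has_order g (2 ^ n.+1).
Proof.
move=> g1 gn; split=> [||k /andP[k0 kM] gk]; rewrite ?expn_gt0//.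
have gg := expg_gcd g1 gk.
have /(dvdn_pfactor _ _ (isT : prime 2))[j jn E] := dvdn_gcdl (2 ^ n.+1) k.
rewrite E in gg.
move: jn; rewrite leq_eqVlt => /orP[/eqP jn|].
  have := dvdn_gcdr (2 ^ n.+1) k; rewrite E jn => /dvdn_leq -/(_ k0).
  by rewrite leqNgt kM.
rewrite ltnS => jn; apply: gn.
by rewrite -(subnKC jn) expnD expgM gg expg1n.
Qed.

(** A group presented by [t] of order [M] and an involution [b] outside [<t>] with
    [t b = b t^r]: every element is [b^e t^x] in exactly one way. *)
Section SplitExtension.
Variables (t b : G) (M r : nat).
Hypotheses (M1 : (1 < M)%N) (tM : has_order t M) (b2 : b * b = 1) (tb : t * b = b * t ^+ r).
Hypothesis bt : forall k, b <> t ^+ k.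

Definition normal_form (e : 'Z_2) (x : 'Z_M) : G := b ^+ e * t ^+ x.

Let t1 : t ^+ M = 1. Proof. by case: tM. Qed.

Lemma exp_ZpD (x y : 'Z_M) : t ^+ (x * y)%g = t ^+ (x + y)%N.
Proof. rewrite -[RHS](expg_modM _ t1); congr (t ^+ _) => /=; congr (_ %% _)%N.
exact: Zp_cast. Qed.

Lemma exp_ZpMn (x : 'Z_M) k : t ^+ (x *+ k)%R = t ^+ (x * k)%N.
Proof. by rewrite -[x in LHS]natr_Zp -mulrnA val_Zp_nat// expg_modM. Qed.

Lemma exp_Z2 (e e' : 'Z_2) : b ^+ (e * e')%g = b ^+ e * b ^+ e'.
Proof.
by case: e e' => [[|[|//]] ?] [[|[|//]] ?] /=; rewrite ?expg0 ?expg1 ?mul1g ?mulg1 ?b2.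
Qed.

Lemma exp_conj k : t ^+ k * b = b * t ^+ (k * r).
Proof.
elim: k => [|k IH]; first by rewrite mul1g mulg1.
by rewrite expgSr -mulgA tb mulgA IH -mulgA -expgnDr mulSn addnC.
Qed.

Lemma exp_conjZ2 k (e : 'Z_2) : t ^+ k * b ^+ e = b ^+ e * t ^+ (k * r ^ e).
Proof.
case: e => [[|[|//]] ?] /=; first by rewrite expg0 mulg1 mul1g expn0 muln1.
by rewrite expg1 expn1 exp_conj.
Qed.

Lemma normal_formM (e e' : 'Z_2) (x x' : 'Z_M) :
  normal_form e x * normal_form e' x' = normal_form (e * e') (x *+ r ^ e' * x')%g.
Proof.
rewrite /normal_form exp_Z2 exp_ZpD expgnDr exp_ZpMn !mulgA; congr (_ * _).
by rewrite -!mulgA exp_conjZ2.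
Qed.

Lemma normal_form_inj e e' x x' : normal_form e x = normal_form e' x' -> e = e' /\ x = x'.
Proof.
have tinj (y y' : 'Z_M) : t ^+ y = t ^+ y' -> y = y'.
  wlog yy' : y y' / (y <= y')%N.
    by move=> W; have [/W|/ltnW /W W'] := leqP y y'; [exact|move/esym/W' => ->].
  move=> E; apply: val_inj => /=; apply/eqP; rewrite eqn_leq yy' leqNgt; apply/negP => lt.
  have y'M : (y' < M)%N by have := ltn_ord y'; rewrite [X in (_ < X)%N]Zp_cast.
  have [_ _ /(_ (y' - y)%N)] := tM; apply; first by rewrite subn_gt0 lt /= ltn_subLR// ltn_addl.
  by apply: (mulgI (t ^+ y)); rewrite -expgnDr subnKC// mulg1.
have nb (y y' : 'Z_M) : b * t ^+ y = t ^+ y' -> False.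
  move=> E; apply: (bt (k := y' + (M - y))).
  have yM : (y <= M)%N by have := ltn_ord y; rewrite [X in (_ < X)%N]Zp_cast// => /ltnW.
  by rewrite expgnDr -E -mulgA -expgnDr subnKC// t1 mulg1.
rewrite /normal_form; case: e e' => [[|[|//]] ei] [[|[|//]] ei'] /=;
  rewrite ?expg0 ?expg1 ?mul1g.
- by move/tinj => ->; split=> //; exact: val_inj.
- by move/esym/nb.
- by move/nb.
by move/mulgI/tinj => ->; split=> //; exact: val_inj.
Qed.

End SplitExtension.

(** The image of a morphism is a subgroup, so it contains <g, h> as soon as it contains
    both generators. *)
Lemma isomorphic_gen2 (K : groupType) (phi : K -> G) g h : {morph phi : x y / x * y} ->
  injective phi -> (exists x, phi x = g) -> (exists x, phi x = h) ->
  (forall x, gen2 g h (phi x)) -> isomorphic_to (gen2 g h) K.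
Proof.
move=> phiM phiI [x xg] [y yh] phi_gen; exists phi; split=> //.
apply/seteqP; split=> [_ [z _ <-]//|k].
have phi1 : phi 1 = 1 by apply: (mulgI (phi 1)); rewrite -phiM !mulg1.
have phiV z : phi z^-1 = (phi z)^-1.
  by apply: (mulgI (phi z)); rewrite -phiM !mulgV.
move=> kgen; pose H : {pred G} := [pred k | `[< exists z, phi z = k >]].
have HP z : reflect (exists x, phi x = z) (z \in H) by exact: asboolP.
suff /HP[z zk] : k \in H by exists z.
apply: kgen.
- split; first by apply/HP; exists 1.
  by move=> u v /HP[u' <-] /HP[v' <-]; apply/HP; exists (u' * v'^-1); rewrite phiM phiV.
- by apply/HP; exists x.
- by apply/HP; exists y.
Qed.

Lemma gen2_mul g h u v : gen2 g h u -> gen2 g h v -> gen2 g h (u * v).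
Proof.
move=> uG vG H HC gH hH; apply: (group_closedM HC); [exact: uG|exact: vG].
Qed.

Lemma gen2_exp g h u k : gen2 g h u -> gen2 g h (u ^+ k).
Proof.
move=> uG; elim: k => [|k IH]; first by move=> H [].
by rewrite expgS; exact: gen2_mul.
Qed.

Lemma gen2_inv g h u : gen2 g h u -> gen2 g h u^-1.
Proof. by move=> uG H HC gH hH; apply: (group_closedV HC); exact: uG. Qed.

Lemma gen2l g h : gen2 g h g. Proof. by []. Qed.
Lemma gen2r g h : gen2 g h h. Proof. by []. Qed.

(** The cyclic group <t1> has index 2 in <t1, t2>, and it remains to find an involution
    outside <t1>. *)
Section TwoGenerators.
Variables (t1 t2 : G) (n : nat).
Hypotheses (t1N : t1 ^+ (2 ^ n) <> 1) (t1M : t1 ^+ (2 ^ n.+1) = 1) (t12 : t1 * t1 = t2 * t2).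
Hypothesis t2t1 : forall k, t2 <> t1 ^+ k.

Let M1 : (1 < 2 ^ n.+1)%N. Proof. by rewrite -{1}(expn0 2) ltn_exp2l. Qed.
Let order1 : has_order t1 (2 ^ n.+1) := has_order_2power t1M t1N.

Let expZ1 : t1 ^+ (1%R : 'Z_(2 ^ n.+1)) = t1.
Proof. by rewrite -[1%R]/(1%:R)%R val_Zp_nat// modn_small. Qed.

Lemma commuting_case : commute t1 t2 ->
  is_abelian (gen2 t1 t2) /\ isomorphic_to (gen2 t1 t2) ('Z_(2 ^ n.+1) * 'Z_2)%type.
Proof.
move=> ct.
pose b := t1^-1 * t2.
have cV : commute t1^-1 t2 by apply/commute_sym/commuteV/commute_sym.
have b2 : b * b = 1.
  by rewrite /b mulgA -(mulgA t1^-1) -cV mulgA -(mulgA (t1^-1 * t1^-1)) -t12 -invMg mulVg.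
have tb : t1 * b = b * t1 ^+ 1.
  by rewrite expg1 /b mulgA mulgV mul1g -mulgA -ct mulgA mulVg mul1g.
have bt k : b <> t1 ^+ k.
  by move=> E; apply: (t2t1 (k := k.+1)); rewrite expgS -E /b mulgA mulgV mul1g.
pose phi (xe : 'Z_(2 ^ n.+1) * 'Z_2) := normal_form t1 b xe.2 xe.1.
have phiM : {morph phi : x y / x * y}.
  move=> [x e] [x' e']; rewrite /phi (normal_formM M1 order1 b2 tb) /= exp1n mulr1n.
  by congr normal_form.
have iso : isomorphic_to (gen2 t1 t2) ('Z_(2 ^ n.+1) * 'Z_2)%type.
  apply: (isomorphic_gen2 phiM).
  - move=> [x e] [x' e'] /(normal_form_inj M1 order1 bt)[].
    by move=> /= -> ->.
  - by exists (1%R, 0%R); rewrite /phi /normal_form /= mul1g expZ1.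
  - exists (1%R, 1%R); rewrite /phi /normal_form /= expg1 expZ1 /b.
    by rewrite -mulgA -ct mulgA mulVg mul1g.
  - move=> [x e]; apply: gen2_mul; apply: gen2_exp; last exact: gen2l.
    by apply: gen2_mul; [apply: gen2_inv; exact: gen2l|exact: gen2r].
split=> //; have [f [fM fI fR]] := iso.
move=> g h; rewrite -fR => -[[x e] _ <-] [[y e'] _ <-]; rewrite -!fM; congr f.
by congr pair; exact: Zp_mulgC.
Qed.

Lemma twisted_case (n_gt0 : (0 < n)%N) : (1 < n)%N -> t2 * t1 = t1 ^+ (2 ^ n + 1) * t2 ->
  isomorphic_to (gen2 t1 t2) (sdprod_by (h_groupAction n_gt0)).
Proof.
move=> n1; rewrite addn1; set r := (2 ^ n).+1 => t21.
have t2X k : t2 * t1 ^+ k = t1 ^+ (r * k) * t2.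
  elim: k => [|k IH]; first by rewrite muln0 mul1g mulg1.
  by rewrite expgS mulgA t21 -mulgA IH mulgA -expgnDr mulnS.
have rr : (r * r = (2 ^ n.-1).+1 * 2 ^ n.+1 + 1)%N.
  by rewrite /r; case: (n) n_gt0 => // m _; rewrite -pred_Sn !expnS; nia.
have t12X : t1 * t2 = t2 * t1 ^+ r.
  by rewrite t2X rr expgnDr mulnC expgM t1M expg1n mul1g expg1.
have t1X k : t1 ^+ k * t2 = t2 * t1 ^+ (k * r).
  elim: k => [|k IH]; first by rewrite mul1g mulg1.
  by rewrite expgSr -mulgA t12X mulgA IH -mulgA -expgnDr mulSn addnC.
(* (t2 t1^k)^2 = t1^(2 + k (r + 1)), and r + 1 = 2 (2^(n-1) + 1), so the exponent is
   2 (1 + (2^(n-1) - 1) (2^(n-1) + 1)) = 2^(2n - 1), a multiple of 2^(n+1) as n > 1. *)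
pose k := (2 ^ n.-1 - 1)%N.
have kE : (2 + (k * r + k) = 2 ^ n.-2 * 2 ^ n.+1)%N.
  rewrite /k /r; case: (n) n1 => [|[|m]] // _; rewrite -!pred_Sn !expnS.
  have : (0 < 2 ^ m)%N by rewrite expn_gt0.
  by move: (2 ^ m)%N => q q0; nia.
pose b := t2 * t1 ^+ k.
have b2 : b * b = 1.
  rewrite /b !mulgA -(mulgA t2) t1X !mulgA -t12 -mulgA -expgnDr -[t1 * t1]/(t1 ^+ 2) -expgnDr kE.
  by rewrite mulnC expgM t1M expg1n.
have tb : t1 * b = b * t1 ^+ r.
  by rewrite /b mulgA t12X -!mulgA -!expgnDr addnC.
have bt j : b <> t1 ^+ j.
  move=> E; apply: (t2t1 (k := j + (2 ^ n.+1 - k))).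
  have kM : (k <= 2 ^ n.+1)%N.
    by rewrite /k; apply: leq_trans (leq_subr _ _) _; rewrite leq_exp2l// -ltnS prednK// ltnW.
  by rewrite expgnDr -E /b -mulgA -expgnDr subnKC// t1M mulg1.
pose phi (u : sdprod_by (h_groupAction n_gt0)) := normal_form t1 b (val u).1 (val u).2.
have phiM : {morph phi : x y / x * y}.
  by move=> u v; rewrite /phi (normal_formM M1 order1 b2 tb).
have inT (e : 'Z_2) (x : 'Z_(2 ^ n.+1)) :
    (e, x) \in finset.setX [set: 'Z_2]%SET [set: 'Z_(2 ^ n.+1)]%SET by rewrite !inE.
have kM : (k <= 2 ^ n.+1)%N.
  by rewrite /k; apply: leq_trans (leq_subr _ _) _; rewrite leq_exp2l// -ltnS prednK// ltnW.
apply: (isomorphic_gen2 phiM).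
- move=> u v /(normal_form_inj M1 order1 bt)[E1 E2]; apply: val_inj.
  by case: (val u) (val v) E1 E2 => [? ?] [? ?] /= -> ->.
- by exists (SdPair _ (inT 0%R 1%R)); rewrite /phi /normal_form /= mul1g expZ1.
- exists (SdPair _ (inT 1%R (2 ^ n.+1 - k)%:R)); rewrite /phi /normal_form /= expg1.
  by rewrite val_Zp_nat// expg_modM// /b -mulgA -expgnDr subnKC// t1M mulg1.
move=> u; apply: gen2_mul; apply: gen2_exp; last exact: gen2l.
by apply: gen2_mul; [exact: gen2r|apply: gen2_exp; exact: gen2l].
Qed.

End TwoGenerators.
End GroupLemmas.

(** * The two automorphisms *)

Section RootsOfUnity.
Variable R : realType.

Lemma omegaX m k : omega R m ^+ k =
  (cos (k%:R * (2 * pi / m%:R)) +i* sin (k%:R * (2 * pi / m%:R)))%C.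
Proof.
elim: k => [|k IH]; first by rewrite expr0 mul0r cos0 sin0.
rewrite exprS IH /omega; set th := 2 * pi / m%:R.
rewrite -natr1 mulrDl mul1r cosD sinD.
by apply/eqP; rewrite eq_complex /=; apply/andP; split; apply/eqP; ring.
Qed.

Lemma omega_half n : omega R (2 ^ n.+1) ^+ (2 ^ n) = -1.
Proof.
rewrite omegaX.
have -> : (2 ^ n)%:R * (2 * pi / (2 ^ n.+1)%:R) = pi :> R.
  have N0 : (2 ^ n)%:R != 0 :> R by rewrite pnatr_eq0 -lt0n expn_gt0.
  by rewrite expnS natrM; field.
by rewrite cospi sinpi; apply/eqP; rewrite eq_complex /= oppr0 !eqxx.
Qed.

End RootsOfUnity.

Section TheMaps.
Variables (R : realType) (n a c : nat) (l : R[i]).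
Hypotheses (n_gt0 : (0 < n)%N) (a_odd : odd a) (l0 : l != 0) (ac : (c * 2 ^ n.-1 = 2 * a + 2)%N).
Variables (S : riemannSurface R) (s : S -> P2 R).
Hypothesis hS : normalization (curve n a l) s.

Let a_gt0 : (0 < a)%N. Proof. exact: odd_gt0. Qed.
Let N := (2 ^ n)%N.
Let om := omega R (2 ^ n.+1).
Let omN : om ^+ N = -1 := omega_half R n.
Let omVN : om^-1 ^+ N = -1. Proof. by rewrite exprVn omN invrN invr1. Qed.

Lemma odd_exprN (x : R[i]) k : odd k -> (- x) ^+ k = - x ^+ k.
Proof. by move=> ko; rewrite exprNn -signr_odd ko expr1 mulN1r. Qed.

Lemma root_neq0 (k : R[i]) : k ^+ N = -1 -> k != 0.
Proof.
move=> kN; apply/eqP => k0; move: kN; rewrite k0 expr0n expn_eq0 /= => /eqP.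
by rewrite eq_sym oppr_eq0 oner_eq0.
Qed.

Lemma branch_polyN x : branch_poly a l (- x) = - branch_poly a l x.
Proof. by rewrite /branch_poly sqrrN odd_exprN// !mulNr. Qed.

Lemma branch_polyV x : x != 0 -> branch_poly a l x^-1 = - branch_poly a l x / x ^+ (4 * a + 4).
Proof.
move=> x0; have x20 : x ^+ 2 != 0 by rewrite expf_neq0.
have E1 : x^-1 ^+ 2 - 1 = - ((x ^+ 2 - 1) / x ^+ 2) by rewrite exprVn; field.
have E2 : (x^-1 ^+ 2 - l ^+ 2) * (x^-1 ^+ 2 - l ^- 2) = (x ^+ 2 - l ^+ 2) * (x ^+ 2 - l ^- 2) / x
  ^+ 4.
  rewrite exprVn; by field; rewrite l0 x0.
rewrite /branch_poly -!mulrA E2 E1 odd_exprN// exprVn expr_div_n -exprM.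
rewrite (_ : (4 * a + 4 = a + 2 * a + a + 4)%N); last by lia.
by rewrite !exprD; field; rewrite x0 l0 expf_neq0.
Qed.

Lemma torus_map_neg (k : R[i]) : k ^+ N = -1 ->
  torus_map n a l (fun x => - x) (fun _ y => k * y).
Proof.
move=> kN; split.
- move=> x y [x0 y0 E]; split; rewrite ?oppr_eq0 ?mulf_neq0// ?root_neq0//.
  by rewrite exprMn kN E branch_polyN mulN1r.
- by move=> x _; exact: derivable_cplxN (@derivable_cplx_id R x).
- move=> T b X Y _ Yc _.
  exact: continuous_cplxM (@continuous_cplx_cst R T b k) Yc.
Qed.

Lemma torus_map_inv (k : R[i]) : k ^+ N = -1 ->
  torus_map n a l (fun x => x^-1) (fun x y => k * y / x ^+ c).
Proof.
move=> kN; split.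
- move=> x y [x0 y0 E]; split; rewrite ?invr_eq0 ?mulf_neq0 ?invr_eq0 ?expf_neq0// ?root_neq0//.
  rewrite expr_div_n exprMn kN E branch_polyV// -exprM mulN1r; congr (_ / _ ^+ _).
  (* c 2^n = 4a + 4 *)
  by move: ac; rewrite /N; case: (n) n_gt0 => // m _; rewrite -pred_Sn expnS; lia.
- by move=> x x0; exact: derivable_cplxV x0 (@derivable_cplx_id R x).
- move=> T b X Y Xc Yc Xb.
  have d1 := continuous_cplxM (@continuous_cplx_cst R T b k) Yc.
  apply: (continuous_cplx_div d1 (continuous_cplxX (n := c) Xc)).
  by rewrite expf_neq0.
Qed.

Lemma acts_by_of (t : S -> S) (u : R[i] -> R[i]) (w : R[i] -> R[i] -> R[i]) :
  (forall p x y, x != 0 -> coord s p x y -> coord s (t p) (u x) (w x y)) -> acts_by s t u w.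
Proof. by move=> H p /torus_coord[pc x0 _]; exact: H. Qed.

(** The formula holds first where x, y <> 0, then at all affine points by continuity;
    conversely it determines a continuous map already on that dense subset. *)
Lemma tau1_exists : exists tau1 : AutRS S, determined_by (tau1_formula n s) tau1.
Proof.
have tm := torus_map_neg omN; have tm' := torus_map_neg omVN; have om0 := root_neq0 omN.
have [||tau tauP] := torus_map_lift a_gt0 hS tm tm'.
- by move=> x y _; rewrite opprK mulKf.
- by move=> x y _; rewrite opprK mulVKf.
exists tau; split.
  move=> p x y pxy; have [_ xh yh] := coord_near hS pxy.
  apply: (acts_by_affine a_gt0 hS (@aut_continuous _ _ tau) tauP pxy).
    exact: continuous_cplxN (holomorphic_fun_near_continuous xh).
  exact: continuous_cplxM (@continuous_cplx_cst R S p om) (holomorphic_fun_near_continuous yh).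
move=> u uc uP; apply: (acts_by_unique a_gt0 hS tm uc (@aut_continuous _ _ tau) _ tauP).
by apply: acts_by_of => p x y _; exact: uP.
Qed.

Lemma tau2_exists : exists tau2 : AutRS S, determined_by (tau2_formula n c s) tau2.
Proof.
have tm := torus_map_inv omN; have tm' := torus_map_inv omVN; have om0 := root_neq0 omN.
have [||tau tauP] := torus_map_lift a_gt0 hS tm tm'.
- move=> x y [x0 _ _]; rewrite invrK; split=> //.
  by rewrite exprVn; field; rewrite om0 expf_neq0.
- move=> x y [x0 _ _]; rewrite invrK; split=> //.
  by rewrite exprVn; field; rewrite om0 expf_neq0.
exists tau; split.
  move=> p x y x0 pxy; have [uc wc] := torus_map_continuous hS tm pxy x0.
  exact: (acts_by_affine a_gt0 hS (@aut_continuous _ _ tau) tauP pxy).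
move=> u uc uP; apply: (acts_by_unique a_gt0 hS tm uc (@aut_continuous _ _ tau) _ tauP).
by apply: acts_by_of => p x y; exact: uP.
Qed.

Lemma aut_ext (f g : AutRS S) :
  (forall p x y, coord s p x y -> x != 0 -> y != 0 ->
    exists x' y', [/\ y' != 0, coord s (f p) x' y' & coord s (g p) x' y']) -> f = g.
Proof.
move=> fg; apply: aut_eq => p; congr (_ p).
apply: (eq_off_finite (finite_off a_gt0 hS) (@aut_continuous _ _ f) (@aut_continuous _ _ g)) => q
  Tq.
have [qc x0 y0] := torus_coord Tq.
have [x' [y' [y'0 fq gq]]] := fg _ _ _ qc x0 y0.
exact: (coord_inj hS fq gq y'0).
Qed.

(** Avoid the branch points, where y = 0, and the fourth roots of unity, where 1/x is
    x or -x. *)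
Lemma generic_point : exists p x y, [/\ coord s p x y, x != 0, y != 0, x^-1 != x & x^-1 != - x].
Proof.
have H := near_right_notin (0 : Cplx R) [:: 0; 1; -1; l; -l; l^-1; -l^-1; 'i%C; -'i%C].
have [x] : exists x : R[i], x \notin [:: 0; 1; -1; l; -l; l^-1; -l^-1; 'i%C; -'i%C].
  by near (0 : R)^'+ => h; exists (0 + h%:C%C); near: h; exact: H.
rewrite !inE !negb_or => /and5P[x0 x1 xN1 xl /and5P[xNl xlV xNlV xi xNi]].
have N0 : (0 < N)%N by rewrite expn_gt0.
pose y : R[i] := N.-root (branch_poly a l x).
have yN : y ^+ N = branch_poly a l x by rewrite /y rootCK.
have [p pxy] := coord_exists hS yN.
exists p, x, y; split=> //.
- apply/eqP => y0; move: yN; rewrite y0 expr0n gtn_eqF//= => /esym/eqP.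
  rewrite /branch_poly !mulf_eq0 !expf_eq0 -{1}(expr1n R[i] 2) -exprVn !subr_eq0 !eqf_sqr.
  by rewrite (negbTE x0) (negbTE x1) (negbTE xN1) (negbTE xl) (negbTE xNl) (negbTE xlV) (negbTE
    xNlV) !andbF.
- apply/eqP => E; have /eqP : x ^+ 2 = 1 by rewrite expr2 -{1}E mulVf.
  by rewrite -(expr1n R[i] 2) eqf_sqr (negbTE x1) (negbTE xN1).
apply/eqP => E; have /eqP : x ^+ 2 = 'i%C ^+ 2.
  by rewrite sqr_i expr2 -[x in x * _]opprK -E mulNr mulVf.
by rewrite eqf_sqr (negbTE xi) (negbTE xNi).
Unshelve. all: by end_near. Qed.

Section Relations.
Variables (t1 t2 : AutRS S).
Hypotheses (T1 : tau1_formula n s t1) (T2 : tau2_formula n c s t2).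

Lemma tau1X k p x y : coord s p x y -> coord s ((t1 ^+ k)%g p) ((-1) ^+ k * x) (om ^+ k * y).
Proof.
move=> pxy; elim: k => [|k IH]; first by rewrite !expr0 !mul1r.
rewrite expgS; have := T1 IH.
by rewrite !exprS !mulrA mulN1r mulNr.
Qed.

Let evenN : (-1) ^+ N = 1 :> R[i].
Proof. by rewrite -signr_odd /N; case: (n) n_gt0 => // m _; rewrite expnS oddM. Qed.

Lemma tau1_half p x y : coord s p x y -> coord s ((t1 ^+ N)%g p) x (- y).
Proof. by move=> /(tau1X N); rewrite evenN omN mul1r mulN1r. Qed.

Lemma tau1_half_neq1 : (t1 ^+ N)%g <> 1%g.
Proof.
have [p [x [y [pxy _ y0 _ _]]]] := generic_point.
move=> E; have := tau1_half pxy; rewrite E => pxNy.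
have [_ /eqP] := affine_point_inj pxy pxNy.
by rewrite -subr_eq0 opprK -mulr2n mulrn_eq0 (negbTE y0).
Qed.

Lemma tau1_full : (t1 ^+ (2 ^ n.+1))%g = 1%g.
Proof.
apply: aut_ext => p x y pxy x0 y0; exists x, y; split=> //.
rewrite expnS mulnC expgM expgS expg1.
by have := tau1_half (tau1_half pxy); rewrite opprK.
Qed.

Lemma tau_squares : (t1 * t1 = t2 * t2)%g.
Proof.
have om0 := root_neq0 omN.
apply: aut_ext => p x y pxy x0 y0; exists x, (om * (om * y)); split.
- by rewrite !mulf_neq0.
- by have := T1 (T1 pxy); rewrite opprK.
have xV0 : x^-1 != 0 by rewrite invr_eq0.
have := T2 xV0 (T2 x0 pxy); rewrite invrK exprVn invrK; congr affine_point.
by rewrite -!mulrA mulVf ?mulr1// expf_neq0.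
Qed.

Lemma tau2_notin k : t2 <> (t1 ^+ k)%g.
Proof.
have [p [x [y [pxy x0 y0 xV xNV]]]] := generic_point.
move=> E; have := T2 x0 pxy; rewrite E => p1.
have [/eqP + _] := affine_point_inj p1 (tau1X k pxy).
by rewrite -signr_odd; case: odd; rewrite ?expr0 ?expr1 ?mul1r ?mulN1r ?(negbTE xV) ?(negbTE xNV).
Qed.

Lemma tau12 p x y : coord s p x y -> x != 0 ->
  coord s ((t1 * t2)%g p) (- x^-1) (om * (om * y / x ^+ c)).
Proof. by move=> pxy x0; exact: T1 (T2 x0 pxy). Qed.

Lemma tau21 p x y : coord s p x y -> x != 0 ->
  coord s ((t2 * t1)%g p) (- x^-1) (om * (om * y) / (- x) ^+ c).
Proof.
move=> pxy x0; have Nx0 : - x != 0 by rewrite oppr_eq0.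
by have := T2 Nx0 (T1 pxy); rewrite invrN.
Qed.

Lemma tau_commute : ~~ odd c -> commute t1 t2.
Proof.
have om0 := root_neq0 omN.
move=> ce; apply: aut_ext => p x y pxy x0 y0.
exists (- x^-1), (om * (om * y / x ^+ c)); split; last 1 first.
- have := tau21 pxy x0; rewrite exprNn -signr_odd (negbTE ce) expr0 mul1r.
  by rewrite !mulrA.
- by rewrite !mulf_neq0 ?invr_eq0 ?expf_neq0.
exact: tau12.
Qed.

Lemma tau_twisted : odd c -> (t2 * t1 = t1 ^+ (2 ^ n + 1) * t2)%g.
Proof.
have om0 := root_neq0 omN.
move=> co; apply: aut_ext => p x y pxy x0 y0.
exists (- x^-1), (- (om * (om * y / x ^+ c))); split.
- by rewrite oppr_eq0 !mulf_neq0 ?invr_eq0 ?expf_neq0.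
- have := tau21 pxy x0; rewrite odd_exprN// invrN mulrN.
  by rewrite !mulrA.
rewrite expgnDr expg1 -mulgA.
exact: tau1_half (tau12 pxy x0).
Qed.

Lemma tau2_half : (t2 ^+ N)%g = (t1 ^+ N)%g.
Proof.
rewrite /N -(prednK n_gt0) expnS !expgM -![(_ ^+ 2)%g]/(_ * _)%g.
by rewrite tau_squares.
Qed.

Lemma tau2_full : (t2 ^+ (2 ^ n.+1))%g = 1%g.
Proof. by rewrite expnS mulnC expgM -/N tau2_half -expgM mulnC -expnS tau1_full. Qed.

End Relations.
End TheMaps.

Theorem theorem4p2 (R : realType) (n a c : nat) (hn : (0 < n)%N) (ha : odd a)
  (l : R[i]) (hl0 : l ^+ 4 != 0) (hl1 : l ^+ 4 != 1)
  (hc : (c * 2 ^ n.-1 = 2 * a + 2)%N)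
  (S : riemannSurface R) (s : S -> P2 R)
  (hS : normalization (curve n a l) s) :
  exists tau1 tau2 : AutRS S,
    [/\ determined_by (tau1_formula n s) tau1,
        determined_by (tau2_formula n c s) tau2,
        has_order tau1 (2 ^ n.+1) /\ has_order tau2 (2 ^ n.+1),
        ~~ odd c ->
          is_abelian (gen2 tau1 tau2) /\
          isomorphic_to (gen2 tau1 tau2) ('Z_(2 ^ n.+1) * 'Z_2)%type &
        odd c ->
          isomorphic_to (gen2 tau1 tau2) (sdprod_by (h_groupAction hn)) /\
          (tau2 * tau1 = tau1 ^+ (2 ^ n + 1) * tau2)%g].
Proof.
have l0 : l != 0 by apply: contraNneq hl0 => ->; rewrite expr0n.
have [t1 [T1 U1]] := tau1_exists ha hS.
have [t2 [T2 U2]] := tau2_exists hn ha l0 hc hS.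
have half := tau1_half_neq1 hn hS T1.
have full := tau1_full hn ha hS T1.
have sq := tau_squares ha hS T1 T2.
have notin := @tau2_notin _ _ _ _ _ _ _ hS _ _ T1 T2.
exists t1, t2; split=> //.
- split; apply: has_order_2power => //; first exact: (tau2_full hn ha hS T1 T2).
  by rewrite (tau2_half hn ha hS T1 T2).
- by move=> ce; exact: (commuting_case half full sq notin (tau_commute ha hS T1 T2 ce)).
move=> co; have tw := tau_twisted hn ha hS T1 T2 co; split=> //.
apply: (twisted_case half full sq notin) => //.
rewrite ltn_neqAle hn andbT; apply/eqP => n1.
by move: hc co; rewrite -n1 expn0 muln1 => ->; rewrite oddD oddM.
Qed.
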